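(* There is an algorithm (IntegratingFactor) which takes as input a rational function $F\in\mathbb{K}(x,y)$, an initial point $(x_0,y_0)$ and a bound $N\in\mathbb{N}$, and returns an integrating factor, ''None'' or FAIL, such that the following holds whenever $\partial_x y=F(x,y)$ has no rational first integral: (1) if the equation admits an integrating factor $U$ such that the numerator and denominator of $\partial_yU/U$ have degree $\leq N$, then the algorithm returns an integrating factor or FAIL; (2) if moreover $U$ is algebraic, then the integrating factor returned (if the output is not FAIL) is algebraic with minimal algebraic extension degree; (3) if the algorithm returns ''None'', then there is no integrating factor $U$ such that the numerator and denominator of $\partial_yU/U$ have degree $\leq N$; (4) if the algorithm returns FAIL, then $(x_0,y_0)$ belongs to an algebraic set of codimension $1$ (depending on $F$ and $N$).
   Context: $\mathbb{K}$ is a finite extension of $\mathbb{Q}$. A first integral of $\partial_x y=F(x,y)$ is a non constant, possibly only locally defined analytic function $\mathcal{F}(x,y)$ with $\partial_x\mathcal{F}+F\partial_y\mathcal{F}=0$; it is rational if $\mathcal{F}\in\mathbb{C}(x,y)$. An integrating factor is a function $U=\partial_y\mathcal{F}$, with $\mathcal{F}$ a first integral, such that $U$ is hyperexponential, i.e. $\partial_yU/U$ (and hence also $\partial_xU/U$) is a rational function; equivalently a non zero hyperexponential $U$ with $\partial_xU+\partial_y(FU)=0$. This includes the algebraic case, in which $U^k\in\mathbb{C}(x,y)$ for some $k\ge1$; the algebraic extension degree of $U$ is then the minimal such $k$, and ''minimal'' means smallest among all algebraic integrating factors of the equation. *)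

(* Defs.v *)
(* MathComp and MathComp-Analysis; the complex numbers are R[i], R : realType. *)
From HB Require Import structures.
From mathcomp Require Import all_boot all_order all_algebra all_field.
From mathcomp Require Import generic_quotient fraction polyXY.
From mathcomp Require Import all_classical all_reals all_analysis.
From mathcomp Require Import complex.

Set Implicit Arguments.
Unset Strict Implicit.
Unset Printing Implicit Defensive.

Import Order.TTheory GRing.Theory Num.Theory.
Import numFieldNormedType.Exports.

Local Open Scope classical_set_scope.
Local Open Scope ring_scope.

(* The regular module R[i]^o is convertible to R[i] and carries the topology
   and the normed-module structure induced by the complex modulus. *)
Notation Cplx R := (complex R)^o.

(* k[x,y]: the outer variable is x and the inner one y, as in the evaluation
   notation p.[x, y] of polyXY. *)
Notation polyxy k := {poly {poly k}}.
Notation ratfun k := {fraction {poly {poly k}}}.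

Section Algebra.
Variable k : fieldType.
Implicit Types (p q d : polyxy k) (G : ratfun k).

Definition is_frac G p q : Prop := q != 0 /\ G = tofrac p / tofrac q.

Definition divides d p : Prop := exists e, p = d * e.

Definition lowest_terms p q : Prop :=
  forall d, divides d p -> divides d q -> d \is a GRing.unit.

(* total degree at most n; the zero polynomial satisfies it for every n *)
Definition tdeg_le (n : nat) p : Prop :=
  forall i j : nat, (n < i + j)%N -> p`_i`_j = 0.

Definition ratfun_deg_le (n : nat) G : Prop :=
  exists p q, [/\ is_frac G p q, lowest_terms p q, tdeg_le n p & tdeg_le n q].

(* G is regular at (x, y), with value v *)
Definition value_at G (x y v : k) : Prop :=
  exists p q, [/\ is_frac G p q, q.[x, y] != 0 & v = p.[x, y] / q.[x, y]].

Definition nonconstant p : Prop := ~ exists c : k, p = c%:P%:P.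

(* Plane hypersurfaces. They are the algebraic sets of pure codimension 1; any
   algebraic subset of the plane of codimension 1 lies in one of them. *)
Definition codim1_algebraic_set (Z : set (k * k)) : Prop :=
  exists p, nonconstant p /\ Z = [set z | p.[z.1, z.2] = 0].

End Algebra.

(* The inclusion k(x,y) -> l(x,y) induced by a field embedding. *)
Definition base_change (k l : fieldType) (iota : {rmorphism k -> l})
    (G : ratfun k) : ratfun l :=
  let r : {ratio {poly {poly k}}} := (repr G)%qT in
  tofrac (map_poly (map_poly iota) (frac r).1)
    / tofrac (map_poly (map_poly iota) (frac r).2).

Section Analysis.
Variable R : realType.
Local Notation C := (Cplx R).
Implicit Types (D : set (C * C)) (f U : C * C -> C) (z w : C * C).
Implicit Types (F B G : ratfun C).

(* Absolutely convergent power series expansion on a polydisc around z; r and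
   M are real because they are comparable to 0 in the order of R[i]. *)
Definition analytic_at f z : Prop :=
  exists (a : nat -> nat -> C) (r M : C),
    [/\ 0 < r,
        forall n : nat,
          \sum_(i < n) \sum_(j < n) `|a i j| * r ^+ (i + j) <= M
      & forall w, `|w.1 - z.1| < r -> `|w.2 - z.2| < r ->
          (fun n : nat => \sum_(i < n) \sum_(j < n)
             a i j * (w.1 - z.1) ^+ i * (w.2 - z.2) ^+ j : C) @ \oo --> f w].

Definition analytic_on D f : Prop := forall z, D z -> analytic_at f z.

Definition domain D : Prop := [/\ D !=set0, open D & connected D].

Definition dx f z : C := 'D_(1, 0) f z.
Definition dy f z : C := 'D_(0, 1) f z.

(* Identities involving rational functions are identities of meromorphic
   functions: they are imposed at the points where these are regular. *)
Definition equal_on D f G : Prop :=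
  forall z v, D z -> value_at G z.1 z.2 v -> f z = v.

Definition first_integral F D f : Prop :=
  [/\ domain D, analytic_on D f,
      exists z w, [/\ D z, D w & f z != f w]
    & forall z v, D z -> value_at F z.1 z.2 v -> dx f z + v * dy f z = 0].

Definition has_rational_first_integral F : Prop :=
  exists D f G, first_integral F D f /\ equal_on D f G.

(* U is not identically zero and (d_y U) / U = B *)
Definition log_dy D U B : Prop :=
  (exists z, D z /\ U z != 0) /\
  forall z v, D z -> value_at B z.1 z.2 v -> dy U z = v * U z.

Definition hyperexponential D U : Prop := exists B, log_dy D U B.

Definition integrating_factor F D U : Prop :=
  hyperexponential D U /\
  exists f, first_integral F D f /\ forall z, D z -> U z = dy f z.

Definition log_dy_deg_le (N : nat) D U : Prop :=
  exists B, log_dy D U B /\ ratfun_deg_le N B.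

Definition rational_power D U (n : nat) : Prop :=
  (0 < n)%N /\ exists G, equal_on D (fun z => U z ^+ n) G.

Definition algebraic D U : Prop := exists n, rational_power D U n.

Definition algebraic_degree D U (n : nat) : Prop :=
  rational_power D U n /\ forall m, rational_power D U m -> (n <= m)%N.

Definition minimal_algebraic_integrating_factor F D U : Prop :=
  integrating_factor F D U /\
  exists n, algebraic_degree D U n /\
    forall D' V m, integrating_factor F D' V -> algebraic_degree D' V m ->
      (n <= m)%N.

End Analysis.

(* Model of computation: partial functions on binary trees, built from pairing
   and projections by composition, branching and while loops. *)
Inductive tree : Type := Leaf | Node of tree & tree.

Inductive prog : Type :=
  | Id
  | Nil
  | Fst
  | Snd
  | Pair of prog & prog
  | Comp of prog & prog         (* Comp p q runs q first *)
  | If of prog & prog & prog    (* Leaf is false *)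
  | While of prog & prog.       (* While c p iterates p as long as c holds *)

Inductive eval : prog -> tree -> tree -> Prop :=
  | eval_Id t : eval Id t t
  | eval_Nil t : eval Nil t Leaf
  | eval_Fst t u : eval Fst (Node t u) t
  | eval_Fst_Leaf : eval Fst Leaf Leaf
  | eval_Snd t u : eval Snd (Node t u) u
  | eval_Snd_Leaf : eval Snd Leaf Leaf
  | eval_Pair p q t u v :
      eval p t u -> eval q t v -> eval (Pair p q) t (Node u v)
  | eval_Comp p q t u v :
      eval q t u -> eval p u v -> eval (Comp p q) t v
  | eval_If_true c p q t u v w :
      eval c t (Node u v) -> eval p t w -> eval (If c p q) t w
  | eval_If_false c p q t w :
      eval c t Leaf -> eval q t w -> eval (If c p q) t w
  | eval_While_stop c p t :
      eval c t Leaf -> eval (While c p) t t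
  | eval_While_step c p t u v t' w :
      eval c t (Node u v) -> eval p t t' -> eval (While c p) t' w ->
      eval (While c p) t w.

Definition code_seq (T : Type) (code : T -> tree) (s : seq T) : tree :=
  foldr (fun x t => Node (code x) t) Leaf s.

Definition code_nat (n : nat) : tree := iter n (Node Leaf) Leaf.

Definition code_int (m : int) : tree :=
  match m with
  | Posz n => Node Leaf (code_nat n)
  | Negz n => Node (Node Leaf Leaf) (code_nat n)
  end.

Definition code_rat (r : rat) : tree :=
  Node (code_int (numq r)) (code_int (denq r)).

(* What the algorithm outputs: an integrating factor U is determined by
   B = (d_y U) / U up to a multiplicative constant, and given as B. *)
Inductive answer (K : fieldExtType rat) : Type :=
  | Factor of ratfun K
  | NoFactor
  | Fail.

Arguments NoFactor {K}.
Arguments Fail {K}.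

Section Coding.
Variable K : fieldExtType rat.

(* An element of the number field is given by its rational coordinates. *)
Definition code_elt (x : K) : tree :=
  code_seq (fun i => code_rat (coord (vbasis {:K}) i x)) (enum 'I_(\dim {:K})).

Definition code_polyxy (p : polyxy K) : tree :=
  code_seq (fun q : {poly K} => code_seq code_elt q) p.

(* A rational function has several codes, one for each way to write it as a
   quotient of polynomials. *)
Definition codes_ratfun (G : ratfun K) (t : tree) : Prop :=
  exists p q, is_frac G p q /\ t = Node (code_polyxy p) (code_polyxy q).

Definition codes_input (F : ratfun K) (z0 : K * K) (N : nat) (t : tree) : Prop :=
  exists2 u, codes_ratfun F u &
    t = Node u (Node (Node (code_elt z0.1) (code_elt z0.2)) (code_nat N)).

Definition codes_answer (a : answer K) (t : tree) : Prop :=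
  match a with
  | Factor B => exists2 u, codes_ratfun B u & t = Node Leaf u
  | NoFactor => t = Leaf
  | Fail => t = Node (Node Leaf Leaf) Leaf
  end.

Definition computable (alg : ratfun K -> K * K -> nat -> answer K) : Prop :=
  exists p : prog, forall F z0 N t, codes_input F z0 N t ->
    exists2 u, eval p t u & codes_answer (alg F z0 N) u.

End Coding.

(* Main.v *)
Require Import Defs.
From HB Require Import structures.
From mathcomp Require Import all_boot all_order all_algebra all_field.
From mathcomp Require Import generic_quotient fraction polyXY.
From mathcomp Require Import all_classical all_reals all_analysis.
From mathcomp Require Import complex.
From mathcomp Require Import ring lra zify.

Set Implicit Arguments.
Unset Strict Implicit.
Unset Printing Implicit Defensive.

Import Order.TTheory GRing.Theory Num.Theory.
Import numFieldNormedType.Exports.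

Local Open Scope classical_set_scope.
Local Open Scope ring_scope.

(** Write F = P/Q. If U is an integrating factor and B = U_y/U, then
    U_x/U = - F_y - F B, hence the differential form (- F_y - F B) dx + B dy is
    closed. For B = p/q this is one polynomial equation in p and q
    ([factor_eq]). Conversely, near a generic point a rational solution B is
    the logarithmic derivative of an integrating factor, obtained by solving
    linear differential equations with power series
    ([factor_eq_integrating_factor]). The analysis serves only to prove this
    equivalence, after which the problem is one of polynomial algebra: find a
    solution p/q of bounded degree, or show that there is none.

    The denominator comes first. In lowest terms, q divides its derivative
    along the vector field Q^3 d_x + P Q^2 d_y ([factor_eq_invariant]). Consider
    the monomials of bounded degree and their successive derivatives along this
    field. If they satisfy a linear relation over the rational functions, then
    a relation with the fewest terms has coefficients whose quotients are
    constant along the field, and one of these quotients is a rational first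
    integral ([first_integral_or_independent]). Otherwise elimination gives
    differential operators which isolate the monomials one after the other; an
    operator applied to q gives a multiple of q, so that q divides the product
    E of the pivots, whatever q is ([pivots_divides]).

    With the denominator E, the numerator has bounded degree and solves an
    affine system of linear equations ([universal_denominator]). A non zero
    solution r of the homogeneous system means that r/E is itself a rational
    integrating factor; its logarithmic derivative is then an answer of
    algebraic degree 1 ([rational_factor_eq], [rational_power_eq]). If the
    homogeneous system has only the zero solution, the affine one either has no
    solution, and the answer is None, or it has exactly one, which is then the
    logarithmic derivative of every integrating factor of bounded degree.
    As for minimality, if the logarithmic derivatives of two algebraic
    integrating factors differ, then a quotient of powers of these factors is a
    rational first integral. Without rational first integral, they all have the
    same logarithmic derivative and the same degree ([power_eq_quotient],
    [minimal_factor]).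

    Each outcome is proved by a finite certificate, made of polynomials over K,
    whose verification is polynomial arithmetic; one of the outcomes always has
    a certificate ([certificates_complete]). Hence the program enumerates all
    trees until one of them is a valid certificate. It fails only on a
    certificate of the existence of a rational first integral, so under the
    hypothesis of the theorem any curve contains the points of failure. Since
    the answer must depend on F and not on the code of F, the program first
    replaces this code by the first tree, in a fixed enumeration, which
    represents the same rational function ([search_program], [algorithm]). *)

(** * The polynomial equations of integrating factors *)

Section Base.
Variable k : comNzRingType.
Implicit Types (p q g h P Q : {poly {poly k}}).

Definition polyDx p : {poly {poly k}} := p^`().
Definition polyDy p : {poly {poly k}} := map_poly (@deriv k) p.

Lemma coef_polyDx p i : (polyDx p)`_i = p`_i.+1 *+ i.+1.
Proof. exact: coef_deriv. Qed.

Lemma coef_polyDy p i : (polyDy p)`_i = (p`_i)^`().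
Proof. by rewrite coef_map_id0 ?deriv0. Qed.

Lemma polyDxD p q : polyDx (p + q) = polyDx p + polyDx q. Proof. exact: derivD. Qed.
Lemma polyDxN p : polyDx (- p) = - polyDx p. Proof. exact: derivN. Qed.
Lemma polyDxM p q : polyDx (p * q) = polyDx p * q + p * polyDx q. Proof. exact: derivM. Qed.
Lemma polyDxB p q : polyDx (p - q) = polyDx p - polyDx q. Proof. exact: derivB. Qed.

Lemma polyDyD p q : polyDy (p + q) = polyDy p + polyDy q.
Proof. by apply/polyP => i; rewrite !(coef_polyDy, coefD) derivD. Qed.

Lemma polyDyN p : polyDy (- p) = - polyDy p.
Proof. by apply/polyP => i; rewrite !(coef_polyDy, coefN) derivN. Qed.

Lemma polyDyB p q : polyDy (p - q) = polyDy p - polyDy q.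
Proof. by rewrite polyDyD polyDyN. Qed.

Lemma polyDyM p q : polyDy (p * q) = polyDy p * q + p * polyDy q.
Proof.
apply/polyP => i; rewrite coef_polyDy coefD !coefM raddf_sum -big_split /=.
by apply: eq_bigr => j _; rewrite derivM !coef_polyDy.
Qed.

Lemma polyDxX p n : polyDx (p ^+ n) = n%:R * p ^+ n.-1 * polyDx p.
Proof.
elim: n => [|n IH]; first by rewrite expr0 !mul0r /polyDx derivC.
rewrite exprS polyDxM IH; case: n {IH} => [|n]; first by rewrite /= expr0; ring.
by rewrite /= exprS; ring.
Qed.

Lemma polyDyX p n : polyDy (p ^+ n) = n%:R * p ^+ n.-1 * polyDy p.
Proof.
elim: n => [|n IH].
  rewrite expr0 !mul0r; apply/polyP => i; rewrite coef_polyDy coef1 coef0.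
  by case: i => [|i] /=; rewrite ?derivC ?deriv0.
rewrite exprS polyDyM IH; case: n {IH} => [|n]; first by rewrite /= expr0; ring.
by rewrite /= exprS; ring.
Qed.

(** For the equation y' = P/Q: Q^2 d_y(P/Q), Q^3 d_y^2(P/Q) and the derivation
    Q^3 (d_x + P/Q d_y), which maps polynomials to polynomials. *)
Definition dyF P Q := polyDy P * Q - P * polyDy Q.
Definition dyyF P Q := polyDy (dyF P Q) * Q - 2%:R * dyF P Q * polyDy Q.
Definition flow P Q p := Q ^+ 3 * polyDx p + P * Q ^+ 2 * polyDy p.

(** With B = p/q, this is the numerator of d_x B + F d_y B + F_y B. *)
Definition hom_eq P Q p q := q * flow P Q p - p * flow P Q q + Q * dyF P Q * p * q.

(** The closedness of the form A dx + B dy, A = - F_y - F B, as a polynomial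
    equation in B = p/q. *)
Definition factor_eq P Q p q := hom_eq P Q p q + dyyF P Q * q ^+ 2.

(** (g/h) satisfies the differential equations of the n-th power of an
    integrating factor with logarithmic derivative p/q. *)
Definition power_eq P Q p q (n : nat) g h :=
  (polyDy g * h - g * polyDy h) * q = n%:R * p * g * h /\
  flow P Q g * h - g * flow P Q h = - (n%:R * Q * dyF P Q * g * h).

Lemma flowD P Q p q : flow P Q (p + q) = flow P Q p + flow P Q q.
Proof. by rewrite /flow polyDxD polyDyD; ring. Qed.

Lemma flowM P Q p q : flow P Q (p * q) = flow P Q p * q + p * flow P Q q.
Proof. by rewrite /flow polyDxM polyDyM; ring. Qed.

Lemma flowX P Q p n : flow P Q (p ^+ n) = n%:R * p ^+ n.-1 * flow P Q p.
Proof. by rewrite /flow polyDxX polyDyX; ring. Qed.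

Definition ev (x y : k) : {rmorphism {poly {poly k}} -> k} :=
  GRing.RMorphism.clone _ _ (horner_eval y \o horner_eval x%:P) _.

Lemma evE p x y : p.[x, y] = ev x y p.
Proof. by []. Qed.

Lemma size_bound p : exists n, (size p <= n)%N /\ forall i, (size (nth 0%R p i) <= n)%N.
Proof.
exists (maxn (size p) (\max_(i < size p) size (nth 0%R p i))); split; first exact: leq_maxl.
move=> i; rewrite leq_max; apply/orP; right.
case: (ltnP i (size p)) => ip; last by rewrite nth_default // size_poly0.
exact: (leq_bigmax (Ordinal ip)).
Qed.

End Base.

Section Fractions.
Variable k : fieldType.
Implicit Types (p q : {poly {poly k}}) (G : ratfun k).

Lemma pi_frac (D : idomainType) (r : {ratio D}) :
  \pi_(FracField.type D)%qT r = tofrac (frac r).1 / tofrac (frac r).2.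
Proof.
have d0 : tofrac (frac r).2 != 0 by rewrite tofrac_eq0 denom_ratioP.
apply: (mulIf d0); rewrite divfK //; unlock tofrac.
rewrite -[LHS]FracField.pi_mul; apply/eqmodP => /=.
rewrite FracField.equivfE /FracField.mulf !numden_Ratio ?mulf_neq0 ?oner_neq0 ?denom_ratioP //.
by rewrite !mulr1 mulrC.
Qed.

Lemma is_frac_repr G : is_frac G (frac (repr G)%qT).1 (frac (repr G)%qT).2.
Proof. by split; [exact: denom_ratioP | rewrite -pi_frac reprK]. Qed.

Lemma frac_repr G : exists p q, is_frac G p q.
Proof. by exists (frac (repr G)%qT).1, (frac (repr G)%qT).2; exact: is_frac_repr. Qed.

Lemma is_frac_eq G p q p' q' : is_frac G p q -> is_frac G p' q' -> p * q' = p' * q.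
Proof.
move=> [q0 ->] [q'0 /eqP]; rewrite eqr_div ?tofrac_eq0 // -!tofracM tofrac_eq.
by move=> /eqP.
Qed.

Lemma is_frac_intro p q : q != 0 -> is_frac (tofrac p / tofrac q) p q.
Proof. by []. Qed.

Lemma eq_is_frac p q p' q' : q != 0 -> q' != 0 -> p * q' = p' * q ->
  tofrac p / tofrac q = tofrac p' / tofrac q'.
Proof.
move=> q0 q'0 e; apply/eqP; rewrite eqr_div ?tofrac_eq0 // -!tofracM tofrac_eq.
exact/eqP.
Qed.

Lemma value_at_eq G p q x y v : is_frac G p q -> value_at G x y v ->
  v * q.[x, y] = p.[x, y].
Proof.
move=> Gpq [p' [q' [Gpq' q'0 ->]]].
have := congr1 (ev x y) (is_frac_eq Gpq Gpq'); rewrite !rmorphM -!evE => e.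
by rewrite mulrAC -e mulfK.
Qed.

(** A value of a rational function may be computed from any representation
    whose denominator does not vanish at the point. *)
Lemma value_at_frac G p q x y : is_frac G p q -> q.[x, y] != 0 ->
  value_at G x y (p.[x, y] / q.[x, y]).
Proof. by move=> h q0; exists p, q. Qed.

End Fractions.

Section BaseChange.
Variables (k l : fieldType) (iota : {rmorphism k -> l}).
Implicit Types (p q P Q g h : {poly {poly k}}) (n : nat).

Definition bc : {rmorphism {poly {poly k}} -> {poly {poly l}}} :=
  GRing.RMorphism.clone _ _ (map_poly (map_poly iota)) _.

Lemma bc_eq0 p : (bc p == 0) = (p == 0).
Proof.
apply/idP/idP => [/eqP e|/eqP->]; last by rewrite rmorph0.
apply/eqP/polyP => i; rewrite coef0; apply: (map_inj_poly (fmorph_inj iota)); first exact: rmorph0.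
by have /polyP/(_ i) := e; rewrite coef_map coef0 rmorph0.
Qed.

Lemma base_change_frac F P Q : is_frac F P Q -> is_frac (base_change iota F) (bc P) (bc Q).
Proof.
move=> FPQ; have [Q0 _] := FPQ; split; first by rewrite bc_eq0.
have e := is_frac_eq (is_frac_repr F) FPQ.
have [d0 _] := is_frac_repr F.
rewrite /base_change; apply: eq_is_frac; [by rewrite (bc_eq0 _) | by rewrite bc_eq0 |].
by have := congr1 bc e; rewrite !rmorphM.
Qed.

Lemma bc_polyDx p : bc (polyDx p) = polyDx (bc p).
Proof. by rewrite /polyDx /bc deriv_map. Qed.

Lemma bc_polyDy p : bc (polyDy p) = polyDy (bc p).
Proof.
apply/polyP => i; have bcE (r : {poly {poly k}}) j : (bc r)`_j = map_poly iota r`_j by rewrite coef_map.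
by rewrite coef_polyDy !bcE coef_polyDy deriv_map.
Qed.

Lemma bc_flow P Q p : bc (flow P Q p) = flow (bc P) (bc Q) (bc p).
Proof. by rewrite /flow rmorphD !(rmorphXn, rmorphM) bc_polyDx bc_polyDy. Qed.

Lemma bc_dyF P Q : bc (dyF P Q) = dyF (bc P) (bc Q).
Proof. by rewrite /dyF rmorphB !rmorphM !bc_polyDy. Qed.

Lemma bc_dyyF P Q : bc (dyyF P Q) = dyyF (bc P) (bc Q).
Proof. by rewrite /dyyF rmorphB !(rmorph_nat, rmorphM) !bc_polyDy bc_dyF. Qed.

Lemma bc_hom_eq P Q p q : bc (hom_eq P Q p q) = hom_eq (bc P) (bc Q) (bc p) (bc q).
Proof. by rewrite /hom_eq rmorphD rmorphB !rmorphM !bc_flow bc_dyF. Qed.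

Lemma bc_factor_eq P Q p q : bc (factor_eq P Q p q) = factor_eq (bc P) (bc Q) (bc p) (bc q).
Proof. by rewrite /factor_eq rmorphD !(rmorphXn, rmorphM) bc_hom_eq bc_dyyF. Qed.

End BaseChange.


(** * Rational and algebraic integrating factors *)

Section RationalFactor.
Variable k : idomainType.
Implicit Types (p q r s g h P Q a b : {poly {poly k}}) (n m : nat).

Lemma polyDxyC p : polyDx (polyDy p) = polyDy (polyDx p).
Proof.
apply/polyP => i; rewrite coef_polyDx !coef_polyDy coef_polyDx.
by rewrite derivMn.
Qed.

(** A rational integrating factor W = r/s yields the solution W_y/W of the
    closedness equation: it is the y-derivative of the homogeneous equation
    divided by W. *)
Lemma rational_factor_eq P Q r s : Q != 0 -> hom_eq P Q r s = 0 ->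
  factor_eq P Q (polyDy r * s - r * polyDy s) (r * s) = 0.
Proof.
move=> Q0 e; apply: (mulfI Q0); rewrite mulr0.
transitivity (Q * (r * s * polyDy (hom_eq P Q r s) - hom_eq P Q r s * polyDy (r * s))
   - 3%:R * polyDy Q * hom_eq P Q r s * (r * s)); last first.
  rewrite e; have -> : polyDy (0 : {poly {poly k}}) = 0 by rewrite /polyDy map_poly0.
  by rewrite !(mulr0, mul0r) !subr0 mulr0.
rewrite /factor_eq /hom_eq /dyyF /flow /dyF !(polyDyD, polyDyB, polyDyN, polyDyM, polyDyX,
  polyDxD, polyDxB, polyDxN, polyDxM, polyDxX) /= !polyDxyC.
ring.
Qed.

Lemma rational_power_eq P Q r s : hom_eq P Q r s = 0 ->
  power_eq P Q (polyDy r * s - r * polyDy s) (r * s) 1 r s.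
Proof.
move=> e; split; first by rewrite mul1r mulrA.
by apply/eqP; rewrite -addr_eq0 mul1r -[X in _ == X]e /hom_eq; apply/eqP; ring.
Qed.

Lemma power_eq_transfer P Q p q p' q' n g h : q != 0 -> q' != 0 -> p * q' = p' * q ->
  power_eq P Q p' q' n g h -> power_eq P Q p q n g h.
Proof.
move=> q0 q'0 pq [e1 e2]; split=> //; apply: (mulfI q'0).
transitivity (q * ((polyDy g * h - g * polyDy h) * q')); first by ring.
rewrite e1; transitivity (n%:R * (p' * q) * g * h); first by ring.
by rewrite -pq; ring.
Qed.

(** Two different logarithmic derivatives of algebraic integrating factors
    give a rational first integral: a power of their quotient. *)
Lemma power_eq_quotient P Q p q p' q' n m g h g' h' :
  power_eq P Q p q n g h -> power_eq P Q p' q' m g' h' ->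
  let a := g ^+ m * h' ^+ n in let b := h ^+ m * g' ^+ n in
  g * h * g' * h' * (flow P Q a * b - a * flow P Q b) = 0 /\
  g * h * g' * h' * q * q' * (polyDy a * b - a * polyDy b) =
    (n * m)%:R * a * b * (g * h * g' * h') * (p * q' - p' * q).
Proof.
move=> [e1 e2] [e3 e4] a b.
have pw (D : {poly {poly k}} -> {poly {poly k}})
    (DM : forall x y, D (x * y) = D x * y + x * D y)
    (DX : forall x i, D (x ^+ i) = i%:R * x ^+ i.-1 * D x) :
  g * h * g' * h' * (D a * b - a * D b) =
  a * b * (m%:R * g' * h' * (D g * h - g * D h) - n%:R * g * h * (D g' * h' - g' * D h')).
  have X (x : {poly {poly k}}) i : x * (i%:R * x ^+ i.-1) = i%:R * x ^+ i.
    by case: i => [|i] /=; rewrite ?expr0 ?exprS; ring.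
  have Da : g * h' * D a = a * (m%:R * D g * h' + n%:R * g * D h').
    rewrite /a DM !DX.
    transitivity (g * (m%:R * g ^+ m.-1) * D g * h' * h' ^+ n +
       h' * (n%:R * h' ^+ n.-1) * D h' * g * g ^+ m); first by ring.
    by rewrite !X; ring.
  have Db : h * g' * D b = b * (m%:R * D h * g' + n%:R * h * D g').
    rewrite /b DM !DX.
    transitivity (h * (m%:R * h ^+ m.-1) * D h * g' * g' ^+ n +
       g' * (n%:R * g' ^+ n.-1) * D g' * h * h ^+ m); first by ring.
    by rewrite !X; ring.
  transitivity (h * g' * b * (g * h' * D a) - g * h' * a * (h * g' * D b)); first by ring.
  by rewrite Da Db; ring.
split.
  by rewrite (pw _ (@flowM _ P Q) (@flowX _ P Q)) e2 e4; ring.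
transitivity (q * q' * (g * h * g' * h' * (polyDy a * b - a * polyDy b))); first by ring.
rewrite (pw _ (@polyDyM _) (@polyDyX _)).
transitivity (a * b * (m%:R * g' * h' * q' * ((polyDy g * h - g * polyDy h) * q)
   - n%:R * g * h * q * ((polyDy g' * h' - g' * polyDy h') * q'))); first by ring.
by rewrite e1 e3 natrM; ring.
Qed.

End RationalFactor.

(** * Double power series *)

Section DoubleSeries.
Variable R : realType.
Local Notation C := (Cplx R).
Implicit Types (a b : nat -> nat -> C) (x y r s e M : C).

Definition sq a (n : nat) x y : C :=
  \sum_(i < n) \sum_(j < n) a i j * x ^+ i * y ^+ j.

Definition sqabs a (n : nat) r : C :=
  \sum_(i < n) \sum_(j < n) `|a i j| * r ^+ (i + j).

(** The content of analytic_at with the coefficients, the radius and the bound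
    made explicit, since these are what the constructions below produce. *)
Definition ps a r M (f : C * C -> C) (z : C * C) : Prop :=
  [/\ 0 < r, forall n, sqabs a n r <= M
    & forall w, `|w.1 - z.1| < r -> `|w.2 - z.2| < r ->
        (fun n : nat => sq a n (w.1 - z.1) (w.2 - z.2)) @ \oo --> f w].

Lemma analytic_atP f z : analytic_at f z <-> exists a r M, ps a r M f z.
Proof. by split=> -[a [r [M [h1 h2 h3]]]]; exists a, r, M; split. Qed.

Lemma real_cplx_ge0 (x : C) : 0 <= x -> x = (complex.Re x)%:C%C.
Proof. by move=> /ger0_real /RRe_real. Qed.

Lemma cvg_real_complex (u : nat -> R) (l : R) :
  u @ \oo --> l -> (fun n => (u n)%:C%C : C) @ \oo --> (l%:C%C : C).
Proof.
move=> ul; apply/cvgrPdist_le => e e0.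
have ee := real_cplx_ge0 (ltW e0).
move: e0; rewrite ee => e0.
have {}e0 : 0 < complex.Re e by move: e0; rewrite (ltcR 0).
near=> n.
rewrite -rmorphB normc_def /= expr0n addr0 sqrtr_sqr lecR.
near: n; move/cvgrPdist_le: ul; exact.
Unshelve. all: by end_near. Qed.

Lemma Re_le_norm (x : C) : `|complex.Re x| <= complex.Re `|x|.
Proof. by rewrite -lecR RRe_real ?normr_real //; exact: normc_ge_Re. Qed.

Lemma Im_le_norm (x : C) : `|complex.Im x| <= complex.Re `|x|.
Proof.
have := Re_le_norm (- 'i%C * x); rewrite normrM normrN.
have -> : `|'i%C : C| = 1.
  by rewrite normc_def /= expr0n expr1n add0r sqrtr1.
by rewrite mul1r; case: x => u v /=; rewrite mulN1r oppr0 mul0r sub0r opprK.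
Qed.

Lemma nondecreasing_bounded_cvg (t : nat -> R) (M : R) :
  (forall n, t n <= t n.+1) -> (forall n, t n <= M) -> cvgn t.
Proof.
move=> tS tM; apply: nondecreasing_is_cvgn; first exact/nondecreasing_seqP.
by exists M => _ [n _ <-].
Qed.

(** The completeness of the complex numbers, in the form used for absolutely
    convergent series: increments are dominated by those of a bounded sequence. *)
Lemma dominated_cvg (u t : nat -> C) M :
  (forall m n, (n <= m)%N -> `|u m - u n| <= t m - t n) ->
  (forall n, t n <= M) -> exists l : C, u @ \oo --> l.
Proof.
move=> ut tM.
pose T n := complex.Re (t n).
have tT m n : (n <= m)%N -> complex.Re `|u m - u n| <= T m - T n.
  by move=> nm; have := ut _ _ nm; rewrite lecE => /andP[_]; rewrite raddfB.
have TM n : T n <= complex.Re M by have := tM n; rewrite lecE => /andP[].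
have Tnd n : T n <= T n.+1.
  by rewrite -subr_ge0; apply: le_trans (tT _ _ (leqnSn n));
    apply: le_trans (Re_le_norm _).
have Tc := nondecreasing_bounded_cvg Tnd TM.
have key (f : C -> R) (fB : forall x y, f (x - y) = f x - f y)
    (fle : forall x, `|f x| <= complex.Re `|x|) : cvgn (f \o u).
  pose g n := T n + f (u n).
  have gnd n : g n <= g n.+1.
    have := le_trans (fle _) (tT _ _ (leqnSn n)).
    by rewrite fB /g ler_norml => /andP[]; lra.
  have gM n : g n <= complex.Re M + (f (u 0%N) + complex.Re M - T 0%N).
    have := le_trans (fle _) (tT _ _ (leq0n n)); rewrite fB ler_norml.
    by have := TM n; rewrite /g => h1 /andP[]; lra.
  have gc := nondecreasing_bounded_cvg gnd gM.
  have -> : f \o u = g \- T by apply/funext => n /=; rewrite /g; lra.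
  exact: is_cvgB.
have /cvg_ex[a ua] := key (fun x => complex.Re x) (fun x y => raddfB _ x y) Re_le_norm.
have /cvg_ex[b ub] := key (fun x => complex.Im x) (fun x y => raddfB _ x y) Im_le_norm.
exists (a%:C%C + 'i%C * b%:C%C).
have -> : u = fun n => ((complex.Re (u n))%:C%C + 'i%C * (complex.Im (u n))%:C%C : C).
  by apply/funext => n; exact: complexE.
apply: cvgD; first exact: cvg_real_complex.
by apply: cvgM; [exact: cvg_cst | exact: cvg_real_complex].
Qed.

(** For a bounded monotone sequence the Cauchy criterion, which is what bounds
    the error uniformly when a double series is truncated. *)
Lemma dominated_tail (t : nat -> C) M :
  (forall n, 0 <= t n) -> (forall n, t n <= t n.+1) -> (forall n, t n <= M) ->
  forall e, 0 < e -> exists N, forall m n, (N <= n)%N -> (n <= m)%N ->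
    t m - t n <= e.
Proof.
move=> t0 tS tM e e0.
have tE n : t n = (complex.Re (t n))%:C%C by exact: real_cplx_ge0.
have eE := real_cplx_ge0 (ltW e0).
pose T n := complex.Re (t n).
have TM n : T n <= complex.Re M by have := tM n; rewrite lecE => /andP[].
have Tnd n : T n <= T n.+1 by have := tS n; rewrite tE (tE n.+1) lecR.
have Tc := nondecreasing_bounded_cvg Tnd TM.
have e0' : 0 < complex.Re e by move: e0; rewrite eE (ltcR 0).
have /cvgrPdist_le/(_ _ e0')[N _ hN] := Tc.
exists N => m n Nn nm.
rewrite (tE m) (tE n) eE -rmorphB lecR.
have Tnd' := homo_leq (@lexx _ _) (@le_trans _ _) Tnd.
have hm : T m <= limn T by apply: nondecreasing_cvgn_le => //; exact/nondecreasing_seqP.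
have := hN n Nn; rewrite /= ler_norml => /andP[]; rewrite -/(T m) -/(T n); lra.
Qed.

Lemma cvg_le_norm (u : nat -> C) (l : C) M :
  u @ \oo --> l -> (exists N, forall n, (N <= n)%N -> `|u n| <= M) -> `|l| <= M.
Proof.
move=> ul [N uM].
have M0 : 0 <= M by exact: le_trans (uM N (leqnn _)).
rewrite -subr_ge0 real_leNgt ?real0 //; last by rewrite rpredB ?ger0_real.
apply/negP => h.
have e0 : 0 < (`|l| - M) / 2 by rewrite divr_gt0 // -opprB oppr_gt0.
have /cvgrPdist_le/(_ _ e0)[N' _ hN] := ul.
have := hN (maxn N N') (leq_maxr _ _); rewrite /= => h1.
have h2 := uM _ (leq_maxl N N').
have : `|l| <= (`|l| - M) / 2 + M.
  rewrite -{1}(subrK (u (maxn N N')) l); apply: le_trans (ler_normD _ _) _.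
  exact: lerD.
rewrite -subr_ge0 => h3.
have : 0 <= - ((`|l| - M) / 2) by apply: le_trans h3 _; rewrite le_eqVlt; apply/orP; left; apply/eqP; field.
by rewrite oppr_ge0 => /le_lt_trans/(_ e0); rewrite ltxx.
Qed.


Lemma sum_box_trunc (F : nat -> nat -> C) n N : (n <= N)%N ->
  \sum_(i < N) \sum_(j < N) (if (i < n)%N && (j < n)%N then F i j else 0) =
  \sum_(i < n) \sum_(j < n) F i j.
Proof.
move=> nN; rewrite (big_ord_widen _ (fun i => \sum_(j < n) F i j) nN).
rewrite [RHS]big_mkcond; apply: eq_bigr => i _.
case: ifP => /= _; last by rewrite big1.
by rewrite (big_ord_widen _ (fun j => F i j) nN) [RHS]big_mkcond.
Qed.

Definition trunc a n i j : C := if (i < n)%N && (j < n)%N then a i j else 0.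

Lemma sqabs_truncB a n N r : (n <= N)%N ->
  sqabs (fun i j => a i j - trunc a n i j) N r = sqabs a N r - sqabs a n r.
Proof.
move=> nN; rewrite /sqabs -(sum_box_trunc (fun i j => `|a i j| * r ^+ (i + j)) nN).
rewrite -sumrB; apply: eq_bigr => i _; rewrite -sumrB; apply: eq_bigr => j _.
by rewrite /trunc; case: ifP => _; rewrite ?subrr ?subr0 ?normr0 ?mul0r.
Qed.

Lemma sqabs_ge0 a n r : 0 <= r -> 0 <= sqabs a n r.
Proof. by move=> r0; do 2!(apply: sumr_ge0 => ? _); rewrite mulr_ge0 ?exprn_ge0. Qed.

Lemma sqabs_le a n N r : 0 <= r -> (n <= N)%N -> sqabs a n r <= sqabs a N r.
Proof. by move=> r0 nN; rewrite -subr_ge0 -sqabs_truncB // sqabs_ge0. Qed.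

Lemma norm_sq_le a n x y r : `|x| <= r -> `|y| <= r -> `|sq a n x y| <= sqabs a n r.
Proof.
move=> xr yr; apply: le_trans (ler_norm_sum _ _ _) _; apply: ler_sum => i _.
apply: le_trans (ler_norm_sum _ _ _) _; apply: ler_sum => j _.
rewrite !normrM !normrX exprD mulrA.
by apply: ler_pM; rewrite ?mulr_ge0 ?exprn_ge0 ?ler_wpM2l ?lerXn2r ?nnegrE //;
  apply: le_trans xr.
Qed.

Lemma sq_truncB a n N x y : (n <= N)%N ->
  sq (fun i j => a i j - trunc a n i j) N x y = sq a N x y - sq a n x y.
Proof.
move=> nN; rewrite /sq -(sum_box_trunc (fun i j => a i j * x ^+ i * y ^+ j) nN).
rewrite -sumrB; apply: eq_bigr => i _; rewrite -sumrB; apply: eq_bigr => j _.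
by rewrite /trunc; case: ifP => _; rewrite ?subrr ?subr0 ?mul0r.
Qed.

Lemma sq_dist_le a n N x y r : (n <= N)%N -> `|x| <= r -> `|y| <= r ->
  `|sq a N x y - sq a n x y| <= sqabs a N r - sqabs a n r.
Proof. by move=> nN xr yr; rewrite -sq_truncB // -sqabs_truncB // norm_sq_le. Qed.

Lemma sq_cvg a M r x y : (forall n, sqabs a n r <= M) ->
  `|x| <= r -> `|y| <= r -> exists l : C, (fun n => sq a n x y) @ \oo --> l.
Proof.
move=> aM xr yr; apply: (dominated_cvg (t := fun n => sqabs a n r)) aM => m n nm.
exact: sq_dist_le.
Qed.

(** ** Re-expansion around another point of the polydisc *)

(** Coefficients at the point (u, v) of the polynomial obtained by truncating
    the series a to bidegree less than n. *)
Definition rexp a n u v k l : C :=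
  \sum_(i < n) \sum_(j < n)
    a i j * ('C(i, k)%:R * u ^+ (i - k)) * ('C(j, l)%:R * v ^+ (j - l)).

Lemma exprD_wide u x i K : (i < K)%N ->
  (u + x) ^+ i = \sum_(k < K) 'C(i, k)%:R * u ^+ (i - k) * x ^+ k.
Proof.
move=> iK; rewrite exprDn.
rewrite (big_ord_widen _ (fun k => u ^+ (i - k) * x ^+ k *+ 'C(i, k)) iK).
rewrite big_mkcond; apply: eq_bigr => k _; case: ltnP => ik.
  by rewrite -mulr_natl mulrA.
by rewrite bin_small // mul0r mul0r.
Qed.

Lemma exprD_part u x i K : 0 <= u -> 0 <= x ->
  \sum_(k < K) 'C(i, k)%:R * u ^+ (i - k) * x ^+ k <= (u + x) ^+ i.
Proof.
move=> u0 x0; rewrite (@exprD_wide _ _ _ (maxn K i.+1)) ?leq_maxr //.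
rewrite (big_ord_widen _ (fun k => 'C(i, k)%:R * u ^+ (i - k) * x ^+ k) (leq_maxl K i.+1)).
rewrite big_mkcond; apply: ler_sum => k _; case: ifP => // _.
by rewrite !mulr_ge0 ?exprn_ge0 ?ler0n.
Qed.

Lemma exchange_big2 n K (G : nat -> nat -> nat -> nat -> C) :
  \sum_(k < K) \sum_(l < K) \sum_(i < n) \sum_(j < n) G i j k l =
  \sum_(i < n) \sum_(j < n) \sum_(k < K) \sum_(l < K) G i j k l.
Proof.
transitivity (\sum_(k < K) \sum_(i < n) \sum_(j < n) \sum_(l < K) G i j k l).
  apply: eq_bigr => k _; rewrite exchange_big; apply: eq_bigr => i _.
  by rewrite exchange_big.
by rewrite exchange_big; apply: eq_bigr => i _; rewrite exchange_big.
Qed.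

Lemma sq_rexp a n K u v x y : (n <= K)%N ->
  sq a n (u + x) (v + y) = sq (rexp a n u v) K x y.
Proof.
move=> nK; rewrite /sq /rexp.
pose G i j k l : C := a i j * ('C(i, k)%:R * u ^+ (i - k) * x ^+ k) *
  ('C(j, l)%:R * v ^+ (j - l) * y ^+ l).
transitivity (\sum_(k < K) \sum_(l < K) \sum_(i < n) \sum_(j < n) G i j k l).
  rewrite exchange_big2; apply: eq_bigr => i _; apply: eq_bigr => j _.
  rewrite (exprD_wide u x (leq_trans (ltn_ord i) nK)).
  rewrite (exprD_wide v y (leq_trans (ltn_ord j) nK)).
  rewrite -mulrA mulr_suml mulr_sumr; apply: eq_bigr => k _.
  by rewrite !mulr_sumr; apply: eq_bigr => l _; rewrite /G; ring.
apply: eq_bigr => k _; apply: eq_bigr => l _.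
rewrite !mulr_suml; apply: eq_bigr => i _; rewrite !mulr_suml; apply: eq_bigr => j _.
by rewrite /G; ring.
Qed.

(** Binomial expansion of the absolute values: each |a i j| is multiplied by
    at most (rho + s)^i (rho + s)^j. *)
Lemma rexp_abs a n K u v rho s : 0 <= s -> `|u| <= rho -> `|v| <= rho ->
  sqabs (rexp a n u v) K s <= sqabs a n (rho + s).
Proof.
move=> s0 ur vr; have r0 : 0 <= rho by apply: le_trans ur.
have step : sqabs (rexp a n u v) K s <=
   \sum_(k < K) \sum_(l < K) \sum_(i < n) \sum_(j < n)
    `|a i j| * ('C(i, k)%:R * rho ^+ (i - k) * s ^+ k) *
     ('C(j, l)%:R * rho ^+ (j - l) * s ^+ l).
  apply: ler_sum => k _; apply: ler_sum => l _.
  rewrite exprD; have -> (A : C) : A * (s ^+ k * s ^+ l) = s ^+ k * s ^+ l * A.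
    by rewrite mulrC.
  apply: (@le_trans _ _ (s ^+ k * s ^+ l * \sum_(i < n) \sum_(j < n)
    `|a i j| * ('C(i, k)%:R * rho ^+ (i - k)) * ('C(j, l)%:R * rho ^+ (j - l)))).
    apply: ler_wpM2l; first by rewrite mulr_ge0 ?exprn_ge0.
    apply: le_trans (ler_norm_sum _ _ _) _; apply: ler_sum => i _.
    apply: le_trans (ler_norm_sum _ _ _) _; apply: ler_sum => j _.
    rewrite !normrM !normrX !normr_nat.
    by apply: ler_pM; rewrite ?mulr_ge0 ?exprn_ge0 //;
      do ?apply: ler_wpM2l; rewrite ?exprn_ge0 //; apply: lerXn2r; rewrite ?nnegrE.
  rewrite mulr_sumr; apply: ler_sum => i _; rewrite mulr_sumr; apply: ler_sum => j _.
  by rewrite le_eqVlt; apply/orP; left; apply/eqP; ring.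
apply: (le_trans step).
rewrite (exchange_big2 n K (fun i j k l =>
  `|a i j| * ('C(i, k)%:R * rho ^+ (i - k) * s ^+ k) *
     ('C(j, l)%:R * rho ^+ (j - l) * s ^+ l))).
apply: ler_sum => i _; apply: ler_sum => j _.
have -> : \sum_(k < K) \sum_(l < K)
    `|a i j| * ('C(i, k)%:R * rho ^+ (i - k) * s ^+ k) *
     ('C(j, l)%:R * rho ^+ (j - l) * s ^+ l) =
   `|a i j| * (\sum_(k < K) 'C(i, k)%:R * rho ^+ (i - k) * s ^+ k) *
    (\sum_(l < K) 'C(j, l)%:R * rho ^+ (j - l) * s ^+ l).
  rewrite -mulrA mulr_suml mulr_sumr; apply: eq_bigr => k _.
  by rewrite !mulr_sumr; apply: eq_bigr => l _; ring.
rewrite exprD mulrA; apply: ler_pM.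
- rewrite mulr_ge0 // sumr_ge0 // => k _.
  by rewrite !mulr_ge0 ?exprn_ge0 ?ler0n.
- by rewrite sumr_ge0 // => k _; rewrite !mulr_ge0 ?exprn_ge0 ?ler0n.
- by apply: ler_wpM2l => //; exact: exprD_part.
- exact: exprD_part.
Qed.

Lemma rexp_trunc a n N u v k l : (n <= N)%N ->
  rexp (fun i j => a i j - trunc a n i j) N u v k l =
  rexp a N u v k l - rexp a n u v k l.
Proof.
move=> nN; rewrite /rexp -(sum_box_trunc (fun i j =>
  a i j * ('C(i, k)%:R * u ^+ (i - k)) * ('C(j, l)%:R * v ^+ (j - l))) nN).
rewrite -sumrB; apply: eq_bigr => i _; rewrite -sumrB; apply: eq_bigr => j _.
by rewrite /trunc; case: ifP => _; rewrite ?subrr ?subr0 ?mul0r.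
Qed.

(** Re-expansion is linear, so the distance of two truncations is controlled
    by the difference of the truncated series. *)
Lemma rexp_dist a n N K u v rho s : (n <= N)%N ->
  0 <= s -> `|u| <= rho -> `|v| <= rho ->
  sqabs (fun k l => rexp a N u v k l - rexp a n u v k l) K s
    <= sqabs a N (rho + s) - sqabs a n (rho + s).
Proof.
move=> nN s0 ur vr; rewrite -sqabs_truncB //.
apply: le_trans (rexp_abs _ _ _ s0 ur vr).
rewrite le_eqVlt; apply/orP; left; apply/eqP.
by apply: eq_bigr => k _; apply: eq_bigr => l _; rewrite rexp_trunc.
Qed.

End DoubleSeries.

Section Reexpand.
Variable R : realType.
Local Notation C := (Cplx R).
Implicit Types (a b : nat -> nat -> C) (x y r s e M : C).

Lemma cvg_sqabs (b : nat -> nat -> C) (B : nat -> nat -> nat -> C) n s :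
  (forall k l, (fun N => B N k l) @ \oo --> b k l) ->
  (fun N => sqabs (B N) n s) @ \oo --> sqabs b n s.
Proof.
move=> Bb; apply: cvg_big => [|i _]; first exact: add_continuous.
apply: cvg_big => [|j _]; first exact: add_continuous.
by apply: cvgM; [exact: cvg_norm | exact: cvg_cst].
Qed.

Lemma cvg_sq (b : nat -> nat -> C) (B : nat -> nat -> nat -> C) n x y :
  (forall k l, (fun N => B N k l) @ \oo --> b k l) ->
  (fun N => sq (B N) n x y) @ \oo --> sq b n x y.
Proof.
move=> Bb; apply: cvg_big => [|i _]; first exact: add_continuous.
apply: cvg_big => [|j _]; first exact: add_continuous.
by do 2!(apply: cvgM; last exact: cvg_cst).
Qed.

Lemma sqabs_ge_term a k l s : 0 <= s ->
  `|a k l| * s ^+ (k + l) <= sqabs a (maxn k l).+1 s.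
Proof.
move=> s0; set n := (maxn k l).+1.
have kn : (k < n)%N by rewrite /n ltnS leq_maxl.
have ln : (l < n)%N by rewrite /n ltnS leq_maxr.
rewrite /sqabs (bigD1 (Ordinal kn)) //= (bigD1 (Ordinal ln)) //= -addrA.
rewrite lerDl addr_ge0 //; first by apply: sumr_ge0 => ? _; rewrite mulr_ge0 ?exprn_ge0.
by do 2!(apply: sumr_ge0 => ? _); rewrite mulr_ge0 ?exprn_ge0.
Qed.

(** The re-expanded truncations form a Cauchy sequence for the norm of
    absolutely convergent series of radius r - rho; their limit represents f
    because each truncation is a polynomial identity. *)
Lemma ps_reexpand a r M f z w rho : ps a r M f z ->
  `|w.1 - z.1| <= rho -> `|w.2 - z.2| <= rho -> rho < r ->
  exists b, ps b (r - rho) M f w /\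
    forall k l, (fun N => rexp a N (w.1 - z.1) (w.2 - z.2) k l) @ \oo --> b k l.
Proof.
case=> r0 aM af; set u := w.1 - z.1; set v := w.2 - z.2 => ur vr rhor.
pose s := r - rho.
have s0 : 0 < s by rewrite subr_gt0.
have rs : rho + s = r by rewrite /s addrC subrK.
have dist n N K : (n <= N)%N ->
  sqabs (fun k l => rexp a N u v k l - rexp a n u v k l) K s
    <= sqabs a N r - sqabs a n r.
  by move=> nN; rewrite -{1}rs -{1}rs; apply: rexp_dist => //; exact: ltW.
have [b bP] : {b : nat -> nat -> C |
    forall k l, (fun N => rexp a N u v k l) @ \oo --> b k l}.
  suff /choice[b bP] : forall kl : nat * nat, exists c : C,
      (fun N => rexp a N u v kl.1 kl.2) @ \oo --> c.
    by exists (fun k l => b (k, l)) => k l; exact: (bP (k, l)).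
  move=> [k l] /=.
  have sp : 0 < s ^+ (k + l) by rewrite exprn_gt0.
  apply: (@dominated_cvg _ _ (fun n => sqabs a n r / s ^+ (k + l)) (M / s ^+ (k + l))).
    move=> m n nm; rewrite -mulrBl ler_pdivlMr //.
    apply: le_trans (dist n m (maxn k l).+1 nm).
    exact: (@sqabs_ge_term (fun k l => rexp a m u v k l - rexp a n u v k l)) (ltW s0).
  by move=> n; rewrite ler_pM2r ?invr_gt0.
exists b; split; last exact: bP.
split; first exact: s0.
  move=> n; rewrite -[sqabs b n _]ger0_norm; last exact/sqabs_ge0/ltW.
  have cv := @cvg_sqabs _ _ n s bP.
  apply: (cvg_le_norm cv); exists 0%N => N _.
  rewrite ger0_norm; last exact/sqabs_ge0/ltW.
  apply: le_trans (rexp_abs _ _ _ (ltW s0) ur vr) _.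
  by rewrite rs.
move=> w' h1 h2.
have a_tail := @dominated_tail _ (fun n => sqabs a n r) M
  (fun n => sqabs_ge0 _ _ (ltW r0)) (fun n => sqabs_le _ (ltW r0) (leqnSn n)) aM.
have fw' : (fun n => sq a n (w'.1 - z.1) (w'.2 - z.2)) @ \oo --> f w'.
  have tri (p q o : C) : `|p - q| < s -> `|q - o| <= rho -> `|p - o| < r.
    move=> pq qo; rewrite -rs [rho + s]addrC -(subrK q p) -addrA; apply: le_lt_trans (ler_normD _ _) _.
    exact: ltr_leD.
  by apply: af; [exact: tri h1 ur | exact: tri h2 vr].
set x := w'.1 - w.1; set y := w'.2 - w.2.
have E1 : w'.1 - z.1 = u + x by rewrite /u /x; ring.
have E2 : w'.2 - z.2 = v + y by rewrite /v /y; ring.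
move: fw'; rewrite E1 E2 => fw'.
have -> : (fun n => sq b n x y) =
   (fun n => (sq b n x y - sq a n (u + x) (v + y)) + sq a n (u + x) (v + y)).
  by apply/funext => n; rewrite subrK.
rewrite -[f w']add0r; apply: cvgD; last exact: fw'.
apply/cvgrPdist_le => e e0; have [N hN] := a_tail e e0.
exists N => // n /= Nn; rewrite sub0r normrN.
rewrite (sq_rexp a u v x y (leqnn n)).
have cv : (fun m => sq (fun k l => rexp a m u v k l - rexp a n u v k l) n x y) @ \oo -->
   (sq (fun k l => b k l - rexp a n u v k l) n x y : C).
  by apply: cvg_sq => k l; apply: cvgB; [exact: bP | exact: cvg_cst].
have -> : sq b n x y - sq (rexp a n u v) n x y =
   sq (fun k l => b k l - rexp a n u v k l) n x y.
  rewrite /sq -sumrB; apply: eq_bigr => i _; rewrite -sumrB; apply: eq_bigr => j _.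
  by ring.
apply: (cvg_le_norm cv); exists n => m nm.
apply: le_trans (norm_sq_le _ _ (ltW h1) (ltW h2)) _.
by apply: le_trans (dist n m n nm) _; exact: hN.
Qed.

(** ** Partial derivatives of power series *)

(** The remainder after the linear term is bounded by |h|^2 M / r^2. *)
Lemma line_derive (c : nat -> C) r M (g : C -> C) : 0 < r ->
  (forall n, \sum_(i < n) `|c i| * r ^+ i <= M) ->
  (forall h, `|h| < r -> (fun n => (\sum_(i < n) c i * h ^+ i) : C) @ \oo --> g h) ->
  (fun h => h^-1 *: (g h - g 0)) @ 0^' --> c 1%N.
Proof.
move=> r0 cM cg.
have M0 : 0 <= M by have := cM 0%N; rewrite big_ord0.
have g0 : g 0 = c 0%N.
  have := cg 0; rewrite normr0 => /(_ r0) h0.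
  have h1 : (fun n => (\sum_(i < n) c i * 0 ^+ i) : C) @ \oo --> c 0%N.
    apply: cvg_near_cst; exists 1%N => // n /= n0.
    case: n n0 => // n _; rewrite big_ord_recl expr0 mulr1 big1 ?addr0 // => i _.
    by rewrite expr0n mulr0.
  exact: (cvg_unique _ h0 h1).
have r2 : 0 < r ^+ 2 by rewrite exprn_gt0.
have bound h : `|h| < r -> `|g h - g 0 - c 1%N * h| <= `|h| ^+ 2 * (M / r ^+ 2).
  move=> hr.
  have cv : (fun n => (\sum_(i < n) c i * h ^+ i - c 0%N - c 1%N * h) : C) @ \oo -->
     g h - g 0 - c 1%N * h.
    by apply: cvgB; [apply: cvgB; [exact: cg | rewrite g0; exact: cvg_cst]
                    | exact: cvg_cst].
  apply: (cvg_le_norm cv); exists 2%N => -[//|[//|n]] _.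
  rewrite !big_ord_recl /= expr0 mulr1 /bump /= expr1 addrA.
  set S := \sum_(i < n) _.
  have -> : c 0%N + c 1%N * h + S - c 0%N - c 1%N * h = S by ring.
  apply: le_trans (ler_norm_sum _ _ _) _.
  apply: (@le_trans _ _ (\sum_(i < n) `|h| ^+ 2 / r ^+ 2 * (`|c i.+2| * r ^+ i.+2))).
    apply: ler_sum => i _; rewrite normrM normrX /= !add1n.
    have -> : `|h| ^+ 2 / r ^+ 2 * (`|c i.+2| * r ^+ i.+2) =
      `|c i.+2| * (`|h| ^+ 2 * r ^+ i).
      by rewrite -[i.+2]add2n exprD; field; rewrite gt_eqF.
    rewrite -[in X in X <= _]add2n exprD.
    apply: ler_wpM2l => //; apply: ler_wpM2l; first by rewrite exprn_ge0.
    by apply: lerXn2r; rewrite ?nnegrE //; exact: ltW.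
  rewrite -mulr_sumr -mulrA [X in _ <= _ * X]mulrC.
  apply: ler_wpM2l; first by rewrite exprn_ge0.
  apply: ler_wpM2l; first by rewrite invr_ge0 ltW.
  apply: le_trans (cM n.+2); rewrite !big_ord_recl /= /bump /= addrA lerDr.
  by rewrite addr_ge0 ?mulr_ge0 ?exprn_ge0 // ltW.
apply/cvgrPdist_le => e e0.
pose K := M / r ^+ 2 + 1.
have K0 : 0 < K by rewrite /K ltr_wpDl // divr_ge0 // ltW.
near=> h.
have h0 : h != 0 by near: h; exact: nbhs_dnbhs_neq.
have hr : `|h| < r.
  near: h; apply: nbhs_dnbhs; exists r => // y /=; by rewrite sub0r normrN.
have he : `|h| <= e / K.
  near: h; apply: nbhs_dnbhs; exists (e / K) => /=; first by rewrite divr_gt0.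
  by move=> y /=; rewrite sub0r normrN => /ltW.
have hn : 0 < `|h| by rewrite normr_gt0.
have -> : c 1%N - h^-1 *: (g h - g 0) = - (h^-1 * (g h - g 0 - c 1%N * h)).
  by rewrite /GRing.scale /=; field.
rewrite normrN normrM normfV ler_pdivrMl //.
apply: le_trans (bound h hr) _; rewrite expr2 -mulrA ler_wpM2l //.
apply: (@le_trans _ _ (e / K * K)); last by rewrite divfK ?gt_eqF.
apply: ler_pM => //; first by rewrite divr_ge0 // ltW.
by rewrite /K lerDl.
Unshelve. all: by end_near. Qed.

End Reexpand.

Section Germs.
Variable R : realType.
Local Notation C := (Cplx R).
Implicit Types (a b : nat -> nat -> C) (x y r s e M : C).

(** Exchanging the variables transfers what is proved for x to y. *)
Definition flip (T : Type) (z : T * T) := (z.2, z.1).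

Lemma flipK (T : Type) (z : T * T) : flip (flip z) = z. Proof. by case: z. Qed.

Lemma sq_flip a n x y : sq (fun i j => a j i) n x y = sq a n y x.
Proof.
by rewrite /sq exchange_big; apply: eq_bigr => i _; apply: eq_bigr => j _; ring.
Qed.

Lemma sqabs_flip a n r : sqabs (fun i j => a j i) n r = sqabs a n r.
Proof.
by rewrite /sqabs exchange_big; apply: eq_bigr => i _; apply: eq_bigr => j _; rewrite addnC.
Qed.

Lemma ps_flip a r M f z :
  ps a r M f z -> ps (fun i j => a j i) r M (f \o @flip C) (flip z).
Proof.
case=> r0 aM af; split=> // [n|w h1 h2]; first by rewrite sqabs_flip.
rewrite (_ : (fun n => _) = (fun n => sq a n (w.2 - z.1) (w.1 - z.2))).
  exact: (af (flip w)).
by apply/funext => n; rewrite sq_flip.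
Qed.

Lemma scale_x_shift (h z1 z2 : C) :
  h *: (1, 0) + (z1, z2) = (h + z1, z2) :> C * C.
Proof.
apply: injective_projections => /=; first by rewrite [_ *: _]mulr1.
by rewrite [_ *: _]mulr0 add0r.
Qed.

Lemma scale_y_shift (h z1 z2 : C) :
  h *: (0, 1) + (z1, z2) = (z1, h + z2) :> C * C.
Proof.
apply: injective_projections => /=; last by rewrite [_ *: _]mulr1.
by rewrite [_ *: _]mulr0 add0r.
Qed.

Lemma ps_derive_x a r M f z : ps a r M f z -> is_derive z (1, 0) f (a 1%N 0%N).
Proof.
case=> r0 aM af.
have key : (fun h : C => h^-1 *: ((f \o shift z) (h *: (1, 0)) - f z)) @ 0^' --> a 1%N 0%N.
  have : (fun h : C => h^-1 *: (f (h + z.1, z.2) - f (0 + z.1, z.2))) @ 0^' --> a 1%N 0%N.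
    apply: (@line_derive _ (fun i => a i 0%N) r M (fun h => f (h + z.1, z.2))) => //.
      case=> [|n]; first by apply: le_trans (aM 0%N); rewrite /sqabs !big_ord0.
      apply: le_trans (aM n.+1); apply: ler_sum => i _.
      rewrite big_ord_recl /= addn0 lerDl sumr_ge0 // => j _.
      by rewrite mulr_ge0 ?exprn_ge0 ?(ltW r0).
    move=> h hr; have := af (h + z.1, z.2); rewrite /= addrK subrr normr0.
    have -> : (fun n => sq a n h 0) = (fun n => \sum_(i < n) a i 0%N * h ^+ i).
      apply/funext => -[|n]; first by rewrite /sq !big_ord0.
      apply: eq_bigr => i _.
      rewrite big_ord_recl /= expr0 mulr1 big1 ?addr0 // => j _.
      by rewrite expr0n mulr0.
    by apply.
  apply: cvg_trans; apply: near_eq_cvg; near=> h.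
  rewrite /= /shift add0r; case: (z) => z1 z2 /=.
  by rewrite scale_x_shift.
split; first by apply/cvg_ex; exists (a 1%N 0%N).
exact: cvg_lim key.
Unshelve. all: by end_near. Qed.


Lemma quotient_flip (f : C * C -> C) (z : C * C) :
  (fun h : C => h^-1 *:
    (((f \o @flip C) \o shift (flip z)) (h *: (1, 0)) - (f \o @flip C) (flip z)))
  = (fun h : C => h^-1 *: ((f \o shift z) (h *: (0, 1)) - f z)).
Proof.
apply/funext => h.
by case: z => z1 z2; rewrite /= /shift /= scale_x_shift scale_y_shift.
Qed.

Lemma dx_flip (f : C * C -> C) z : dx (f \o @flip C) (flip z) = dy f z.
Proof. by rewrite /dx /dy /derive quotient_flip. Qed.

Lemma derivable_flip (f : C * C -> C) z :
  derivable (f \o @flip C) (flip z) (1, 0) <-> derivable f z (0, 1).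
Proof. by rewrite /derivable quotient_flip. Qed.

Lemma flip_flip (T : Type) (f : C * C -> T) : (f \o @flip C) \o @flip C = f.
Proof. by apply/funext => w; rewrite /= flipK. Qed.

Lemma ps_derive_y a r M f z : ps a r M f z -> is_derive z (0, 1) f (a 0%N 1%N).
Proof.
move=> /ps_flip /ps_derive_x[h1 h2]; split; first by apply/derivable_flip.
by rewrite -[LHS]/(dy f z) -dx_flip.
Qed.

Lemma cvg_eq_add (u v w : nat -> C) (p q l : C) :
  u @ \oo --> p -> v @ \oo --> q -> (forall n, w n = u n + v n) -> l = p + q ->
  w @ \oo --> l.
Proof.
move=> up vq E ->; have -> : w = (fun n => u n + v n) by apply/funext.
by apply: cvgD; [exact: up | exact: vq].
Qed.

Lemma sq_shift1 a r M x y (l : C) : (forall n, sqabs a n r <= M) ->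
  `|x| <= r -> `|y| <= r -> (fun n => sq a n x y) @ \oo --> l ->
  (fun n => (\sum_(i < n) \sum_(j < n.+1) a i j * x ^+ i * y ^+ j) : C) @ \oo --> l.
Proof.
move=> aM xr yr al; have r0 : 0 <= r by apply: le_trans xr.
suff ex : (fun n => (\sum_(i < n) a i n * x ^+ i * y ^+ n) : C) @ \oo --> (0 : C).
  apply: (cvg_eq_add al ex); last by rewrite addr0.
  by move=> n; rewrite /sq -big_split; apply: eq_bigr => i _; rewrite big_ord_recr.
have a_tail := @dominated_tail _ (fun n => sqabs a n r) M
  (fun n => sqabs_ge0 _ _ r0) (fun n => sqabs_le _ r0 (leqnSn n)) aM.
apply/cvgrPdist_le => e e0; have [N hN] := a_tail e e0.
exists N => // n /= Nn; rewrite sub0r normrN.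
apply: le_trans (hN n.+1 n Nn (leqnSn n)).
apply: (@le_trans _ _ (\sum_(i < n) `|a i n| * r ^+ (i + n))).
  apply: le_trans (ler_norm_sum _ _ _) _; apply: ler_sum => i _.
  rewrite !normrM !normrX exprD mulrA.
  by apply: ler_pM; rewrite ?mulr_ge0 ?exprn_ge0 ?ler_wpM2l ?lerXn2r ?nnegrE.
have -> : sqabs a n.+1 r = sqabs a n r + \sum_(i < n) `|a i n| * r ^+ (i + n)
    + \sum_(j < n.+1) `|a n j| * r ^+ (n + j).
  rewrite {1}/sqabs big_ord_recr /= -big_split /=; congr (_ + _).
  by apply: eq_bigr => i _; rewrite big_ord_recr.
have -> (p q o : C) : p + q + o - p = q + o by ring.
rewrite lerDl; apply: sumr_ge0 => j _; by rewrite mulr_ge0 ?exprn_ge0.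
Qed.

Definition derx a i j : C := i.+1%:R * a i.+1 j.
Definition dery a i j : C := j.+1%:R * a i j.+1.

Lemma natS_le_pow2 (n : nat) : n.+1%:R <= 2 ^+ n :> C.
Proof. by rewrite -natrX ler_nat ltn_expl. Qed.

(** The factor i+1 produced by the derivation is at most 2^i, hence is
    absorbed by halving the radius. *)
Lemma sqabs_derx a r M n : 0 < r -> (forall n, sqabs a n r <= M) ->
  sqabs (derx a) n (r / 2) <= M / r.
Proof.
move=> r0 aM; rewrite ler_pdivlMr //; apply: le_trans (aM n.+1).
rewrite {2}/sqabs big_ord_recl /=.
apply: le_trans (_ : \sum_(i < n) \sum_(j < n.+1) `|a i.+1 j| * r ^+ (i.+1 + j) <= _); last first.
  rewrite lerDr; apply: sumr_ge0 => j _; by rewrite mulr_ge0 ?exprn_ge0 ?(ltW r0).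
rewrite mulr_suml; apply: ler_sum => i _; rewrite big_ord_recr /=.
rewrite mulr_suml; apply: ler_wpDr; first by rewrite mulr_ge0 ?exprn_ge0 ?(ltW r0).
apply: ler_sum => j _; rewrite /derx normrM normr_nat.
have -> : i.+1%:R * `|a i.+1 j| * (r / 2) ^+ (i + j) * r =
   `|a i.+1 j| * r ^+ (i.+1 + j) * (i.+1%:R / 2 ^+ (i + j)).
  rewrite expr_div_n addSn exprSr; field.
  by rewrite expf_neq0 // pnatr_eq0.
rewrite ler_piMr ?mulr_ge0 ?exprn_ge0 ?(ltW r0) //.
rewrite ler_pdivrMr ?exprn_gt0 // mul1r; apply: le_trans (natS_le_pow2 i) _.
by rewrite -!natrX ler_nat leq_pexp2l // leq_addr.
Qed.

Lemma rexp10 a n u v :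
  rexp a n.+1 u v 1 0 = \sum_(i < n) \sum_(j < n.+1) derx a i j * u ^+ i * v ^+ j.
Proof.
rewrite /rexp big_ord_recl /= big1 ?add0r => [|j _]; last by rewrite bin0n mul0r mulr0 mul0r.
apply: eq_bigr => i _; apply: eq_bigr => j _.
by rewrite bin1 bin0 subn0 /= /bump /= add1n subn1 /= /derx; ring.
Qed.

Lemma ps_half a r M f z w : ps a r M f z ->
  `|w.1 - z.1| < r / 2 -> `|w.2 - z.2| < r / 2 ->
  exists b, ps b (r - r / 2) M f w /\
    forall k l, (fun N => rexp a N (w.1 - z.1) (w.2 - z.2) k l) @ \oo --> b k l.
Proof.
move=> af h1 h2; have [r0 _ _] := af.
apply: (ps_reexpand af (ltW h1) (ltW h2)).
by rewrite ltr_pdivrMr // mulr_natr mulr2n ltrDl.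
Qed.

(** At a point w of the smaller polydisc the derivative is the coefficient
    (1, 0) of the re-expansion at w, and this coefficient is the value at w of
    the derived series. *)
Lemma ps_derx a r M f z : ps a r M f z -> ps (derx a) (r / 2) (M / r) (dx f) z.
Proof.
move=> af; have [r0 aM _] := af; split; first by rewrite divr_gt0.
  by move=> n; exact: sqabs_derx.
move=> w h1 h2; have [b [bf bP]] := ps_half af h1 h2.
have [_ db] := ps_derive_x bf; rewrite /dx db.
set u := w.1 - z.1; set v := w.2 - z.2.
have dM n := @sqabs_derx a r M n r0 aM.
have [l hl] := @sq_cvg _ (derx a) _ _ u v dM (ltW h1) (ltW h2).
suff -> : b 1%N 0%N = l by [].
have h := sq_shift1 dM (ltW h1) (ltW h2) hl.
have h' : (fun n => rexp a n.+1 u v 1 0) @ \oo --> b 1%N 0%N.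
  by have := bP 1%N 0%N; rewrite -cvg_shiftS.
have e : (fun n => rexp a n.+1 u v 1 0) =
   (fun n => (\sum_(i < n) \sum_(j < n.+1) derx a i j * u ^+ i * v ^+ j) : C).
  by apply/funext => n; exact: rexp10.
by rewrite e in h'; exact: (cvg_unique _ h' h).
Qed.

Lemma ps_dery a r M f z : ps a r M f z -> ps (dery a) (r / 2) (M / r) (dy f) z.
Proof.
move=> /ps_flip /ps_derx /ps_flip; rewrite flipK.
have -> // : dx (f \o @flip C) \o @flip C = dy f.
by apply/funext => w; rewrite /= dx_flip.
Qed.

Lemma analytic_dx (f : C * C -> C) (z : C * C) : analytic_at f z -> analytic_at (dx f) z.
Proof.
move=> /analytic_atP[a [r [M /ps_derx h]]]; apply/analytic_atP.
by exists (derx a), (r / 2), (M / r).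
Qed.

Lemma analytic_dy (f : C * C -> C) (z : C * C) : analytic_at f z -> analytic_at (dy f) z.
Proof.
move=> /analytic_atP[a [r [M /ps_dery h]]]; apply/analytic_atP.
by exists (dery a), (r / 2), (M / r).
Qed.

Lemma analytic_derive_x (f : C * C -> C) (z : C * C) : analytic_at f z -> is_derive z (1, 0) f (dx f z).
Proof. by move=> /analytic_atP[a [r [M /ps_derive_x[h1 h2]]]]; split. Qed.

Lemma analytic_derive_y (f : C * C -> C) (z : C * C) : analytic_at f z -> is_derive z (0, 1) f (dy f z).
Proof. by move=> /analytic_atP[a [r [M /ps_derive_y[h1 h2]]]]; split. Qed.

(** Both sides are the coefficient (1, 1) of the series at z. *)
Lemma analytic_schwarz (f : C * C -> C) (z : C * C) : analytic_at f z -> dx (dy f) z = dy (dx f) z.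
Proof.
move=> /analytic_atP[a [r [M h]]].
have [_ h1] := ps_derive_x (ps_dery h); have [_ h2] := ps_derive_y (ps_derx h).
have e : dery a 1 0 = derx a 0 1 by [].
by rewrite [LHS]h1 e [RHS]h2.
Qed.

End Germs.

(** ** Operations on power series *)

Section Operations.
Variable R : realType.
Local Notation C := (Cplx R).
Implicit Types (a b c h u v : nat -> nat -> C) (x y r s e M : C) (f g : C * C -> C) (z w : C * C).

Definition near_in r z w : Prop := `|w.1 - z.1| < r /\ `|w.2 - z.2| < r.

Lemma ps_ext a b r M f g z : (forall i j, a i j = b i j) ->
  (forall w, near_in r z w -> f w = g w) -> ps a r M f z -> ps b r M g z.
Proof.
move=> ab fg; have <- : a = b by apply/funext => i; apply/funext => j.
case=> r0 aM af; split; [exact: r0 | exact: aM | move=> w h1 h2].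
by rewrite -(fg w (conj h1 h2)); exact: af.
Qed.

(** Two sums of one convergent series. *)
Lemma ps_uniq a r M M' f g z w :
  ps a r M f z -> ps a r M' g z -> near_in r z w -> f w = g w.
Proof.
move=> [_ _ h1] [_ _ h2] [w1 w2].
exact: cvg_unique (h1 w w1 w2) (h2 w w1 w2).
Qed.

Lemma ps_smaller a r M f z r' : ps a r M f z -> 0 < r' -> r' <= r -> ps a r' M f z.
Proof.
move=> [r0 aM af] r'0 r'r; split; [exact: r'0|move=> n|move=> w h1 h2]; last first.
  by apply: af; [exact: lt_le_trans h1 r'r | exact: lt_le_trans h2 r'r].
apply: le_trans (aM n); do 2!(apply: ler_sum => ? _).
by apply: ler_wpM2l => //; apply: lerXn2r; rewrite // nnegrE ltW.
Qed.

Lemma ps_add a b r M M' f g z : ps a r M f z -> ps b r M' g z ->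
  ps (fun i j => a i j + b i j) r (M + M') (fun w => f w + g w) z.
Proof.
move=> [r0 aM af] [_ bM bg]; split; [exact: r0|move=> n|move=> w h1 h2].
  apply: le_trans (lerD (aM n) (bM n)); rewrite /sqabs -big_split.
  apply: ler_sum => i _; rewrite -big_split; apply: ler_sum => j _ /=.
  by rewrite -mulrDl; apply: ler_wpM2r; [rewrite exprn_ge0 ?(ltW r0) | exact: ler_normD].
apply: (cvg_eq_add (af w h1 h2) (bg w h1 h2)); last by [].
move=> n.
rewrite /sq -big_split; apply: eq_bigr => i _; rewrite -big_split.
by apply: eq_bigr => j _ /=; ring.
Qed.

Lemma ps_scale (k : C) a r M f z : ps a r M f z ->
  ps (fun i j => k * a i j) r (`|k| * M) (fun w => k * f w) z.
Proof.
move=> [r0 aM af]; split; [exact: r0|move=> n|move=> w h1 h2].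
  apply: le_trans (ler_wpM2l (normr_ge0 k) (aM n)).
  rewrite /sqabs mulr_sumr; apply: ler_sum => i _; rewrite mulr_sumr.
  by apply: ler_sum => j _; rewrite normrM mulrA.
have -> : (fun n => sq (fun i j => k * a i j) n (w.1 - z.1) (w.2 - z.2)) =
  (fun n => k * sq a n (w.1 - z.1) (w.2 - z.2)).
  apply/funext => n; rewrite /sq mulr_sumr; apply: eq_bigr => i _.
  by rewrite mulr_sumr; apply: eq_bigr => j _; ring.
by apply: cvgM; [exact: cvg_cst | exact: af].
Qed.

Lemma ps_zero r z : 0 < r -> ps (fun _ _ => 0) r 0 (fun=> 0) z.
Proof.
move=> r0; split; [exact: r0|move=> n|move=> w _ _].
  by rewrite /sqabs big1 // => i _; rewrite big1 // => j _; rewrite normr0 mul0r.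
have -> : (fun n => sq (fun _ _ => 0) n (w.1 - z.1) (w.2 - z.2)) = (fun=> (0 : C)).
  apply/funext => n; rewrite /sq big1 // => i _; rewrite big1 // => j _.
  by rewrite !mul0r.
exact: cvg_cst.
Qed.

Definition shx a i j : C := if i is i'.+1 then a i' j else 0.

Lemma ps_shx a r M f z : ps a r M f z ->
  ps (shx a) r (r * M) (fun w => (w.1 - z.1) * f w) z.
Proof.
move=> [r0 aM af]; split; [exact: r0|move=> n|move=> w h1 h2].
  case: n => [|n].
    by rewrite /sqabs big_ord0 mulr_ge0 ?(ltW r0) //; apply: le_trans (aM 0%N); rewrite sqabs_ge0 // ltW.
  apply: le_trans (ler_wpM2l (ltW r0) (aM n.+1)).
  rewrite /sqabs big_ord_recl big1 ?add0r => [|j _]; last by rewrite normr0 mul0r.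
  rewrite [X in _ <= _ * X]big_ord_recr /= mulrDr ler_wpDr //.
    by rewrite mulr_ge0 ?(ltW r0) // sumr_ge0 // => j _; rewrite mulr_ge0 ?exprn_ge0 ?(ltW r0).
  rewrite mulr_sumr; apply: ler_sum => i _; rewrite mulr_sumr; apply: ler_sum => j _.
  by rewrite /bump /= ?add1n addSn exprS mulrCA.
rewrite -cvg_shiftS.
have -> : (fun n => sq (shx a) n.+1 (w.1 - z.1) (w.2 - z.2)) = (fun n => (w.1 - z.1) *
    \sum_(i < n) \sum_(j < n.+1) a i j * (w.1 - z.1) ^+ i * (w.2 - z.2) ^+ j).
  apply/funext => n; rewrite /sq big_ord_recl big1 ?add0r => [|j _]; last by rewrite !mul0r.
  rewrite mulr_sumr; apply: eq_bigr => i _; rewrite mulr_sumr; apply: eq_bigr => j _.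
  by rewrite /bump /= ?add1n exprS; ring.
apply: cvgM; first exact: cvg_cst.
by apply: (sq_shift1 aM (ltW h1) (ltW h2)); exact: af.
Qed.

(** Multiplication by the monomial of exponents k and l. *)
Definition sh k l a i j : C :=
  if (k <= i)%N && (l <= j)%N then a (i - k)%N (j - l)%N else 0.

Lemma ps_sh a r M f z k l : ps a r M f z ->
  exists M', ps (sh k l a) r M' (fun w => (w.1 - z.1) ^+ k * (w.2 - z.2) ^+ l * f w) z.
Proof.
move=> h.
have [M1 h1] : exists M', ps (sh 0 l a) r M' (fun w => (w.2 - z.2) ^+ l * f w) z.
  elim: l => [|l [M' IH]].
    exists M; apply: ps_ext h => [i j|w _]; last by rewrite mul1r.
    by rewrite /sh !subn0.
  have := ps_flip (ps_shx (ps_flip IH)); rewrite flipK => h'.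
  exists (r * M'); apply: ps_ext h' => [i j|w _] /=; last by rewrite ?flipK exprS mulrA.
  by rewrite /shx; case: j => [|j]; rewrite /sh ?andbF // ltnS subSS.
elim: k => [|k [M' IH]].
  by exists M1; apply: ps_ext h1 => // w _; rewrite mul1r.
exists (r * M'); apply: ps_ext (ps_shx IH) => [i j|w _] /=; last by rewrite exprS !mulrA.
by rewrite /shx; case: i => [|i]; rewrite /sh // ltnS subSS.
Qed.

(** Multiplication by the polynomial of bidegree less than d with coefficients h. *)
Definition act h (d : nat) a i j : C := \sum_(k < d) \sum_(l < d) h k l * sh k l a i j.

Lemma ps_sum (I : Type) (t : seq I) (A : I -> nat -> nat -> C) (F : I -> C * C -> C) r z :
  0 < r -> (forall i, exists M, ps (A i) r M (F i) z) ->
  exists M, ps (fun i j => \sum_(k <- t) A k i j) r M (fun w => \sum_(k <- t) F k w) z.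
Proof.
move=> r0 AF; elim: t => [|k t [M IH]].
  by exists 0; apply: ps_ext (ps_zero z r0) => *; rewrite big_nil.
have [M' h] := AF k; exists (M' + M); apply: ps_ext (ps_add h IH) => *; rewrite big_cons //.
Qed.

Lemma ps_act h d a r M f z : ps a r M f z ->
  exists M', ps (act h d a) r M' (fun w => sq h d (w.1 - z.1) (w.2 - z.2) * f w) z.
Proof.
move=> af; have [r0 _ _] := af.
pose F (k l : 'I_d) w : C := h k l * ((w.1 - z.1) ^+ k * (w.2 - z.2) ^+ l * f w).
have h1 (k l : 'I_d) : exists M', ps (fun i j => h k l * sh k l a i j) r M' (F k l) z.
  have [M1 h1] := ps_sh k l af.
  by exists (`|h k l| * M1); exact: ps_scale h1.
have h2 (k : 'I_d) := ps_sum (index_enum 'I_d) r0 (h1 k).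
have [M' h'] := ps_sum (index_enum 'I_d) r0 h2.
exists M'; apply: ps_ext h' => [//|w _].
rewrite /sq mulr_suml; apply: eq_bigr => k _; rewrite mulr_suml; apply: eq_bigr => l _.
by rewrite /F; ring.
Qed.

(** ** Recursive definition and majorisation of coefficients *)

(** Recursion on the total degree: the iterates of Psi are stationary in each
    degree. *)
Lemma degree_recursion (Psi : (nat -> nat -> C) -> nat -> nat -> C) :
  (forall u v i j, (forall i' j', (i' + j' < i + j)%N -> u i' j' = v i' j') ->
     Psi u i j = Psi v i j) ->
  exists u, forall i j, u i j = Psi u i j.
Proof.
move=> loc; pose g n := iter n Psi (fun _ _ => 0).
have stab n i j : (i + j < n)%N -> g n.+1 i j = g n i j.
  elim: n i j => // n IH i j ijn.
  rewrite /g iterS [in RHS]iterS; apply: loc => i' j' h; apply: IH.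
  exact: leq_trans h _.
have stab2 n m i j : (i + j < n)%N -> (n <= m)%N -> g m i j = g n i j.
  move=> ijn /subnK <-; elim: (m - n)%N => // k IH.
  by rewrite addSn stab // (leq_trans ijn) // leq_addl.
exists (fun i j => g (i + j).+1 i j) => i j.
rewrite {1}/g iterS; apply: loc => i' j' h.
by apply: stab2.
Qed.

(** Majorant method: if each coefficient is bounded by a geometric term plus m
    times a bound for the coefficients of smaller degree, a geometric bound
    of ratio at least 2 m propagates. *)
Lemma geometric_bound u (K0 S0 m : C) : 0 <= K0 -> 0 <= S0 -> 0 <= m ->
  (forall i j (X : C), 0 <= X ->
     (forall i' j', (i' + j' < i + j)%N -> `|u i' j'| <= X) ->
     `|u i j| <= K0 * S0 ^+ (i + j) + m * X) ->
  exists K S : C, [/\ 0 <= K, 0 < S & forall i j, `|u i j| <= K * S ^+ (i + j)].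
Proof.
move=> K00 S00 m0 H.
(* S >= 2 m makes the second term at most half of the bound, and K = 2 K0
   leaves the other half for the first term *)
pose S := S0 + 2 * m + 1; pose K := 2 * K0.
have S0S : S0 <= S by rewrite /S -addrA lerDl addr_ge0 // mulr_ge0.
have S1 : 1 <= S by rewrite /S lerDr addr_ge0 // mulr_ge0.
have Sp : 0 < S by apply: lt_le_trans S1.
have mS : 2 * m <= S by rewrite /S addrAC lerDr addr_ge0.
exists K, S; split=> //; first by rewrite mulr_ge0.
suff key n i j : (i + j < n)%N -> `|u i j| <= K * S ^+ (i + j) by move=> i j; exact: (key (i + j).+1).
elim: n i j => // n IH i j; rewrite ltnS => ijn.
have h0 : K0 * S0 ^+ (i + j) <= K0 * S ^+ (i + j).
  by apply: ler_wpM2l => //; apply: lerXn2r; rewrite // nnegrE ltW.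
case: (posnP (i + j)) => [ij0|ij0].
  apply: le_trans (H i j 0 _ _) _ => //; first by rewrite ij0.
  rewrite mulr0 addr0; apply: le_trans h0 _.
  by rewrite /K -mulrA ler_peMl ?mulr_ge0 ?exprn_ge0 ?(ltW Sp) // ler1n.
have Sn : S ^+ (i + j) = S * S ^+ (i + j).-1 by rewrite -exprS prednK.
apply: le_trans (H i j (K * S ^+ (i + j).-1) _ _) _.
- by rewrite !mulr_ge0 ?exprn_ge0 ?(ltW Sp).
- move=> i' j' h; apply: le_trans (IH i' j' (leq_trans h ijn)) _.
  apply: ler_wpM2l; first by rewrite mulr_ge0.
  by apply: ler_weXn2l => //; rewrite -ltnS prednK.
apply: (@le_trans _ _ (K0 * S ^+ (i + j) + K0 * S ^+ (i + j))); last first.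
  by rewrite /K le_eqVlt; apply/orP; left; apply/eqP; ring.
apply: lerD => //; rewrite Sn /K.
have -> : m * (2 * K0 * S ^+ (i + j).-1) = K0 * (2 * m * S ^+ (i + j).-1) by ring.
by apply: ler_wpM2l => //; apply: ler_wpM2r => //; rewrite exprn_ge0 // ltW.
Qed.

Lemma geometric_ps u (K S : C) z : 0 <= K -> 0 < S ->
  (forall i j, `|u i j| <= K * S ^+ (i + j)) ->
  exists r M f, ps u r M f z.
Proof.
move=> K0 S0 uK.
(* with this radius the terms are bounded by K 2^-i 2^-j *)
pose r := (2 * S)^-1.
have r0 : 0 < r by rewrite invr_gt0 mulr_gt0.
have half n : \sum_(i < n) (2^-1 : C) ^+ i <= 2.
  have -> : \sum_(i < n) (2^-1 : C) ^+ i = 2 - 2 * 2^-1 ^+ n.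
    elim: n => [|n IH]; first by rewrite big_ord0 expr0; ring.
    by rewrite big_ord_recr /= IH exprS; field.
  by rewrite gerBl mulr_ge0 // exprn_ge0 // invr_ge0.
have bd n : sqabs u n r <= K * 2 * 2.
  apply: (@le_trans _ _ (\sum_(i < n) \sum_(j < n) K * (2^-1 ^+ i * 2^-1 ^+ j))).
    apply: ler_sum => i _; apply: ler_sum => j _.
    apply: le_trans (ler_wpM2r _ (uK i j)) _; first by rewrite exprn_ge0 // ltW.
    rewrite -mulrA -exprMn -exprD.
    suff -> : S * r = 2^-1 by [].
    by rewrite /r; field; rewrite gt_eqF.
  have -> : \sum_(i < n) \sum_(j < n) K * (2^-1 ^+ i * 2^-1 ^+ j) =
     K * (\sum_(i < n) 2^-1 ^+ i) * (\sum_(j < n) 2^-1 ^+ j) :> C.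
    rewrite -mulrA mulr_suml mulr_sumr; apply: eq_bigr => i _.
    by rewrite !mulr_sumr.
  have g0 : 0 <= \sum_(i < n) (2^-1 : C) ^+ i.
    by apply: sumr_ge0 => i _; rewrite exprn_ge0 // invr_ge0.
  by apply: ler_pM => //; [exact: mulr_ge0 | apply: ler_wpM2l].
have ex w : exists l : C, near_in r z w ->
    (fun n => sq u n (w.1 - z.1) (w.2 - z.2)) @ \oo --> l.
  have [[h1 h2]|] := pselect (near_in r z w); last by exists 0.
  by have [l hl] := sq_cvg bd (ltW h1) (ltW h2); exists l.
have [f fP] := choice ex.
by exists r, (K * 2 * 2), f; split; [exact: r0|exact: bd|move=> w h1 h2; exact: fP].
Qed.

Lemma ps_geometric a r M f z : ps a r M f z ->
  exists K S : C, [/\ 0 <= K, 0 < S & forall i j, `|a i j| <= K * S ^+ (i + j)].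
Proof.
move=> [r0 aM _]; exists M, r^-1; split=> [||i j].
- by apply: le_trans (aM 0%N); rewrite sqabs_ge0 // ltW.
- by rewrite invr_gt0.
rewrite exprVn ler_pdivlMr ?exprn_gt0 //.
by apply: le_trans (aM (maxn i j).+1); apply: sqabs_ge_term; exact: ltW.
Qed.

End Operations.

(** * Linear differential equations in one of the variables *)

Section Polynomials.
Variable R : realType.
Local Notation C := (Cplx R).
Implicit Types (a b c h u v : nat -> nat -> C) (x y r s e M : C) (f g : C * C -> C) (z w : C * C).
Implicit Types (p q H : polyxy C).

Lemma horner2_sum p x y (n : nat) : (size p <= n)%N ->
  (forall i, (size (nth 0%R p i) <= n)%N) -> p.[x, y] = sq (fun i j => p`_i`_j) n x y.
Proof.
move=> pn pin; rewrite (horner_coef_wide _ pn) horner_sum; apply: eq_bigr => i _.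
rewrite hornerM -rmorphXn hornerC (horner_coef_wide _ (pin i)).
by rewrite mulr_suml; apply: eq_bigr => j _; rewrite /=; ring.
Qed.

(** A polynomial as a finite power series at z. *)
Lemma poly_center p z : exists h d,
  (forall w, p.[w.1, w.2] = sq h d.+1 (w.1 - z.1) (w.2 - z.2)) /\ h 0 0 = p.[z.1, z.2].
Proof.
have [n [pn pin]] := size_bound p.
exists (rexp (fun i j => p`_i`_j) n.+1 z.1 z.2), n.
have E w : p.[w.1, w.2] = sq (rexp (fun i j => p`_i`_j) n.+1 z.1 z.2) n.+1 (w.1 - z.1) (w.2 - z.2).
  rewrite -(sq_rexp _ z.1 z.2 _ _ (leqnn n.+1)) !subrKC.
  by apply: horner2_sum => [|i]; exact: leq_trans (leqnSn n).
split=> //; rewrite E !subrr /sq big_ord_recl big_ord_recl /= !expr0 !mulr1.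
rewrite big1 ?addr0 => [|i _]; last by rewrite expr0n mulr0.
by rewrite big1 ?addr0 // => i _; rewrite big1 // => j _; rewrite expr0n mulr0 mul0r.
Qed.

Lemma min_radius r1 r2 : 0 < r1 -> 0 < r2 -> exists r, [/\ 0 < r, r <= r1 & r <= r2].
Proof.
move=> h1 h2; have h : 0 < r1 + r2 by rewrite addr_gt0.
exists (r1 * r2 / (r1 + r2)); split.
- by rewrite divr_gt0 // mulr_gt0.
- by rewrite ler_pdivrMr // ler_pM2l // lerDr ltW.
- by rewrite ler_pdivrMr // mulrC ler_pM2l // lerDl ltW.
Qed.

Lemma act_bound h d u i j X : 0 <= X ->
  (forall k l, h k l != 0 -> (k <= i)%N -> (l <= j)%N -> `|u (i - k)%N (j - l)%N| <= X) ->
  `|act h d u i j| <= (\sum_(k < d) \sum_(l < d) `|h k l|) * X.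
Proof.
move=> X0 uX; apply: le_trans (ler_norm_sum _ _ _) _; rewrite mulr_suml.
apply: ler_sum => k _; apply: le_trans (ler_norm_sum _ _ _) _; rewrite mulr_suml.
apply: ler_sum => l _; rewrite normrM; have [->|h0] := eqVneq (h k l) 0.
  by rewrite normr0 !mul0r.
apply: ler_wpM2l => //; rewrite /sh; case: ifP => [/andP[h1 h2]|_]; first exact: uX.
by rewrite normr0.
Qed.

Lemma act_ext h d u v i j :
  (forall k l, h k l != 0 -> (k <= i)%N -> (l <= j)%N ->
      u (i - k)%N (j - l)%N = v (i - k)%N (j - l)%N) ->
  act h d u i j = act h d v i j.
Proof.
move=> uv; apply: eq_bigr => k _; apply: eq_bigr => l _.
have [->|h0] := eqVneq (h k l) 0; first by rewrite !mul0r.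
by rewrite /sh; case: ifP => [/andP[h1 h2]|_] //; rewrite uv.
Qed.

(** The part of a polynomial that raises the degree, once its constant term
    has been used to solve for the coefficient of highest degree. *)
Definition no_const h k l : C := if (k == 0)%N && (l == 0)%N then 0 else h k l.

Lemma act_split h d u i j : act h d.+1 u i j = h 0 0 * u i j + act (no_const h) d.+1 u i j.
Proof.
rewrite /act !big_ord_recl /= /no_const /= mul0r add0r !addrA; congr (_ + _ + _).
by rewrite /sh /= !subn0.
Qed.

Lemma no_const_neq0 h k l : no_const h k l != 0 -> (0 < k + l)%N.
Proof. by rewrite /no_const addn_gt0; case: k l => [|k] [|l] //=; rewrite eqxx. Qed.

(** The coefficients of a solution are computed by recursion on the total
    degree, and the recursion keeps a geometric bound. *)
Lemma ode_coef h d cc dc (t : nat -> nat -> C) (phi : nat -> C) (K S : C) :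
  h 0%N 0%N != 0 -> 0 <= K -> 0 < S ->
  (forall i j, `|t i j| <= K * S ^+ (i + j)) -> (forall j, `|phi j| <= K * S ^+ j) ->
  exists u, [/\ forall j, u 0%N j = phi j,
    forall i j, act h d.+1 (derx u) i j = act cc dc u i j + t i j
  & exists K S : C, [/\ 0 <= K, 0 < S & forall i j, `|u i j| <= K * S ^+ (i + j)]].
Proof.
move=> h0 K0 S0 tK phiK.
(* the equation at order (i, j), solved for the coefficient (i + 1, j) *)
pose Psi v i j : C := if i is i'.+1 then
  (act cc dc v i' j + t i' j - act (no_const h) d.+1 (derx v) i' j) / (i'.+1%:R * h 0%N 0%N)
  else phi j.
have deg_lt i j k l : (k <= i)%N -> (l <= j)%N -> (i - k + (j - l) < i.+1 + j)%N by lia.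
have deg_lt2 i j k l : (k <= i)%N -> (l <= j)%N -> (0 < k + l)%N ->
  ((i - k).+1 + (j - l) < i.+1 + j)%N by lia.
have [u uE] : exists u, forall i j, u i j = Psi u i j.
  apply: degree_recursion => v w [//|i] j vw; rewrite /Psi.
  have -> : act cc dc v i j = act cc dc w i j.
    by apply: act_ext => k l _ h1 h2; apply: vw; exact: deg_lt.
  have -> // : act (no_const h) d.+1 (derx v) i j = act (no_const h) d.+1 (derx w) i j.
  apply: act_ext => k l /no_const_neq0 h3 h1 h2; rewrite /derx vw //.
  exact: deg_lt2.
have iN0 i : i.+1%:R != 0 :> C by rewrite pnatr_eq0.
exists u; split=> [j|i j|]; first by rewrite uE.
  rewrite act_split {1}/derx (uE i.+1 j) /=.
  by field; rewrite h0 /= -mulrS iN0.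
pose hn := `|h 0%N 0%N|.
have hn0 : 0 < hn by rewrite normr_gt0.
pose sumabs (g : nat -> nat -> C) (n : nat) : C := \sum_(k < n) \sum_(l < n) `|g k l|.
have sum0 a n : 0 <= sumabs a n by do 2!apply: sumr_ge0 => ? _.
pose m := (sumabs cc dc + sumabs (no_const h) d.+1) / hn.
pose S1 := S + 1.
have S1S : S <= S1 by rewrite lerDl.
have S11 : 1 <= S1 by rewrite lerDr ltW.
have S10 : 0 < S1 by apply: lt_le_trans S11.
apply: (@geometric_bound _ u (K + K / hn) S1 m).
- by rewrite addr_ge0 // divr_ge0 // ltW.
- exact: ltW.
- by rewrite divr_ge0 ?addr_ge0 ?(ltW hn0).
move=> i j X X0 uX; case: i uX => [|i] uX.
  rewrite uE /Psi add0n; apply: le_trans (phiK j) _.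
  apply: (@le_trans _ _ (K * S1 ^+ j)).
    by apply: ler_wpM2l => //; apply: lerXn2r; rewrite // nnegrE ltW.
  rewrite mulrDl -addrA lerDl addr_ge0 // mulr_ge0 // ?exprn_ge0 ?(ltW S10) //.
    by rewrite divr_ge0 // ltW.
  by rewrite divr_ge0 ?addr_ge0 ?(ltW hn0).
rewrite uE /Psi normrM normfV normrM normr_nat -/hn.
rewrite ler_pdivrMr ?mulr_gt0 ?ltr0n //.
have b1 : `|act cc dc u i j| <= sumabs cc dc * X.
  by apply: act_bound => // k l _ h1 h2; apply: uX; exact: deg_lt.
have b2 : `|act (no_const h) d.+1 (derx u) i j| <= sumabs (no_const h) d.+1 * (i.+1%:R * X).
  apply: act_bound => [|k l /no_const_neq0 h3 h1 h2]; first by rewrite mulr_ge0.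
  rewrite /derx normrM normr_nat; apply: ler_pM => //.
    by rewrite ler_nat ltnS leq_subr.
  by apply: uX; exact: deg_lt2.
have b3 : `|t i j| <= K * S1 ^+ (i.+1 + j).
  apply: le_trans (tK i j) _; apply: ler_wpM2l => //.
  apply: (@le_trans _ _ (S1 ^+ (i + j))); first by apply: lerXn2r; rewrite // nnegrE ltW.
  by apply: ler_weXn2l => //; rewrite addSn.
apply: le_trans (ler_normB _ _) _; apply: le_trans (lerD (ler_normD _ _) (lexx _)) _.
apply: le_trans (lerD (lerD b1 b3) b2) _.
set A := sumabs cc dc; set B := sumabs _ d.+1; set T := S1 ^+ _.
have T0 : 0 <= T by rewrite exprn_ge0 // ltW.
have i1 : 1 <= i.+1%:R :> C by rewrite ler1n.
have -> : ((K + K / hn) * T + m * X) * (i.+1%:R * hn) =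
   i.+1%:R * (A * X) + i.+1%:R * (K * T) + B * (i.+1%:R * X) + i.+1%:R * (hn * (K * T)).
  by rewrite /m -/A -/B; field; rewrite gt_eqF.
have KT0 : 0 <= K * T by rewrite mulr_ge0.
rewrite ler_wpDr ?mulr_ge0 ?(ltW hn0) //.
rewrite lerD2r; apply: lerD; apply: ler_peMl => //.
by apply: mulr_ge0 => //; exact: sum0.
Qed.

Lemma sq_on_axis u v n y : (forall j, u 0%N j = v 0%N j) -> sq u n 0 y = sq v n 0 y.
Proof.
move=> uv; case: n => [|n]; first by rewrite /sq !big_ord0.
rewrite /sq big_ord_recl [RHS]big_ord_recl; congr (_ + _).
  by apply: eq_bigr => j _; rewrite uv.
by rewrite !big1 // => i _; rewrite big1 // => j _; rewrite expr0n mulr0 mul0r.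
Qed.

(** Cauchy problem for a linear equation with initial values on the line
    through z parallel to the y-axis; H(z) <> 0 makes the equation regular. *)
Lemma ode_x H (c e : polyxy C) (s phi : C * C -> C) z :
  H.[z.1, z.2] != 0 -> analytic_at s z -> analytic_at phi z ->
  exists a r M U, [/\ ps a r M U z,
    forall w, near_in r z w ->
      H.[w.1, w.2] * dx U w = c.[w.1, w.2] * U w + e.[w.1, w.2] * s w
    & forall w, near_in r z w -> w.1 = z.1 -> U w = phi w].
Proof.
move=> H0 /analytic_atP[sa [rs [Ms hs]]] /analytic_atP[pa [rp [Mp hp]]].
have [h [d [hE h00]]] := poly_center H z.
have [cc [dc [cE _]]] := poly_center c z.
have [ee [de [eE _]]] := poly_center e z.
have [Mt ht] := ps_act ee de.+1 hs.
have [K1 [S1 [K10 S10 tK]]] := ps_geometric ht.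
have [K2 [S2 [K20 S20 pK]]] := ps_geometric hp.
have le1 i j : K1 * S1 ^+ (i + j) <= (K1 + K2) * (S1 + S2) ^+ (i + j).
  apply: ler_pM; rewrite ?exprn_ge0 ?(ltW S10) ?lerDl //.
  by apply: lerXn2r; rewrite ?nnegrE ?addr_ge0 ?lerDl ?(ltW S10) ?(ltW S20).
have le2 j : K2 * S2 ^+ j <= (K1 + K2) * (S1 + S2) ^+ j.
  apply: ler_pM; rewrite ?exprn_ge0 ?(ltW S20) ?lerDr //.
  by apply: lerXn2r; rewrite ?nnegrE ?addr_ge0 ?lerDr ?(ltW S10) ?(ltW S20).
have h00' : h 0%N 0%N != 0 by rewrite h00.
have [u [u0 uE [K [S [K0 S0 uK]]]]] :=
  @ode_coef h d cc dc.+1 (act ee de.+1 sa) (fun j => pa 0%N j) (K1 + K2) (S1 + S2)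
   h00' (addr_ge0 K10 K20) (addr_gt0 S10 S20)
   (fun i j => le_trans (tK i j) (le1 i j)) (fun j => le_trans (pK 0%N j) (le2 j)).
have [r1 [M1 [U hU]]] := geometric_ps z K0 S0 uK.
have [r10 _ _] := hU; have [rs0 _ _] := hs; have [rp0 _ _] := hp.
have [r2 [r20 r21 r2s]] := min_radius r10 rs0.
have [r3 [r30 r32 r3p]] := min_radius r20 rp0.
have r3h : r3 / 2 <= r3 by rewrite ler_pdivrMr // ler_peMr ?(ltW r30) // ler1n.
have r3h0 : 0 < r3 / 2 by rewrite divr_gt0.
have hU3 := ps_smaller hU r30 (le_trans r32 r21).
have hUr := ps_smaller hU3 r3h0 r3h.
exists u, (r3 / 2), M1, U; split; first exact: hUr.
  move=> w wr.
  have [Ml hl] := ps_act h d.+1 (ps_derx hU3).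
  have [Mc hc] := ps_act cc dc.+1 hUr.
  have hs3 := ps_smaller ht r3h0 (le_trans r3h (le_trans r32 r2s)).
  have hr := ps_add hc hs3.
  have hl' : ps (fun i j => act cc dc.+1 u i j + act ee de.+1 sa i j) (r3 / 2) Ml
     (fun w => sq h d.+1 (w.1 - z.1) (w.2 - z.2) * dx U w) z.
    by apply: ps_ext hl => [i j|//]; exact: uE.
  by have := ps_uniq hl' hr wr; rewrite hE cE eE.
move=> w wr w1; have [_ _ cU] := hUr; have [_ _ cp] := ps_smaller hp r3h0 (le_trans r3h r3p).
have [wr1 wr2] := wr.
have := cU w wr1 wr2; have := cp w wr1 wr2; rewrite w1 subrr.
have -> : (fun n => sq u n 0 (w.2 - z.2)) = (fun n => sq pa n 0 (w.2 - z.2)).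
  by apply/funext => n; exact: sq_on_axis.
by move=> c1 c2; exact: cvg_unique c2 c1.
Qed.

End Polynomials.

(** * Functions of two complex variables *)

Section Calculus.
Variable R : realType.
Local Notation C := (Cplx R).
Implicit Types (x y r s e M : C) (f g : C * C -> C) (z w : C * C).
Implicit Types (p q : polyxy C).

Lemma near_inE r z w : near_in r z w <-> ball z r w.
Proof.
rewrite /near_in; split=> -[h1 h2]; split.
- by rewrite /ball /= distrC.
- by rewrite /ball /= distrC.
- by move: h1; rewrite /ball /= distrC.
- by move: h2; rewrite /ball /= distrC.
Qed.

Lemma nbhs_near_in z (P : set (C * C)) :
  nbhs z P <-> exists2 r, 0 < r & forall w, near_in r z w -> P w.
Proof.
split=> [/nbhs_ballP[r r0 h]|[r r0 h]]; first by exists r => // w /near_inE; exact: h.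
by apply/nbhs_ballP; exists r => // w /near_inE; exact: h.
Qed.

Lemma near_in_center r z : 0 < r -> near_in r z z.
Proof. by move=> r0; rewrite /near_in !subrr normr0. Qed.

Lemma near_in_open r z w : near_in r z w -> nbhs w (near_in r z).
Proof.
move=> /near_inE h.
have : nbhs w (ball z r).
  by apply: open_nbhs_nbhs; split=> //; exact: ball_open.
by apply: filterS => u; move/near_inE.
Qed.

(** ** Rules of derivation *)

Lemma is_derive_affine (f : C * C -> C) z (v : C * C) (c : C) :
  (forall h : C, f (h *: v + z) = h * c + f z) -> is_derive z v f c.
Proof.
move=> fE.
have key : (fun h : C => h^-1 *: ((f \o shift z) (h *: v) - f z)) @ 0^' --> c.
  apply: cvg_near_cst; near=> h.
  have h0 : h != 0 by near: h; exact: nbhs_dnbhs_neq.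
  by rewrite /= /shift fE addrK [_ *: _]mulKf.
split; first by apply/cvg_ex; exists c.
exact: cvg_lim key.
Unshelve. all: by end_near. Qed.

Lemma is_derive_fst_x z : is_derive z (1, 0) (fst : C * C -> C) 1.
Proof. by apply: is_derive_affine => h; case: z => a b; rewrite scale_x_shift mulr1. Qed.

Lemma is_derive_snd_x z : is_derive z (1, 0) (snd : C * C -> C) 0.
Proof. by apply: is_derive_affine => h; case: z => a b; rewrite scale_x_shift mulr0 add0r. Qed.

Lemma is_derive_fst_y z : is_derive z (0, 1) (fst : C * C -> C) 0.
Proof. by apply: is_derive_affine => h; case: z => a b; rewrite scale_y_shift mulr0 add0r. Qed.

Lemma is_derive_snd_y z : is_derive z (0, 1) (snd : C * C -> C) 1.
Proof. by apply: is_derive_affine => h; case: z => a b; rewrite scale_y_shift mulr1. Qed.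

Lemma is_derive_mul f g z (v : C * C) (a b : C) :
  is_derive z v f a -> is_derive z v g b ->
  is_derive z v (fun w => f w * g w) (a * g z + f z * b).
Proof.
move=> hf hg; have h := is_deriveM hf hg.
have -> : a * g z + f z * b = f z * b + g z * a by ring.
exact: h.
Qed.

Lemma is_derive_add f g z (v : C * C) (a b : C) :
  is_derive z v f a -> is_derive z v g b ->
  is_derive z v (fun w => f w + g w) (a + b).
Proof. by move=> hf hg; have := is_deriveD hf hg. Qed.

Lemma is_derive_const (c : C) z (v : C * C) : is_derive z v (fun=> c) 0.
Proof. exact: is_derive_cst. Qed.

Lemma is_derive_uniq f z (v : C * C) (a b : C) :
  is_derive z v f a -> is_derive z v f b -> a = b.
Proof. by move=> [_ <-] [_ <-]. Qed.

Lemma is_derive_pow f z (v : C * C) (a : C) (n : nat) : is_derive z v f a ->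
  is_derive z v (fun w => f w ^+ n) (n%:R * f z ^+ n.-1 * a).
Proof.
move=> hf; elim: n => [|n IH].
  by rewrite !mul0r; exact: is_derive_const.
have := is_derive_mul hf IH.
have -> : (fun w => f w * f w ^+ n) = (fun w => f w ^+ n.+1).
  by apply/funext => w; rewrite exprS.
congr is_derive; case: n {IH} => [|n] /=; first by rewrite !expr0; ring.
by rewrite exprS; ring.
Qed.

Lemma is_derive_inv f z (v : C * C) (a : C) : f z != 0 -> is_derive z v f a ->
  is_derive z v (fun w => (f w)^-1) (- a / f z ^+ 2).
Proof.
move=> fz [h1 h2]; split; first exact: derivableV.
by rewrite deriveV // h2 [LHS]mulrC mulrN mulNr.
Qed.


Lemma is_derive_inner (c : {poly C}) z (v : C * C) (b : C) :
  is_derive z v (snd : C * C -> C) b ->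
  is_derive z v (fun w => c.[w.2]) (c^`().[z.2] * b).
Proof.
move=> hb; elim/poly_ind: c => [|c k IH].
  rewrite deriv0 horner0 mul0r.
  have -> : (fun w : C * C => (0 : {poly C}).[w.2]) = (fun=> 0).
    by apply/funext => w; rewrite horner0.
  exact: is_derive_const.
have := is_derive_add (is_derive_mul IH hb) (is_derive_const k z v).
have -> : (fun w : C * C => c.[w.2] * w.2 + k) = (fun w => (c * 'X + k%:P).[w.2]).
  by apply/funext => w; rewrite !hornerE.
by congr is_derive; rewrite derivMXaddC hornerD hornerMX; ring.
Qed.

Lemma horner2_cons p (c : {poly C}) x y :
  (p * 'X + c%:P).[x, y] = p.[x, y] * x + c.[y].
Proof. by rewrite hornerD hornerMX hornerC hornerD hornerM hornerC. Qed.

Lemma polyDy_cons p (c : {poly C}) :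
  polyDy (p * 'X + c%:P) = polyDy p * 'X + (c^`())%:P.
Proof.
apply/polyP => i; rewrite coef_map_id0 ?deriv0 // !coefD !coefMX !coefC.
by case: i => [|i] /=; rewrite ?addr0 ?add0r // coef_map_id0 ?deriv0.
Qed.

Lemma is_derive_poly_x p z :
  is_derive z (1, 0) (fun w : C * C => p.[w.1, w.2]) (polyDx p).[z.1, z.2].
Proof.
elim/poly_ind: p => [|p c IH].
  rewrite /polyDx deriv0 !horner0.
  have -> : (fun w : C * C => (0 : polyxy C).[w.1, w.2]) = (fun=> 0).
    by apply/funext => w; rewrite !horner0.
  exact: is_derive_const.
have := is_derive_add (is_derive_mul IH (is_derive_fst_x z))
  (is_derive_inner c (is_derive_snd_x z)).
have -> : (fun w : C * C => p.[w.1, w.2] * w.1 + c.[w.2]) =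
   (fun w => (p * 'X + c%:P).[w.1, w.2]).
  by apply/funext => w; rewrite horner2_cons.
congr is_derive; rewrite /polyDx derivMXaddC.
by rewrite hornerD hornerMX hornerD hornerM hornerC; ring.
Qed.

Lemma is_derive_poly_y p z :
  is_derive z (0, 1) (fun w : C * C => p.[w.1, w.2]) (polyDy p).[z.1, z.2].
Proof.
elim/poly_ind: p => [|p c IH].
  rewrite /polyDy map_poly0 !horner0.
  have -> : (fun w : C * C => (0 : polyxy C).[w.1, w.2]) = (fun=> 0).
    by apply/funext => w; rewrite !horner0.
  exact: is_derive_const.
have := is_derive_add (is_derive_mul IH (is_derive_fst_y z))
  (is_derive_inner c (is_derive_snd_y z)).
have -> : (fun w : C * C => p.[w.1, w.2] * w.1 + c.[w.2]) =
   (fun w => (p * 'X + c%:P).[w.1, w.2]).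
  by apply/funext => w; rewrite horner2_cons.
by congr is_derive; rewrite polyDy_cons horner2_cons; ring.
Qed.

(** ** Continuity, and density of the complement of a curve *)

Lemma continuous_poly p : continuous (fun w : C * C => p.[w.1, w.2]).
Proof.
have cin (c : {poly C}) : continuous (fun w : C * C => c.[w.2]).
  elim/poly_ind: c => [|c k IH] z.
    have -> : (fun w : C * C => (0 : {poly C}).[w.2]) = (fun=> 0).
      by apply/funext => w; rewrite horner0.
    exact: cvg_cst.
  have -> : (fun w : C * C => (c * 'X + k%:P).[w.2]) = (fun w => c.[w.2] * w.2 + k).
    by apply/funext => w; rewrite !hornerE.
  apply: cvgD; last exact: cvg_cst.
  by apply: cvgM; [exact: IH | exact: cvg_snd].
elim/poly_ind: p => [|p c IH] z.
  have -> : (fun w : C * C => (0 : polyxy C).[w.1, w.2]) = (fun=> 0).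
    by apply/funext => w; rewrite !horner0.
  exact: cvg_cst.
have -> : (fun w : C * C => (p * 'X + c%:P).[w.1, w.2]) =
    (fun w => p.[w.1, w.2] * w.1 + c.[w.2]).
  by apply/funext => w; rewrite horner2_cons.
apply: cvgD; last exact: cin.
by apply: cvgM; [exact: IH | exact: cvg_fst].
Qed.

Lemma continuous_neq0 f z : {for z, continuous f} -> f z != 0 -> \forall w \near z, f w != 0.
Proof.
move=> fc fz; have e0 : 0 < `|f z| by rewrite normr_gt0.
have /cvgrPdist_lt/(_ _ e0) := fc.
by apply: filterS => w; apply: contraTneq => ->; rewrite subr0 ltxx.
Qed.

Lemma poly_neq0_near p z : p.[z.1, z.2] != 0 -> \forall w \near z, p.[w.1, w.2] != 0.
Proof. by move=> pz; apply: (@continuous_neq0 (fun w => p.[w.1, w.2])) => //; exact: continuous_poly. Qed.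

Lemma disc_nonroot (c : {poly C}) x r : c != 0 -> 0 < r ->
  exists y, `|y - x| < r /\ c.[y] != 0.
Proof.
move=> c0 r0; pose t i : C := x + r / i.+2%:R.
suff [i _ h] : exists2 i, (i < size c)%N & c.[t i] != 0.
  exists (t i); split=> //; rewrite /t addrC addKr.
  rewrite ger0_norm ?divr_ge0 ?(ltW r0) // ltr_pdivrMr //.
  by rewrite ltr_pMr // ltr1n.
apply: contrapT => H.
have h1 : all (root c) [seq t i | i <- iota 0 (size c)].
  apply/allP => _ /mapP[i + ->].
  rewrite mem_iota add0n => ic; apply/rootP; apply/eqP; apply: contrapT => /negP h.
  by apply: H; exists i.
have h2 : uniq [seq t i | i <- iota 0 (size c)].
  rewrite map_inj_uniq ?iota_uniq // => i j /addrI /(mulfI (lt0r_neq0 r0)) /invr_inj /eqP.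
  by rewrite eqr_nat => /eqP[].
by have := max_poly_roots c0 h1 h2; rewrite size_map size_iota ltnn.
Qed.

(** Choose y outside of the zeros of the leading coefficient, then x outside of
    the zeros of the polynomial obtained for this y. *)
Lemma poly_dense p (W : set (C * C)) z : p != 0 -> nbhs z W ->
  exists w, W w /\ p.[w.1, w.2] != 0.
Proof.
move=> p0 /nbhs_near_in[r r0 rW].
have lp : lead_coef p != 0 by rewrite lead_coef_eq0.
have [y [yr hy]] := disc_nonroot z.2 lp r0.
pose c : {poly C} := map_poly (horner_eval y) p.
have c0 : c != 0.
  apply/eqP => /polyP/(_ (size p).-1); rewrite coef_map coef0 /= /horner_eval.
  by apply/eqP.
have [x [xr hx]] := disc_nonroot z.1 c0 r0.
exists (x, y); split; first by apply: rW.
suff -> : p.[x, y] = c.[x] by [].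
rewrite (horner_coef_wide _ (leqnn (size p))) horner_sum (@horner_coef_wide _ (size p) c); last first.
  exact: size_poly.
apply: eq_bigr => i _.
by rewrite hornerM -rmorphXn hornerC coef_map.
Qed.

(** ** Analytic functions are continuous; quotients of polynomials are analytic *)

Lemma analytic_continuous f z : analytic_at f z -> {for z, continuous f}.
Proof.
move=> /analytic_atP[a [r [M h]]]; have [r0 aM af] := h.
have M0 : 0 <= M by apply: le_trans (aM 0%N); rewrite sqabs_ge0 // ltW.
have bound t w : 0 < t -> t <= r -> near_in t z w -> `|f w - a 0%N 0%N| <= t / r * M.
  move=> t0 tr [w1 w2].
  have cv := af w (lt_le_trans w1 tr) (lt_le_trans w2 tr).
  have cv' : (fun n => (sq a n (w.1 - z.1) (w.2 - z.2) - a 0%N 0%N) : C) @ \oo -->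
      (f w - a 0%N 0%N : C).
    by apply: cvgB; [exact: cv | exact: cvg_cst].
  apply: (cvg_le_norm cv'); exists 1%N => -[//|n] _.
  pose b i j : C := if (i == 0)%N && (j == 0)%N then 0 else a i j.
  have -> : sq a n.+1 (w.1 - z.1) (w.2 - z.2) - a 0%N 0%N = sq b n.+1 (w.1 - z.1) (w.2 - z.2).
    rewrite /sq big_ord_recl [in RHS]big_ord_recl [X in X + _ - _]big_ord_recl.
    rewrite [X in _ = X + _]big_ord_recl /= !expr0 /b /= !mulr1 add0r.
    set A := \sum_(i < n) _; set B := \sum_(i < n) _.
    by have -> (u v k : C) : u + v + k - u = v + k by ring.
  apply: le_trans (norm_sq_le _ _ (ltW w1) (ltW w2)) _.
  apply: le_trans (ler_wpM2l _ (aM n.+1)); last by rewrite divr_ge0 // ltW.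
  rewrite /sqabs mulr_sumr; apply: ler_sum => i _; rewrite mulr_sumr; apply: ler_sum => j _.
  rewrite /b; case: ifP => [_|ij0].
    by rewrite normr0 mul0r !mulr_ge0 ?invr_ge0 ?exprn_ge0 ?(ltW r0) ?(ltW t0).
  rewrite mulrCA; apply: ler_wpM2l => //.
  have /prednK <- : (0 < i + j)%N by rewrite lt0n addn_eq0 ij0.
  rewrite !exprS mulrA divfK ?gt_eqF //; apply: ler_wpM2l; first exact: ltW.
  by apply: lerXn2r; rewrite // nnegrE ltW.
have small e t : 0 < e -> t <= r * e / (M + 1) -> t / r * M <= e.
  move=> e0 te; have K0 : 0 < M + 1 by rewrite ltr_wpDl.
  rewrite mulrAC ler_pdivrMr //; apply: le_trans (ler_wpM2r M0 te) _.
  have -> : r * e / (M + 1) * M = e * r * (M / (M + 1)) by ring.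
  apply: ler_piMr; first by rewrite mulr_ge0 ?(ltW e0) ?(ltW r0).
  by rewrite ler_pdivrMr // mul1r lerDl.
have fz : f z = a 0%N 0%N.
  apply/eqP; rewrite -subr_eq0 -normr_eq0; apply/eqP.
  apply/eqP; rewrite eq_le normr_ge0 andbT; apply/ler_addgt0Pl => e e0.
  have K0 : 0 < M + 1 by rewrite ltr_wpDl.
  have e1 : 0 < r * e / (M + 1) by rewrite divr_gt0 // mulr_gt0.
  have [t [t0 tr te]] := min_radius r0 e1.
  apply: le_trans (bound t z t0 tr (near_in_center z t0)) _.
  by rewrite addr0; exact: small.
apply/cvgrPdist_le => e e0.
have K0 : 0 < M + 1 by rewrite ltr_wpDl.
have e1 : 0 < r * e / (M + 1) by rewrite divr_gt0 // mulr_gt0.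
have [t [t0 tr te]] := min_radius r0 e1.
apply/nbhs_near_in; exists t => // w wt.
rewrite distrC fz; apply: le_trans (bound t w t0 tr wt) _.
exact: small.
Qed.

End Calculus.

Section Existence.
Variable R : realType.
Local Notation C := (Cplx R).
Implicit Types (x y r s e M : C) (f g : C * C -> C) (z w : C * C).
Implicit Types (p q : polyxy C).

(** ** Functions with vanishing partial derivatives *)

(** The mean value theorem, applied below to the real and imaginary parts of a
    function along a segment. *)
Lemma real_flat_const (psi : R -> R) :
  (forall t : R, 0 <= t <= 1 -> forall e : R, 0 < e -> exists2 d : R, 0 < d &
     forall k : R, `|k| < d -> `|psi (t + k) - psi t| <= e * `|k|) ->
  psi 1 = psi 0.
Proof.
move=> flat.
have D (t : R) : t \in `[0, 1] -> is_derive t (1 : R) psi 0.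
  rewrite in_itv => /flat {}flat.
  have key : (fun h : R => h^-1 *: ((psi \o shift t) (h *: (1 : R)) - psi t)) @ 0^' --> (0 : R).
    apply/cvgrPdist_le => e e0; have [d d0 hd] := flat e e0.
    near=> h.
    have h0 : h != 0 by near: h; exact: nbhs_dnbhs_neq.
    have hr : `|h| < d.
      near: h; apply: nbhs_dnbhs; exists d => // y /=; by rewrite sub0r normrN.
    rewrite sub0r normrN /= /shift [_%:A]mulr1 [_ *: _]mulrC normrM normfV.
    by rewrite ler_pdivrMr ?normr_gt0 // [h + t]addrC; exact: hd.
  split; first by apply/cvg_ex; exists 0.
  exact: cvg_lim key.
have D' (t : R) : t \in `]0, 1[ -> is_derive t (1 : R) psi ((fun=> 0) t).
  by rewrite in_itv /= => /andP[h1 h2]; apply: D; rewrite in_itv /= !ltW.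
have [] := @MVT_segment R psi (fun=> 0) 0 1 ler01 D'.
  by apply: derivable_within_continuous => t /D[].
by move=> c _; rewrite mul0r => /subr0_eq.
Unshelve. all: by end_near. Qed.

Lemma flat_line_const (g : C -> C) (v : C) :
  (forall h, `|h| <= `|v| -> forall e, 0 < e -> exists2 d, 0 < d &
     forall k, `|k| < d -> `|g (h + k) - g h| <= e * `|k|) -> g v = g 0.
Proof.
move=> flat.
have nv0 : 0 < `|v| + 1 by rewrite ltr_wpDl.
have part (re : C -> R) : (forall x y, re (x - y) = re x - re y) ->
    (forall x, `|re x| <= complex.Re `|x|) -> re (g v) = re (g 0).
  move=> reB rele; pose psi (t : R) := re (g (t%:C%C * v)).
  have := @real_flat_const psi; rewrite /psi rmorph1 rmorph0 mul1r mul0r; apply.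
  move=> t /andP[t0 t1] e e0.
  have tv : `|t%:C%C * v| <= `|v|.
    rewrite normrM -[X in _ <= X]mul1r; apply: ler_wpM2r => //.
    by rewrite ger0_norm ?lecR ?(lecR 0) // -(rmorph1 (real_complex R)) lecR.
  have ec0 : 0 < e%:C%C / (`|v| + 1) by rewrite divr_gt0 // (ltcR 0).
  have [d d0 hd] := flat _ tv _ ec0.
  have dE := real_cplx_ge0 (ltW d0).
  have vE : `|v| + 1 = (complex.Re (`|v| + 1))%:C%C by apply: real_cplx_ge0; exact: ltW.
  have d0' : 0 < complex.Re d by move: d0; rewrite dE (ltcR 0).
  have v0' : 0 < complex.Re (`|v| + 1) by move: nv0; rewrite vE (ltcR 0).
  have vn : `|v| <= `|v| + 1 by rewrite lerDl.
  exists (complex.Re d / complex.Re (`|v| + 1)); first by rewrite divr_gt0.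
  move=> k kd.
  have nk : `|k%:C%C : C| = `|k|%:C%C by rewrite normc_def /= expr0n addr0 sqrtr_sqr.
  have kv : `|k%:C%C * v| < d.
    rewrite normrM; apply: (@le_lt_trans _ _ (`|k%:C%C| * (`|v| + 1))).
      exact: ler_wpM2l.
    by rewrite -ltr_pdivlMr // nk dE vE -fmorphV -rmorphM ltcR.
  rewrite rmorphD mulrDl -reB; apply: le_trans (rele _) _.
  rewrite -lecR RRe_real ?normr_real //; apply: le_trans (hd _ kv) _.
  rewrite rmorphM normrM nk -mulrA; apply: ler_wpM2l; first by rewrite (lecR 0) ltW.
  rewrite mulrCA ler_piMr ?(lecR 0) //.
  by rewrite mulrC ler_pdivrMr // mul1r.
apply/eqP; rewrite eq_complex; apply/andP; split; apply/eqP.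
  by apply: (part (fun x => complex.Re x)) => [x y|]; [exact: raddfB | exact: Re_le_norm].
by apply: (part (fun x => complex.Im x)) => [x y|]; [exact: raddfB | exact: Im_le_norm].
Qed.

Lemma const_in_x f z r w : (forall w, near_in r z w -> is_derive w (1, 0) f 0) ->
  near_in r z w -> f w = f (z.1, w.2).
Proof.
move=> D [w1 w2]; pose g (h : C) := f (z.1 + h, w.2).
suff : g (w.1 - z.1) = g 0 by rewrite /g subrKC addr0; case: (w).
apply: flat_line_const => h hv e e0.
have [|df Df] := D (z.1 + h, w.2).
  by split=> //=; rewrite addrC addKr; exact: le_lt_trans w1.
have : (fun h' : C => h'^-1 *: ((f \o shift (z.1 + h, w.2)) (h' *: (1, 0)) - f (z.1 + h, w.2))) @ 0^' -->
    'D_(1, 0) f (z.1 + h, w.2) by exact: df.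
rewrite Df => /cvgrPdist_le/(_ e e0) [d /= d0 hd].
exists d => // k kd; have [->|k0] := eqVneq k 0.
  by rewrite addr0 subrr normr0 mulr0.
have := hd k; rewrite /= sub0r normrN => /(_ kd k0).
rewrite sub0r normrN /shift scale_x_shift [k + _]addrC -[z.1 + h + k]addrA.
by rewrite normrM normfV ler_pdivrMl ?normr_gt0 // mulrC.
Qed.

Lemma const_in_y f z r w : (forall w, near_in r z w -> is_derive w (0, 1) f 0) ->
  near_in r z w -> f w = f (w.1, z.2).
Proof.
move=> D [w1 w2].
have D' w' : near_in r (flip z) w' -> is_derive w' (1, 0) (f \o @flip C) 0.
  move=> [h1 h2]; have [d1 d2] := D (flip w') (conj h2 h1).
  split; first by rewrite -[w']flipK; apply/derivable_flip.
  by rewrite -[w']flipK; exact: etrans (dx_flip _ _) d2.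
have := const_in_x D' (conj w2 w1 : near_in r (flip z) (flip w)).
by rewrite [in LHS]/= flipK.
Qed.

Lemma analytic_flip f z : analytic_at f z -> analytic_at (f \o @flip C) (flip z).
Proof.
move=> /analytic_atP[a [r [M h]]]; apply/analytic_atP.
by exists (fun i j => a j i), r, M; exact: ps_flip.
Qed.

Lemma ps_analytic a r M f z w : ps a r M f z -> near_in r z w -> analytic_at f w.
Proof.
move=> h [w1 w2]; have [r0 _ _] := h.
have [rho [r1 h1 h2]] : exists rho, [/\ rho < r, `|w.1 - z.1| <= rho & `|w.2 - z.2| <= rho].
  case: (real_leP (normr_real (w.1 - z.1)) (normr_real (w.2 - z.2))) => h'.
    by exists `|w.2 - z.2|.
  by exists `|w.1 - z.1|; split=> //; exact: ltW.
have [b [hb _]] := ps_reexpand h h1 h2 r1.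
by apply/analytic_atP; exists b, (r - rho), M.
Qed.

Lemma analytic_cst (c : C) z : analytic_at (fun=> c) z.
Proof.
pose a i j : C := if (i == 0)%N && (j == 0)%N then c else 0.
apply/analytic_atP; exists a, 1, `|c|; split=> // [n|w _ _].
  case: n => [|n]; first by rewrite /sqabs big_ord0.
  rewrite /sqabs big_ord_recl big_ord_recl /= expr0 mulr1.
  rewrite big1 => [|j _]; last by rewrite normr0 mul0r.
  by rewrite big1 ?addr0 // => i _; rewrite big1 // => j _; rewrite normr0 mul0r.
apply: cvg_near_cst; exists 1%N => // -[//|n] _.
rewrite /sq big_ord_recl big_ord_recl /= !expr0 !mulr1.
rewrite big1 => [|j _]; last by rewrite !mul0r.
by rewrite big1 ?addr0 // => i _; rewrite big1 // => j _; rewrite !mul0r.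
Qed.

(** Obtained from ode_x by exchanging the variables, also in the polynomials. *)
Lemma ode_y p (c e : polyxy C) (s phi : C * C -> C) z :
  p.[z.1, z.2] != 0 -> analytic_at s z -> analytic_at phi z ->
  exists a r M U, [/\ ps a r M U z,
    forall w, near_in r z w ->
      p.[w.1, w.2] * dy U w = c.[w.1, w.2] * U w + e.[w.1, w.2] * s w
    & forall w, near_in r z w -> w.2 = z.2 -> U w = phi w].
Proof.
move=> p0 hs hphi.
have p0' : (swapXY p).[(flip z).1, (flip z).2] != 0 by rewrite horner2_swapXY.
have [a [r [M [U [hU E1 E2]]]]] :=
  ode_x (swapXY c) (swapXY e) p0' (analytic_flip hs) (analytic_flip hphi).
exists (fun i j => a j i), r, M, (U \o @flip C).
have hU' := ps_flip hU; rewrite flipK in hU'.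
split=> // [w [w1 w2]|w [w1 w2] wz].
  have := E1 (flip w) (conj w2 w1); rewrite !horner2_swapXY /= flipK => <-.
  by rewrite -dx_flip flip_flip.
by rewrite /= (E2 (flip w) (conj w2 w1)) //= flipK.
Qed.

Lemma near_in_shrink (P : set (C * C)) r z : 0 < r -> nbhs z P ->
  exists r', [/\ 0 < r', r' <= r & forall w, near_in r' z w -> P w].
Proof.
move=> r0 /nbhs_near_in[r1 r10 h]; have [r2 [h1 h2 h3]] := min_radius r0 r10.
by exists r2; split=> // w [w1 w2]; apply: h; split; exact: lt_le_trans h3.
Qed.

Lemma analytic_quotient p q z : q.[z.1, z.2] != 0 ->
  analytic_at (fun w => p.[w.1, w.2] / q.[w.1, w.2]) z.
Proof.
move=> q0; pose P w := p.[w.1, w.2]; pose Q w := q.[w.1, w.2].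
pose E f w := Q w * f w - P w.
have [a1 [r1 [M1 [phi [h1 e1 i1]]]]] :=
  ode_y (- polyDy q) (polyDy p) q0 (analytic_cst 1 z) (analytic_cst (P z / Q z) z).
have [r10 _ _] := h1.
have phia : analytic_at phi z by apply/analytic_atP; exists a1, r1, M1.
have [a [r2 [M [f [h2 e2 i2]]]]] :=
  ode_x (- polyDx q) (polyDx p) q0 (analytic_cst 1 z) phia.
have [r20 _ _] := h2.
have [r [r0 rr1 rr2]] := min_radius r10 r20.
have Dphi w : near_in r1 z w -> is_derive w (0, 1) (E phi) 0.
  move=> wr; have D := analytic_derive_y (ps_analytic h1 wr).
  have := is_derive_add (is_derive_mul (is_derive_poly_y q w) D)
    (is_derive_mul (is_derive_const (-1) w (0, 1)) (is_derive_poly_y p w)).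
  have -> : (fun w0 => q.[w0.1, w0.2] * phi w0 + -1 * p.[w0.1, w0.2]) = E phi.
    by apply/funext => w0; rewrite /E mulN1r.
  rewrite e1 //; congr is_derive; rewrite !hornerN; ring.
have Ephi y : `|y - z.2| < r -> E phi (z.1, y) = 0.
  move=> yr; have yin : near_in r1 z (z.1, y).
    by split=> /=; rewrite ?subrr ?normr0 //; exact: lt_le_trans yr rr1.
  have zz : near_in r1 z (z.1, z.2) by rewrite -surjective_pairing; exact: near_in_center.
  rewrite (const_in_y Dphi yin) /E (i1 _ zz erefl) /P /Q /= [q.[_, _] * _]mulrC divfK //.
  by rewrite subrr.
have Df w : near_in r2 z w -> is_derive w (1, 0) (E f) 0.
  move=> wr; have D := analytic_derive_x (ps_analytic h2 wr).
  have := is_derive_add (is_derive_mul (is_derive_poly_x q w) D)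
    (is_derive_mul (is_derive_const (-1) w (1, 0)) (is_derive_poly_x p w)).
  have -> : (fun w0 => q.[w0.1, w0.2] * f w0 + -1 * p.[w0.1, w0.2]) = E f.
    by apply/funext => w0; rewrite /E mulN1r.
  rewrite e2 //; congr is_derive; rewrite !hornerN; ring.
have Ef w : near_in r z w -> E f w = 0.
  move=> [w1 w2]; have win : near_in r2 z w by split; exact: lt_le_trans rr2.
  have zw : near_in r2 z (z.1, w.2).
    by split=> /=; rewrite ?subrr ?normr0 //; exact: lt_le_trans w2 rr2.
  by rewrite (const_in_x Df win) -(Ephi w.2 w2) /E (i2 _ zw erefl).
have [r' [r'0 r'r hq]] := near_in_shrink r0 (poly_neq0_near q0).
apply/analytic_atP; exists a, r', M.
apply: ps_ext (ps_smaller h2 r'0 (le_trans r'r rr2)) => // w wr.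
have [w1 w2] := wr.
have /subr0_eq : E f w = 0 by apply: Ef; split; exact: lt_le_trans r'r.
by rewrite /Q /P => <-; rewrite mulrC mulKf //; exact: hq.
Qed.

(** ** Polydiscs are connected *)

(** A polydisc is a union of segments through its centre. *)
Lemma near_in_connected r z : connected (near_in r z).
Proof.
have [[w0 w0r]|emp] := pselect (exists w, near_in r z w); last first.
  have -> : near_in r z = set0; last exact: connected0.
  by apply/seteqP; split=> // w wr; apply: emp; exists w.
pose path (w : C * C) (t : R) : C * C := z + t%:C%C *: (w - z).
have E : near_in r z = \bigcup_(w in near_in r z) (path w @` `[0, 1]).
  apply/seteqP; split=> [w wr|u [w [w1 w2] [t]]].
    exists w => //; exists 1; first by rewrite /= in_itv /= lexx ler01.
    by rewrite /path rmorph1 scale1r subrKC.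
  rewrite /= in_itv /= => /andP[t0 t1] <-.
  have tn : `|t%:C%C : C| <= 1.
    by rewrite ger0_norm ?(lecR 0) // -(rmorph1 (real_complex R)) lecR.
  have shrink x : `|t%:C%C * x| <= `|x| by rewrite normrM ler_piMl.
  split; rewrite /path /= addrC addKr.
    exact: le_lt_trans (shrink _) w1.
  exact: le_lt_trans (shrink _) w2.
rewrite E; apply: bigcup_connected.
  exists z => w wr; exists 0; first by rewrite /= in_itv /= lexx ler01.
  by rewrite /path rmorph0 scale0r addr0.
move=> w _; apply: connected_continuous_connected; first exact: segment_connected.
apply: continuous_subspaceT => t; rewrite /continuous_at /path.
apply: (@cvgD _ _ _ _ _ (fun=> z) (fun t : R => t%:C%C *: (w - z))); first exact: cvg_cst.
apply: cvgZr_tmp; apply/cvgrPdist_le => e e0.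
have ee := real_cplx_ge0 (ltW e0).
have e0' : 0 < complex.Re e by move: e0; rewrite ee (ltcR 0).
have /cvgrPdist_le/(_ _ e0') : (id : R -> R) @ t --> t by exact: cvg_id.
apply: filterS => u /= h; rewrite ee -rmorphB.
by rewrite normc_def /= expr0n addr0 sqrtr_sqr lecR.
Qed.

End Existence.

(** * Necessity of the polynomial equations *)


(** The elimination steps, over an arbitrary field: the variables stand for
    the values at one point of the polynomials, of the unknown function and of
    their derivatives. *)
Section Elimination.
Variable F : fieldType.
Implicit Types (P Q p q U X : F).

(** The y-derivative of Q f_x + P f_y = 0, where U = f_y and f_x is eliminated:
    U_x = - (F_y + F B) U. *)
Lemma elim_Ux P Q p q U Py Qy fx fxy Ux Uy :
  Qy * fx + Q * fxy + (Py * U + P * Uy) = 0 -> Q * fx + P * U = 0 ->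
  q * Uy = p * U -> Ux = fxy ->
  Q ^+ 2 * q * Ux + ((Py * Q - P * Qy) * q + P * Q * p) * U = 0.
Proof.
move=> e1 e2 e3 ->.
have -> : Q ^+ 2 * q * fxy + ((Py * Q - P * Qy) * q + P * Q * p) * U =
  q * Q * (Qy * fx + Q * fxy + (Py * U + P * Uy)) - q * Qy * (Q * fx + P * U)
  - P * Q * (q * Uy - p * U) by ring.
by rewrite e1 e2 e3 subrr !mulr0 !subr0.
Qed.

(** X and Y are the two mixed derivatives of U; they are obtained by deriving
    the equations for U_x and U_y, and their equality is the closedness. *)
Lemma elim_factor_eq P Q p q U Py Qy px py qx qy a ay Ux Uy X Y :
  Q != 0 -> q != 0 -> X = Y -> a = Py * Q - P * Qy ->
  Q ^+ 2 * q * Ux + (a * q + P * Q * p) * U = 0 ->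
  (2%:R * Q * Qy * q + Q ^+ 2 * qy) * Ux + Q ^+ 2 * q * X +
    ((ay * q + a * qy + Py * Q * p + P * Qy * p + P * Q * py) * U
     + (a * q + P * Q * p) * Uy) = 0 ->
  qx * Uy + q * Y + (- px * U + - p * Ux) = 0 ->
  q * Uy = p * U ->
  (q * (Q ^+ 3 * px + P * Q ^+ 2 * py) - p * (Q ^+ 3 * qx + P * Q ^+ 2 * qy) +
   Q * a * p * q + (ay * Q - 2%:R * a * Qy) * q ^+ 2) * U = 0.
Proof.
move=> Q0 q0 <- aE e4 e5 e6 e3.
pose t := U / (Q ^+ 2 * q).
have UE : U = Q ^+ 2 * q * t by rewrite /t mulrC divfK // mulf_neq0 ?expf_neq0.
have UyE : Uy = p * Q ^+ 2 * t.
  by apply: (mulfI q0); rewrite e3 UE; ring.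
have UxE : Ux = - (a * q + P * Q * p) * t.
  apply: (mulfI (mulf_neq0 (expf_neq0 2 Q0) q0)); apply/eqP; rewrite -subr_eq0 -e4.
  by apply/eqP; rewrite UE; ring.
have XE : q * X = - (qx * Uy - px * U - p * Ux).
  by rewrite -[LHS]addr0 -[in LHS](oppr0) -e6; ring.
apply: (mulfI Q0); rewrite mulr0 -[RHS](mulr0 (Q ^+ 2 * q)) -e5.
have -> : Q ^+ 2 * q * X = Q ^+ 2 * (q * X) by ring.
by rewrite XE UxE UyE UE aE; ring.
Qed.

Lemma elim_power_eq P Q p q U g h gx gy hx hy a Ux Uy (n : nat) :
  hx * U ^+ n + h * (n%:R * U ^+ n.-1 * Ux) + - gx = 0 ->
  hy * U ^+ n + h * (n%:R * U ^+ n.-1 * Uy) + - gy = 0 ->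
  h * U ^+ n = g -> q * Uy = p * U ->
  Q ^+ 2 * q * Ux + (a * q + P * Q * p) * U = 0 ->
  (gy * h - g * hy) * q - n%:R * p * g * h = 0 /\
  q * ((Q ^+ 3 * gx + P * Q ^+ 2 * gy) * h - g * (Q ^+ 3 * hx + P * Q ^+ 2 * hy)
    + n%:R * Q * a * g * h) = 0.
Proof.
move=> /subr0_eq <- /subr0_eq <- <- e2 e4.
have UU : n%:R * U ^+ n = n%:R * U ^+ n.-1 * U.
  by case: (n) => [|m] /=; rewrite ?mul0r // exprSr mulrA.
set V := n%:R * U ^+ n.-1 in UU *.
have k1 : q * (V * Uy) = n%:R * p * U ^+ n.
  transitivity (V * (q * Uy)); first by ring.
  by rewrite e2; transitivity (p * (V * U)); [ring | rewrite -UU; ring].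
have k2 : Q ^+ 2 * q * (V * Ux) = - ((a * q + P * Q * p) * (n%:R * U ^+ n)).
  have {}e4 : Q ^+ 2 * q * Ux = - ((a * q + P * Q * p) * U).
    by apply/eqP; rewrite -addr_eq0; apply/eqP.
  transitivity (V * (Q ^+ 2 * q * Ux)); first by ring.
  by rewrite e4 UU; ring.
split.
  have -> : ((hy * U ^+ n + h * (V * Uy)) * h - h * U ^+ n * hy) * q -
     n%:R * p * (h * U ^+ n) * h = h ^+ 2 * (q * (V * Uy) - n%:R * p * U ^+ n) by ring.
  by rewrite k1 subrr mulr0.
have -> : q * ((Q ^+ 3 * (hx * U ^+ n + h * (V * Ux)) + P * Q ^+ 2 * (hy * U ^+ n + h * (V * Uy))) * h
   - h * U ^+ n * (Q ^+ 3 * hx + P * Q ^+ 2 * hy) + n%:R * Q * a * (h * U ^+ n) * h) =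
   h ^+ 2 * (Q * (Q ^+ 2 * q * (V * Ux)) + P * Q ^+ 2 * (q * (V * Uy))
      + n%:R * Q * a * q * U ^+ n) by ring.
by rewrite k1 k2; ring.
Qed.

End Elimination.

(** The same steps through a ring morphism, which will evaluate polynomials. *)
Section Morphism.
Variables (S : comNzRingType) (F : fieldType) (phi : {rmorphism S -> F}).
Variables (P Q p q Py Qy px py qx qy g h gx gy hx hy a ay : S).
Variables (U Ux Uy X Y : F).
Let evm := (rmorph_nat phi, rmorphXn phi, rmorphB phi, rmorphN phi, rmorphD phi, rmorphM phi).

Lemma morph_factor_eq : phi Q != 0 -> phi q != 0 -> X = Y ->
  phi a = phi Py * phi Q - phi P * phi Qy ->
  phi (Q ^+ 2 * q) * Ux + phi (a * q + P * Q * p) * U = 0 ->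
  phi (2%:R * Q * Qy * q + Q ^+ 2 * qy) * Ux + phi (Q ^+ 2 * q) * X +
    (phi (ay * q + a * qy + Py * Q * p + P * Qy * p + P * Q * py) * U
     + phi (a * q + P * Q * p) * Uy) = 0 ->
  phi qx * Uy + phi q * Y + (phi (- px) * U + phi (- p) * Ux) = 0 ->
  phi q * Uy = phi p * U ->
  phi (q * (Q ^+ 3 * px + P * Q ^+ 2 * py) - p * (Q ^+ 3 * qx + P * Q ^+ 2 * qy) +
   Q * a * p * q + (ay * Q - 2%:R * a * Qy) * q ^+ 2) * U = 0.
Proof. by rewrite !evm; exact: elim_factor_eq. Qed.

Lemma morph_power_eq n :
  phi hx * U ^+ n + phi h * (n%:R * U ^+ n.-1 * Ux) + phi (- gx) = 0 ->
  phi hy * U ^+ n + phi h * (n%:R * U ^+ n.-1 * Uy) + phi (- gy) = 0 ->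
  phi h * U ^+ n = phi g -> phi q * Uy = phi p * U ->
  phi (Q ^+ 2 * q) * Ux + phi (a * q + P * Q * p) * U = 0 ->
  phi ((gy * h - g * hy) * q - n%:R * p * g * h) = 0 /\
  phi (q * ((Q ^+ 3 * gx + P * Q ^+ 2 * gy) * h - g * (Q ^+ 3 * hx + P * Q ^+ 2 * hy)
    + n%:R * Q * a * g * h)) = 0.
Proof. by rewrite !evm => ex ey e e2 e4; exact: (elim_power_eq ex ey e e2 e4). Qed.

End Morphism.

Section Evaluation.
Variables (k : comNzRingType) (F : fieldType) (phi : {rmorphism {poly {poly k}} -> F}).
Variables (P Q p q : {poly {poly k}}).
Implicit Types (U X : F).
Let evm := (rmorph_nat phi, rmorphXn phi, rmorphB phi, rmorphN phi, rmorphD phi, rmorphM phi).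

Lemma eval_Ux U fx fxy Ux Uy :
  phi (polyDy Q) * fx + phi Q * fxy + (phi (polyDy P) * U + phi P * Uy) = 0 ->
  phi Q * fx + phi P * U = 0 -> phi q * Uy = phi p * U -> Ux = fxy ->
  phi (Q ^+ 2 * q) * Ux + phi (dyF P Q * q + P * Q * p) * U = 0.
Proof. by move=> e1 e2 e3 e4; have := elim_Ux e1 e2 e3 e4; rewrite /dyF !evm. Qed.

Lemma eval_dyF : phi (dyF P Q) = phi (polyDy P) * phi Q - phi P * phi (polyDy Q).
Proof. by rewrite rmorphB !rmorphM. Qed.

Lemma eval_factor_eq U Ux Uy X Y :
  phi Q != 0 -> phi q != 0 -> X = Y ->
  phi (Q ^+ 2 * q) * Ux + phi (dyF P Q * q + P * Q * p) * U = 0 ->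
  phi (polyDy (Q ^+ 2 * q)) * Ux + phi (Q ^+ 2 * q) * X +
    (phi (polyDy (dyF P Q * q + P * Q * p)) * U
     + phi (dyF P Q * q + P * Q * p) * Uy) = 0 ->
  phi (polyDx q) * Uy + phi q * Y + (phi (polyDx (- p)) * U + phi (- p) * Ux) = 0 ->
  phi q * Uy = phi p * U -> phi (factor_eq P Q p q) * U = 0.
Proof.
have -> : polyDy (Q ^+ 2 * q) = 2%:R * Q * polyDy Q * q + Q ^+ 2 * polyDy q.
  by rewrite polyDyM polyDyX expr1.
have -> : polyDy (dyF P Q * q + P * Q * p) =
  polyDy (dyF P Q) * q + dyF P Q * polyDy q + polyDy P * Q * p + P * polyDy Q * p
   + P * Q * polyDy p by rewrite polyDyD !polyDyM; ring.
rewrite polyDxN /factor_eq /hom_eq /flow /dyyF => Q0 q0 XY.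
exact: (morph_factor_eq Q0 q0 XY eval_dyF).
Qed.

Lemma eval_power_eq U Ux Uy (n : nat) g h :
  phi (polyDx h) * U ^+ n + phi h * (n%:R * U ^+ n.-1 * Ux) + phi (polyDx (- g)) = 0 ->
  phi (polyDy h) * U ^+ n + phi h * (n%:R * U ^+ n.-1 * Uy) + phi (polyDy (- g)) = 0 ->
  phi h * U ^+ n = phi g -> phi q * Uy = phi p * U ->
  phi (Q ^+ 2 * q) * Ux + phi (dyF P Q * q + P * Q * p) * U = 0 ->
  phi ((polyDy g * h - g * polyDy h) * q - n%:R * p * g * h) = 0 /\
  phi (q * (flow P Q g * h - g * flow P Q h + n%:R * Q * dyF P Q * g * h)) = 0.
Proof.
rewrite polyDxN polyDyN /flow => ex ey e e2 e4.
exact: (morph_power_eq ex ey e e2 e4).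
Qed.

End Evaluation.

Section Necessary.
Variable R : realType.
Local Notation C := (Cplx R).
Implicit Types (x y r s : C) (f : C * C -> C) (z w : C * C) (N D : set (C * C)).
Implicit Types (p q g h P Q : polyxy C) (n : nat).

Notation pv p w := (ev w.1 w.2 p).

Lemma poly_x p w : is_derive w (1, 0) (fun w : C * C => pv p w) (pv (polyDx p) w).
Proof. exact: is_derive_poly_x. Qed.

Lemma poly_y p w : is_derive w (0, 1) (fun w : C * C => pv p w) (pv (polyDy p) w).
Proof. exact: is_derive_poly_y. Qed.

Lemma derive_zero_on N f w (v : C * C) (d : C) : open N -> N w ->
  (forall u, N u -> f u = 0) -> is_derive w v f d -> d = 0.
Proof.
move=> oN Nw f0 hd; apply: (is_derive_uniq hd).
apply: near_eq_is_derive (is_derive_const 0 w v).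
have : nbhs w N by apply: open_nbhs_nbhs.
by apply: filterS => u /f0.
Qed.

Lemma open_poly_neq0 p : open [set w : C * C | pv p w != 0].
Proof. by rewrite openE => w; exact: poly_neq0_near. Qed.

(** An open set where no denominator vanishes. *)
Section Local.
Variables (P Q p q : polyxy C) (N : set (C * C)) (f : C * C -> C).
Hypotheses (oN : open N) (fN : forall u, N u -> analytic_at f u)
  (QN : forall u, N u -> pv Q u != 0) (qN : forall u, N u -> pv q u != 0)
  (fe : forall u, N u -> pv Q u * dx f u + pv P u * dy f u = 0)
  (Ue : forall u, N u -> pv q u * dy (dy f) u = pv p u * dy f u).

Lemma local_Ux u : N u ->
  pv (Q ^+ 2 * q) u * dx (dy f) u + pv (dyF P Q * q + P * Q * p) u * dy f u = 0.
Proof.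
move=> Nu; have hf := fN Nu.
have e1 := derive_zero_on oN Nu fe
  (is_derive_add (is_derive_mul (poly_y _ _) (analytic_derive_y (analytic_dx hf)))
                 (is_derive_mul (poly_y _ _) (analytic_derive_y (analytic_dy hf)))).
exact: (eval_Ux e1 (fe Nu) (Ue Nu) (analytic_schwarz hf)).
Qed.

Lemma local_factor_eq u : N u -> pv (factor_eq P Q p q) u * dy f u = 0.
Proof.
move=> Nu; have hf := fN Nu; have hU := analytic_dy hf.
have e4 := local_Ux Nu.
have e5 := derive_zero_on oN Nu local_Ux
  (is_derive_add (is_derive_mul (poly_y _ _) (analytic_derive_y (analytic_dx hU)))
                 (is_derive_mul (poly_y _ _) (analytic_derive_y hU))).
have Ue0 w : N w -> pv q w * dy (dy f) w + pv (- p) w * dy f w = 0.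
  by move=> Nw; rewrite (Ue Nw) rmorphN mulNr; exact: subrr.
have e6 := derive_zero_on oN Nu Ue0
  (is_derive_add (is_derive_mul (poly_x _ _) (analytic_derive_x (analytic_dy hU)))
                 (is_derive_mul (poly_x _ _) (analytic_derive_x hU))).
exact: (eval_factor_eq (QN Nu) (qN Nu) (esym (analytic_schwarz hU)) e4 e5 e6 (Ue Nu)).
Qed.

Lemma local_power_eq n g h u : N u ->
  (forall w, N w -> pv h w * dy f w ^+ n = pv g w) ->
  pv ((polyDy g * h - g * polyDy h) * q - n%:R * p * g * h) u = 0 /\
  pv (q * (flow P Q g * h - g * flow P Q h + n%:R * Q * dyF P Q * g * h)) u = 0.
Proof.
move=> Nu E.
have E0 w : N w -> pv h w * dy f w ^+ n + pv (- g) w = 0.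
  by move=> Nw; rewrite (E w Nw) rmorphN; exact: subrr.
have hf := fN Nu; have hU := analytic_dy hf.
have ey := derive_zero_on oN Nu E0
  (is_derive_add (is_derive_mul (poly_y _ _) (is_derive_pow n (analytic_derive_y hU))) (poly_y _ _)).
have ex := derive_zero_on oN Nu E0
  (is_derive_add (is_derive_mul (poly_x _ _) (is_derive_pow n (analytic_derive_x hU))) (poly_x _ _)).
exact: (eval_power_eq ex ey (E u Nu) (Ue Nu) (local_Ux Nu)).
Qed.

End Local.
End Necessary.

Section IntegratingFactorEquations.
Variable R : realType.
Local Notation C := (Cplx R).
Implicit Types (x y r : C) (f U : C * C -> C) (z w : C * C) (D : set (C * C)).
Implicit Types (p q g h P Q : polyxy C) (F B G : ratfun C) (n : nat).
Notation pv p w := (ev w.1 w.2 p).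

(** By density, a polynomial identity may be tested at the points of an open
    set where neither s nor the integrating factor vanishes. *)
Lemma generic_zero D f p (s : polyxy C) z : open D -> D z -> analytic_at f z -> dy f z != 0 -> s != 0 ->
  (forall w, D w -> pv s w != 0 -> dy f w != 0 -> pv p w = 0) -> p = 0.
Proof.
move=> oD Dz hf Uz s0 H; apply/eqP/negP => /negP p0.
have nb : nbhs z (D `&` [set w | dy f w != 0]).
  apply: filterI; first exact: open_nbhs_nbhs.
  by apply: (continuous_neq0 (analytic_continuous (analytic_dy hf))).
have [w [[Dw Uw] hw]] := poly_dense (mulf_neq0 p0 s0) nb.
have : pv p w * pv s w != 0 by rewrite -rmorphM.
rewrite mulf_eq0 negb_or => /andP[pw sw].
by move: pw; rewrite (H w Dw sw Uw) eqxx.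
Qed.

Section Given.
Variables (D : set (C * C)) (f U : C * C -> C) (F B : ratfun C) (P Q p q : polyxy C).
Hypotheses (Fi : first_integral F D f) (Uf : forall z, D z -> U z = dy f z)
  (UB : log_dy D U B) (FPQ : is_frac F P Q) (Bpq : is_frac B p q).

Let oD : open D. Proof. by case: Fi => -[]. Qed.
Let fD z : D z -> analytic_at f z. Proof. by case: Fi => _ h _ _; exact: h. Qed.

Let fe z : D z -> pv Q z != 0 -> pv Q z * dx f z + pv P z * dy f z = 0.
Proof.
move=> Dz Qz; case: Fi => _ _ _ /(_ z _ Dz (value_at_frac FPQ Qz)) e.
have -> : pv P z = pv Q z * (P.[z.1, z.2] / Q.[z.1, z.2]) by rewrite [RHS]mulrC divfK.
by rewrite -mulrA -mulrDr e mulr0.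
Qed.

Let Ue z : D z -> pv q z != 0 -> pv q z * dy (dy f) z = pv p z * dy f z.
Proof.
move=> Dz qz; case: UB => _ /(_ z _ Dz (value_at_frac Bpq qz)).
rewrite (Uf Dz) => e.
have -> : dy (dy f) z = dy U z.
  apply: near_eq_derive; have : nbhs z D by apply: open_nbhs_nbhs.
  by apply: filterS => w /Uf.
by rewrite e mulrA [pv q z * _]mulrC divfK.
Qed.

Let N h := D `&` [set w | pv (Q * q * h) w != 0].

Let oN h : open (N h).
Proof. by apply: openI; [exact: oD | exact: open_poly_neq0]. Qed.

Let NQ h u : N h u -> [/\ D u, pv Q u != 0, pv q u != 0 & pv h u != 0].
Proof.
by move=> [Du] /=; rewrite !rmorphM !mulf_eq0 !negb_or => /andP[/andP[h1 h2] h3].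
Qed.

Let Q0 : Q != 0. Proof. by case: FPQ. Qed.
Let q0 : q != 0. Proof. by case: Bpq. Qed.

Let Uz : exists z, D z /\ dy f z != 0.
Proof. by case: UB => -[z [Dz uz]] _; exists z; split=> //; rewrite -Uf. Qed.

Lemma integrating_factor_eq : factor_eq P Q p q = 0.
Proof.
have [z [Dz uz]] := Uz.
apply: (@generic_zero D f _ (Q * q) z oD Dz (fD Dz) uz); first exact: mulf_neq0.
move=> w Dw sw uw; have Nw : N 1 w by split=> //=; rewrite mulr1.
have H := @local_factor_eq _ P Q p q (N 1) f (@oN 1)
  (fun u Nu => let: And4 h1 _ _ _ := @NQ 1 u Nu in fD h1)
  (fun u Nu => let: And4 _ h2 _ _ := @NQ 1 u Nu in h2)
  (fun u Nu => let: And4 _ _ h2 _ := @NQ 1 u Nu in h2)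
  (fun u Nu => let: And4 h1 h2 _ _ := @NQ 1 u Nu in fe h1 h2)
  (fun u Nu => let: And4 h1 _ h2 _ := @NQ 1 u Nu in Ue h1 h2) w Nw.
by apply/eqP; move/eqP: H; rewrite mulf_eq0 (negbTE uw) orbF.
Qed.

Lemma algebraic_factor_eq n G g h : equal_on D (fun z => U z ^+ n) G -> is_frac G g h ->
  power_eq P Q p q n g h /\ g != 0.
Proof.
move=> UG Ggh; have h0 : h != 0 by case: Ggh.
have [z [Dz uz]] := Uz.
have s0 : Q * q * h != 0 := mulf_neq0 (mulf_neq0 Q0 q0) h0.
have E w : N h w -> pv h w * dy f w ^+ n = pv g w.
  move=> /NQ[Dw _ _ hw]; rewrite -(Uf Dw).
  have /= -> := UG w _ Dw (value_at_frac Ggh hw).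
  by rewrite mulrC divfK.
have loc w (Nw : N h w) := @local_power_eq _ P Q p q (N h) f (@oN h)
  (fun u Nu => let: And4 h1 _ _ _ := @NQ h u Nu in fD h1)
  (fun u Nu => let: And4 h1 h2 _ _ := @NQ h u Nu in fe h1 h2)
  (fun u Nu => let: And4 h1 _ h2 _ := @NQ h u Nu in Ue h1 h2) n g h w Nw E.
split; [split|].
- apply/eqP; rewrite -subr_eq0; apply/eqP.
  apply: (@generic_zero D f _ (Q * q * h) z oD Dz (fD Dz) uz s0) => w Dw sw _.
  by case: (loc w (conj Dw sw)).
- apply: (mulfI q0); apply/eqP; rewrite -subr_eq0 -mulrBr opprK; apply/eqP.
  apply: (@generic_zero D f _ (Q * q * h) z oD Dz (fD Dz) uz s0) => w Dw sw _.
  by case: (loc w (conj Dw sw)).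
apply/eqP => g0.
have nb : nbhs z (D `&` [set w | dy f w != 0]).
  apply: filterI; first exact: open_nbhs_nbhs.
  by apply: (continuous_neq0 (analytic_continuous (analytic_dy (fD Dz)))).
have [w [[Dw uw] hw]] := poly_dense s0 nb.
have := E w (conj Dw hw); rewrite g0 rmorph0 => /eqP.
have [_ _ _ hw'] := NQ (conj Dw hw : N h w).
by rewrite mulf_eq0 (negbTE hw') expf_eq0 (negbTE uw) andbF.
Qed.

End Given.
End IntegratingFactorEquations.

(** * Sufficiency of the polynomial equations *)


Section Elimination2.
Variable F : fieldType.
Implicit Types (P Q p q U X : F).

(** With U_x = A U and X = U_xy, the polynomial equation says that
    (U_y/U - B)_x = 0. *)
Lemma elim_compat P Q p q U Py Qy px py qx qy ay X Ux Uy :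
  Q != 0 -> q != 0 -> U != 0 ->
  Q ^+ 2 * q * Ux + ((Py * Q - P * Qy) * q + P * Q * p) * U = 0 ->
  (2%:R * Q * Qy * q + Q ^+ 2 * qy) * Ux + Q ^+ 2 * q * X +
    ((ay * q + (Py * Q - P * Qy) * qy + Py * Q * p + P * Qy * p + P * Q * py) * U
     + ((Py * Q - P * Qy) * q + P * Q * p) * Uy) = 0 ->
  q * (Q ^+ 3 * px + P * Q ^+ 2 * py) - p * (Q ^+ 3 * qx + P * Q ^+ 2 * qy) +
   Q * (Py * Q - P * Qy) * p * q + (ay * Q - 2%:R * (Py * Q - P * Qy) * Qy) * q ^+ 2 = 0 ->
  X / U + Uy * (- Ux / U ^+ 2) + (0 * (p / q) + -1 * (px / q + p * (- qx / q ^+ 2))) = 0.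
Proof.
move=> Q0 q0 U0 e4 e5 e.
have UxE : Ux = - (((Py * Q - P * Qy) * q + P * Q * p) * U) / (Q ^+ 2 * q).
  apply: (mulfI (mulf_neq0 (expf_neq0 2 Q0) q0)); rewrite [RHS]mulrC divfK ?mulf_neq0 ?expf_neq0 //.
  by apply/eqP; rewrite -addr_eq0 e4.
have XE : X = - ((2%:R * Q * Qy * q + Q ^+ 2 * qy) * Ux +
    ((ay * q + (Py * Q - P * Qy) * qy + Py * Q * p + P * Qy * p + P * Q * py) * U
     + ((Py * Q - P * Qy) * q + P * Q * p) * Uy)) / (Q ^+ 2 * q).
  apply: (mulfI (mulf_neq0 (expf_neq0 2 Q0) q0)); rewrite [RHS]mulrC divfK ?mulf_neq0 ?expf_neq0 //.
  by apply/eqP; rewrite -addr_eq0 addrC addrAC e5.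
transitivity (- (q * (Q ^+ 3 * px + P * Q ^+ 2 * py) - p * (Q ^+ 3 * qx + P * Q ^+ 2 * qy) +
   Q * (Py * Q - P * Qy) * p * q + (ay * Q - 2%:R * (Py * Q - P * Qy) * Qy) * q ^+ 2) / (Q ^+ 3 * q ^+ 2)).
  by rewrite XE UxE; field; rewrite Q0 q0 U0.
by rewrite e oppr0 mul0r.
Qed.

(** The equation of U implies (f_y - U)_x = 0. *)
Lemma elim_fy P Q p q U Py Qy fx fxy Ux Uy :
  Q != 0 -> q != 0 ->
  Qy * fx + Q * fxy + (Py * U + P * Uy) = 0 -> Q * fx + P * U = 0 -> q * Uy = p * U ->
  Q ^+ 2 * q * Ux + ((Py * Q - P * Qy) * q + P * Q * p) * U = 0 ->
  fxy + (0 * U + -1 * Ux) = 0.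
Proof.
move=> Q0 q0 e1 e2 e3 e4; rewrite mul0r add0r.
have := elim_Ux e1 e2 e3 erefl; rewrite -{}[RHS]e4 => /addIr.
by move=> /(mulfI (mulf_neq0 (expf_neq0 2 Q0) q0)) ->; rewrite mulN1r subrr.
Qed.

(** U^n h/g has vanishing derivatives, here in y and below in x. *)
Lemma elim_power_y p q U g h gy hy Uy (n : nat) :
  q != 0 -> g != 0 -> q * Uy = p * U -> (gy * h - g * hy) * q = n%:R * p * g * h ->
  n%:R * U ^+ n.-1 * Uy * (h / g) + U ^+ n * (hy / g + h * (- gy / g ^+ 2)) = 0.
Proof.
move=> q0 g0 e1 e2.
have UyE : Uy = p * U / q by rewrite -e1 mulrC mulKf.
have UU : n%:R * U ^+ n = n%:R * U ^+ n.-1 * U.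
  by case: (n) => [|m] /=; rewrite ?mul0r // exprSr mulrA.
transitivity ((n%:R * U ^+ n.-1 * U * p * g * h - U ^+ n * ((gy * h - g * hy) * q)) / (q * g ^+ 2)).
  by rewrite UyE; field; rewrite q0 g0.
by rewrite e2 -UU; field; rewrite q0 g0.
Qed.

Lemma elim_power_x P Q p q U g h gx gy hx hy a Ux (n : nat) :
  Q != 0 -> q != 0 -> g != 0 ->
  Q ^+ 2 * q * Ux + (a * q + P * Q * p) * U = 0 ->
  (gy * h - g * hy) * q = n%:R * p * g * h ->
  (Q ^+ 3 * gx + P * Q ^+ 2 * gy) * h - g * (Q ^+ 3 * hx + P * Q ^+ 2 * hy)
    = - (n%:R * Q * a * g * h) ->
  n%:R * U ^+ n.-1 * Ux * (h / g) + U ^+ n * (hx / g + h * (- gx / g ^+ 2)) = 0.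
Proof.
move=> Q0 q0 g0 e4 e2 e3.
have UxE : Ux = - ((a * q + P * Q * p) * U) / (Q ^+ 2 * q).
  apply: (mulfI (mulf_neq0 (expf_neq0 2 Q0) q0)); rewrite [RHS]mulrC divfK ?mulf_neq0 ?expf_neq0 //.
  by apply/eqP; rewrite -addr_eq0 e4.
have UU : n%:R * U ^+ n = n%:R * U ^+ n.-1 * U.
  by case: (n) => [|m] /=; rewrite ?mul0r // exprSr mulrA.
transitivity ((- (n%:R * U ^+ n.-1 * U) * Q * (a * q + P * Q * p) * g * h
   - U ^+ n * (q * ((Q ^+ 3 * gx + P * Q ^+ 2 * gy) * h - g * (Q ^+ 3 * hx + P * Q ^+ 2 * hy))
       - P * Q ^+ 2 * ((gy * h - g * hy) * q))) / (Q ^+ 3 * q * g ^+ 2)).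
  by rewrite UxE; field; rewrite Q0 q0 g0.
by rewrite e2 e3 -UU; field; rewrite Q0 q0 g0.
Qed.

Lemma elim_rational P Q v g h gx gy hx hy : Q != 0 -> h != 0 -> v * Q = P ->
  (Q ^+ 3 * gx + P * Q ^+ 2 * gy) * h - g * (Q ^+ 3 * hx + P * Q ^+ 2 * hy) = 0 ->
  gx / h + g * (- hx / h ^+ 2) + v * (gy / h + g * (- hy / h ^+ 2)) = 0.
Proof.
move=> Q0 h0 <- e.
transitivity (((Q ^+ 3 * gx + v * Q * Q ^+ 2 * gy) * h - g * (Q ^+ 3 * hx + v * Q * Q ^+ 2 * hy)) / (Q ^+ 3 * h ^+ 2)).
  by field; rewrite Q0 h0.
by rewrite e mul0r.
Qed.

Lemma logarithmic_form q p u y : q != 0 -> u != 0 ->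
  q * y = p * u <-> y / u + -1 * (p / q) = 0.
Proof.
move=> q0 u0; rewrite mulN1r; split=> [e|/subr0_eq e].
  by apply/eqP; rewrite subr_eq0 eqr_div // [y * q]mulrC e.
by rewrite -[y](divfK u0) e mulrA mulrCA mulfV // mulr1.
Qed.

Lemma unit_equation (o e p u y : F) : o = 1 -> e = 0 -> o * y = e * u + o * p -> y = p.
Proof. by move=> -> ->; rewrite !mul1r mul0r add0r. Qed.

Lemma quotient_derivative_eq0 (g h gy hy : F) : h != 0 ->
  gy / h + g * (- hy / h ^+ 2) = 0 -> gy * h - g * hy = 0.
Proof.
move=> h0 e; transitivity ((gy / h + g * (- hy / h ^+ 2)) * h ^+ 2); first by field.
by rewrite e mul0r.
Qed.

End Elimination2.

Section Morphism2.
Variables (S : comNzRingType) (F : fieldType) (phi : {rmorphism S -> F}).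
Variables (P Q p q Py Qy px py qx qy g h gx gy hx hy a ay : S).
Variables (U Ux Uy X : F).
Let evm := (rmorph_nat phi, rmorphXn phi, rmorphB phi, rmorphN phi, rmorphD phi, rmorphM phi).

Lemma morph_compat : phi Q != 0 -> phi q != 0 -> U != 0 ->
  phi a = phi Py * phi Q - phi P * phi Qy ->
  phi (Q ^+ 2 * q) * Ux + phi (a * q + P * Q * p) * U = 0 ->
  phi (2%:R * Q * Qy * q + Q ^+ 2 * qy) * Ux + phi (Q ^+ 2 * q) * X +
    (phi (ay * q + a * qy + Py * Q * p + P * Qy * p + P * Q * py) * U
     + phi (a * q + P * Q * p) * Uy) = 0 ->
  phi (q * (Q ^+ 3 * px + P * Q ^+ 2 * py) - p * (Q ^+ 3 * qx + P * Q ^+ 2 * qy) +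
   Q * a * p * q + (ay * Q - 2%:R * a * Qy) * q ^+ 2) = 0 ->
  X / U + Uy * (- Ux / U ^+ 2) + (0 * (phi p / phi q) +
    -1 * (phi px / phi q + phi p * (- phi qx / phi q ^+ 2))) = 0.
Proof. by move=> Q0 q0 U0; rewrite !evm => ->; exact: elim_compat. Qed.

Lemma morph_power n : phi Q != 0 -> phi q != 0 -> phi g != 0 ->
  phi q * Uy = phi p * U ->
  phi (Q ^+ 2 * q) * Ux + phi (a * q + P * Q * p) * U = 0 ->
  phi ((gy * h - g * hy) * q) = phi (n%:R * p * g * h) ->
  phi ((Q ^+ 3 * gx + P * Q ^+ 2 * gy) * h - g * (Q ^+ 3 * hx + P * Q ^+ 2 * hy))
    = phi (- (n%:R * Q * a * g * h)) ->
  n%:R * U ^+ n.-1 * Uy * (phi h / phi g) +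
    U ^+ n * (phi hy / phi g + phi h * (- phi gy / phi g ^+ 2)) = 0 /\
  n%:R * U ^+ n.-1 * Ux * (phi h / phi g) +
    U ^+ n * (phi hx / phi g + phi h * (- phi gx / phi g ^+ 2)) = 0.
Proof.
rewrite !evm => Q0 q0 g0 e3 e4 e1 e2.
by split; [exact: (elim_power_y q0 g0 e3 e1)|exact: (elim_power_x Q0 q0 g0 e4 e1 e2)].
Qed.

End Morphism2.

Section Evaluation2.
Variables (k : comNzRingType) (F : fieldType) (phi : {rmorphism {poly {poly k}} -> F}).
Variables (P Q p q : {poly {poly k}}).
Implicit Types (U X : F).
Let evm := (rmorph_nat phi, rmorphXn phi, rmorphB phi, rmorphN phi, rmorphD phi, rmorphM phi).

Lemma eval_compat U X Ux Uy :
  phi Q != 0 -> phi q != 0 -> U != 0 ->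
  phi (Q ^+ 2 * q) * Ux + phi (dyF P Q * q + P * Q * p) * U = 0 ->
  phi (polyDy (Q ^+ 2 * q)) * Ux + phi (Q ^+ 2 * q) * X +
    (phi (polyDy (dyF P Q * q + P * Q * p)) * U
     + phi (dyF P Q * q + P * Q * p) * Uy) = 0 ->
  factor_eq P Q p q = 0 ->
  X / U + Uy * (- Ux / U ^+ 2) + (0 * (phi p / phi q) +
    -1 * (phi (polyDx p) / phi q + phi p * (- phi (polyDx q) / phi q ^+ 2))) = 0.
Proof.
have -> : polyDy (Q ^+ 2 * q) = 2%:R * Q * polyDy Q * q + Q ^+ 2 * polyDy q.
  by rewrite polyDyM polyDyX expr1.
have -> : polyDy (dyF P Q * q + P * Q * p) =
  polyDy (dyF P Q) * q + dyF P Q * polyDy q + polyDy P * Q * p + P * polyDy Q * p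
   + P * Q * polyDy p by rewrite polyDyD !polyDyM; ring.
rewrite /factor_eq /hom_eq /flow /dyyF => Q0 q0 U0 e4 e5 /(congr1 phi); rewrite rmorph0 => e6.
exact: (morph_compat Q0 q0 U0 (eval_dyF phi P Q) e4 e5 e6).
Qed.

Lemma eval_fy U fx fxy Ux Uy :
  phi Q != 0 -> phi q != 0 ->
  phi (polyDy Q) * fx + phi Q * fxy + (phi (polyDy P) * U + phi P * Uy) = 0 ->
  phi Q * fx + phi P * U = 0 -> phi q * Uy = phi p * U ->
  phi (Q ^+ 2 * q) * Ux + phi (dyF P Q * q + P * Q * p) * U = 0 ->
  fxy + (0 * U + -1 * Ux) = 0.
Proof.
rewrite /dyF !evm => Q0 q0 e1 e2 e3 e4; exact: (elim_fy Q0 q0 e1 e2 e3 e4).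
Qed.

Lemma eval_power U Ux Uy (n : nat) g h :
  phi Q != 0 -> phi q != 0 -> phi g != 0 -> power_eq P Q p q n g h ->
  phi q * Uy = phi p * U ->
  phi (Q ^+ 2 * q) * Ux + phi (dyF P Q * q + P * Q * p) * U = 0 ->
  n%:R * U ^+ n.-1 * Uy * (phi h / phi g) +
    U ^+ n * (phi (polyDy h) / phi g + phi h * (- phi (polyDy g) / phi g ^+ 2)) = 0 /\
  n%:R * U ^+ n.-1 * Ux * (phi h / phi g) +
    U ^+ n * (phi (polyDx h) / phi g + phi h * (- phi (polyDx g) / phi g ^+ 2)) = 0.
Proof.
move=> Q0 q0 g0 [/(congr1 phi) e1 /(congr1 phi) e2] e3 e4; rewrite /flow in e2.
exact: (morph_power Q0 q0 g0 e3 e4 e1 e2).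
Qed.

Lemma eval_rational v g h : phi Q != 0 -> phi h != 0 -> v * phi Q = phi P ->
  flow P Q g * h - g * flow P Q h = 0 ->
  phi (polyDx g) / phi h + phi g * (- phi (polyDx h) / phi h ^+ 2) +
    v * (phi (polyDy g) / phi h + phi g * (- phi (polyDy h) / phi h ^+ 2)) = 0.
Proof.
move=> Q0 h0 e /(congr1 phi) e2; rewrite rmorph0 /flow !evm in e2.
exact: (elim_rational Q0 h0 e e2).
Qed.

End Evaluation2.

Section Sufficient.
Variable R : realType.
Local Notation C := (Cplx R).
Implicit Types (x y r : C) (f g U : C * C -> C) (z w c : C * C) (D N : set (C * C)).
Implicit Types (p q P Q : polyxy C) (F B G : ratfun C) (n : nat).
Notation pv p w := (ev w.1 w.2 p).

Lemma is_derive_divide f g z (v : C * C) (a b : C) : g z != 0 ->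
  is_derive z v f a -> is_derive z v g b ->
  is_derive z v (fun w => f w / g w) (a / g z + f z * (- b / g z ^+ 2)).
Proof. by move=> g0 hf hg; exact: is_derive_mul hf (is_derive_inv g0 hg). Qed.

Lemma open_near_in r z : open (near_in r z).
Proof. by rewrite openE => w; exact: near_in_open. Qed.

Lemma dy_line f g r z : 0 < r -> analytic_at f z -> analytic_at g z ->
  (forall w, near_in r z w -> w.1 = z.1 -> f w = g w) -> dy f z = dy g z.
Proof.
move=> r0 hf hg fg.
have [df _] := analytic_derive_y hf; have [dg _] := analytic_derive_y hg.
have e : \forall h \near (0 : C)^', h^-1 *: ((f \o shift z) (h *: (0, 1)) - f z) =
    h^-1 *: ((g \o shift z) (h *: (0, 1)) - g z).
  near=> h.
  have hr : `|h| < r.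
    near: h; apply: nbhs_dnbhs; exists r => // y /=; by rewrite sub0r normrN.
  have E1 : f z = g z by apply: fg => //; exact: near_in_center.
  have E2 : f (h *: (0, 1) + z) = g (h *: (0, 1) + z).
    case: (z) fg => z1 z2 /= fg; rewrite scale_y_shift; apply: fg => //.
    by split=> /=; rewrite ?subrr ?normr0 ?addrK.
  by rewrite /= /shift E1 E2.
rewrite /dy /derive.
have cf : (fun h : C => h^-1 *: ((f \o shift z) (h *: (0, 1)) - f z)) @ 0^' --> 'D_(0, 1) f z by exact: df.
have cg : (fun h : C => h^-1 *: ((g \o shift z) (h *: (0, 1)) - g z)) @ 0^' --> 'D_(0, 1) g z by exact: dg.
have cg' : (fun h : C => h^-1 *: ((g \o shift z) (h *: (0, 1)) - g z)) @ 0^' --> 'D_(0, 1) f z.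
  by apply: cvg_trans cf; apply: near_eq_cvg.
exact: (cvg_unique _ cg' cg).
Unshelve. all: by end_near. Qed.

Lemma dx_dy f z : analytic_at f z -> is_derive z (1, 0) (dy f) (dy (dx f) z).
Proof. by move=> hf; rewrite -(analytic_schwarz hf); exact: analytic_derive_x (analytic_dy hf). Qed.

Lemma near_in_le r r' z w : r <= r' -> near_in r z w -> near_in r' z w.
Proof. by move=> rr [h1 h2]; split; [exact: lt_le_trans h1 rr | exact: lt_le_trans h2 rr]. Qed.

Lemma near_in_axis r z w : near_in r z w -> near_in r z (z.1, w.2).
Proof. by move=> [h1 h2]; split=> //=; rewrite subrr normr0; exact: le_lt_trans h1. Qed.

(** A first integral f on D whose y-derivative has logarithmic derivative p/q,
    away from all poles and zeros. *)
Definition solution P Q p q (D : set (C * C)) f : Prop :=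
  [/\ forall w, D w -> analytic_at f w,
      forall w, D w -> pv Q w != 0 /\ pv q w != 0,
      forall w, D w -> dy f w != 0,
      forall w, D w -> pv Q w * dx f w + pv P w * dy f w = 0
    & forall w, D w -> pv q w * dy (dy f) w = pv p w * dy f w].

Section Construct.
Variables (P Q p q s : polyxy C) (c : C * C).
Hypotheses (Qc : pv Q c != 0) (qc : pv q c != 0) (sc : pv s c != 0)
  (eqn : factor_eq P Q p q = 0).

(** The quantity U_y/U - p/q does not depend on x, and vanishes on the axis
    through c. *)
Lemma Uy_from_axis (U phi : C * C -> C) r : 0 < r ->
  (forall w, near_in r c w -> [/\ analytic_at U w, analytic_at phi w, U w != 0,
     pv Q w != 0 & pv q w != 0]) ->
  (forall w, near_in r c w ->
     pv (Q ^+ 2 * q) w * dx U w + pv (dyF P Q * q + P * Q * p) w * U w = 0) ->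
  (forall w, near_in r c w -> pv q w * dy phi w = pv p w * phi w) ->
  (forall w, near_in r c w -> w.1 = c.1 -> U w = phi w) ->
  forall w, near_in r c w -> pv q w * dy U w = pv p w * U w.
Proof.
move=> r0 hD e4 ephi Uphi.
pose V w : C := dy U w / U w + -1 * (pv p w / pv q w).
have DV w : near_in r c w -> is_derive w (1, 0) V 0.
  move=> wr; have [hU _ U0 Q0 q0] := hD w wr.
  have e5 := derive_zero_on (@open_near_in r c) wr e4
   (is_derive_add (is_derive_mul (poly_y _ _) (analytic_derive_y (analytic_dx hU)))
                  (is_derive_mul (poly_y _ _) (analytic_derive_y hU))).
  have D := is_derive_add (is_derive_divide U0 (dx_dy hU) (analytic_derive_x hU))
   (is_derive_mul (is_derive_const (-1) w (1, 0)) (is_derive_divide q0 (poly_x p w) (poly_x q w))).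
  exact: (is_derive_eq D (eval_compat Q0 q0 U0 (e4 w wr) e5 eqn)).
move=> w wr; have [_ _ U0 Q0 q0] := hD w wr.
have ar := near_in_axis wr; have [aU aphi aU0 _ aq0] := hD _ ar.
have Va : V (c.1, w.2) = 0.
  have [h1 h2] := ar.
  have r'0 : 0 < r - `|w.2 - c.2| by rewrite subr_gt0.
  have e : dy U (c.1, w.2) = dy phi (c.1, w.2).
    apply: (dy_line r'0 aU aphi) => u [u1 u2] ue; apply: Uphi => //.
    split; first by rewrite ue subrr normr0.
    rewrite -(subrK w.2 u.2) -addrA; apply: le_lt_trans (ler_normD _ _) _.
    by rewrite -ltrBrDr.
  apply/(logarithmic_form _ _ aq0 aU0).
  by rewrite e (Uphi _ ar erefl); exact: ephi.
by apply/(logarithmic_form _ _ q0 U0); have := const_in_x DV wr; rewrite Va.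
Qed.

(** The difference f_y - U does not depend on x, and vanishes on the axis
    through c. *)
Lemma fy_from_axis (U psi f : C * C -> C) r : 0 < r ->
  (forall w, near_in r c w -> [/\ analytic_at U w, analytic_at psi w, analytic_at f w,
     pv Q w != 0 & pv q w != 0]) ->
  (forall w, near_in r c w -> pv Q w * dx f w + pv P w * U w = 0) ->
  (forall w, near_in r c w -> pv q w * dy U w = pv p w * U w) ->
  (forall w, near_in r c w ->
     pv (Q ^+ 2 * q) w * dx U w + pv (dyF P Q * q + P * Q * p) w * U w = 0) ->
  (forall w, near_in r c w -> dy psi w = U w) ->
  (forall w, near_in r c w -> w.1 = c.1 -> f w = psi w) ->
  forall w, near_in r c w -> dy f w = U w.
Proof.
move=> r0 hD e2 e3 e4 epsi fpsi.
pose V w : C := dy f w + -1 * U w.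
have DV w : near_in r c w -> is_derive w (1, 0) V 0.
  move=> wr; have [hU _ hf Q0 q0] := hD w wr.
  have e1 := derive_zero_on (@open_near_in r c) wr e2
   (is_derive_add (is_derive_mul (poly_y _ _) (analytic_derive_y (analytic_dx hf)))
                  (is_derive_mul (poly_y _ _) (analytic_derive_y hU))).
  have D := is_derive_add (dx_dy hf)
   (is_derive_mul (is_derive_const (-1) w (1, 0)) (analytic_derive_x hU)).
  exact: (is_derive_eq D (eval_fy Q0 q0 e1 (e2 w wr) (e3 w wr) (e4 w wr))).
move=> w wr.
have ar := near_in_axis wr; have [_ apsi af _ _] := hD _ ar.
have Va : V (c.1, w.2) = 0.
  have [h1 h2] := ar.
  have r'0 : 0 < r - `|w.2 - c.2| by rewrite subr_gt0.
  have e : dy f (c.1, w.2) = dy psi (c.1, w.2).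
    apply: (dy_line r'0 af apsi) => u [u1 u2] ue; apply: fpsi => //.
    split; first by rewrite ue subrr normr0.
    rewrite -(subrK w.2 u.2) -addrA; apply: le_lt_trans (ler_normD _ _) _.
    by rewrite -ltrBrDr.
  by rewrite /V e (epsi _ ar) mulN1r; exact: subrr.
by apply/subr0_eq; have := const_in_x DV wr; rewrite Va /V mulN1r.
Qed.

(** Four Cauchy problems: phi solves the equation in y of the integrating
    factor; U solves its equation in x and equals phi on the axis through c;
    psi is a primitive of U in y; f solves Q f_x = - P U and equals psi on the
    axis. The polynomial equation makes the equations compatible. *)
Lemma solution_exists : exists r f, 0 < r /\ solution P Q p q (near_in r c) f /\
  forall w, near_in r c w -> pv s w != 0.
Proof.
have one z : analytic_at (fun=> 1 : C) z := analytic_cst 1 z.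
have zero z : analytic_at (fun=> 0 : C) z := analytic_cst 0 z.
have [a1 [r1 [M1 [phi [h1 e1 i1]]]]] := ode_y p 0 qc (one c) (one c).
have [r10 _ _] := h1.
have hphi := ps_analytic h1 (near_in_center c r10).
have Qqc : (Q ^+ 2 * q).[c.1, c.2] != 0.
  by rewrite evE rmorphM rmorphXn mulf_neq0 ?expf_neq0.
have [a2 [r2 [M2 [U [h2 e2 i2]]]]] :=
  ode_x (- (dyF P Q * q + P * Q * p)) 0 Qqc (one c) hphi.
have [r20 _ _] := h2.
have hU := ps_analytic h2 (near_in_center c r20).
have onec : (1 : polyxy C).[c.1, c.2] != 0 by rewrite evE rmorph1 oner_neq0.
have [a3 [r3 [M3 [psi [h3 e3 i3]]]]] := ode_y 0 1 onec hU (zero c).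
have [r30 _ _] := h3.
have hpsi := ps_analytic h3 (near_in_center c r30).
have [a4 [r4 [M4 [f [h4 e4 i4]]]]] := ode_x 0 (- P) Qc hU hpsi.
have [r40 _ _] := h4.
have Uc : U c != 0.
  rewrite (i2 c (near_in_center c r20) erefl) (i1 c (near_in_center c r10) erefl).
  exact: oner_neq0.
have nb : nbhs c [set w | pv (Q * q * s) w != 0 /\ U w != 0].
  apply: filterI; last exact: (continuous_neq0 (analytic_continuous hU)).
  apply: poly_neq0_near; rewrite evE !rmorphM !mulf_neq0 //.
have [r5 [r50 r51 r52]] := min_radius r10 r20.
have [r6 [r60 r63 r64]] := min_radius r30 r40.
have [r7 [r70 r75 r76]] := min_radius r50 r60.
have [r [r0 rr7 hr]] := near_in_shrink r70 nb.
have le1 : r <= r1 by apply: le_trans rr7 (le_trans r75 r51).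
have le2 : r <= r2 by apply: le_trans rr7 (le_trans r75 r52).
have le3 : r <= r3 by apply: le_trans rr7 (le_trans r76 r63).
have le4 : r <= r4 by apply: le_trans rr7 (le_trans r76 r64).
have nz w : near_in r c w -> [/\ pv Q w != 0, pv q w != 0, pv s w != 0 & U w != 0].
  move=> /hr[]; rewrite !rmorphM !mulf_eq0 !negb_or => /andP[/andP[x1 x2] x3] x4.
  by split.
have aU w (wr : near_in r c w) := ps_analytic h2 (near_in_le le2 wr).
have aphi w (wr : near_in r c w) := ps_analytic h1 (near_in_le le1 wr).
have apsi w (wr : near_in r c w) := ps_analytic h3 (near_in_le le3 wr).
have af w (wr : near_in r c w) := ps_analytic h4 (near_in_le le4 wr).
have E4 w : near_in r c w ->
     pv (Q ^+ 2 * q) w * dx U w + pv (dyF P Q * q + P * Q * p) w * U w = 0.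
  move=> wr; have := e2 w (near_in_le le2 wr).
  rewrite !evE rmorph0 mul0r addr0 rmorphN mulNr => ->; exact: addNr.
have Ephi w : near_in r c w -> pv q w * dy phi w = pv p w * phi w.
  by move=> wr; have := e1 w (near_in_le le1 wr); rewrite !evE rmorph0 mul0r addr0.
have EU := Uy_from_axis r0 (fun w wr => let: And4 x1 x2 _ x4 := nz w wr in
     And5 (aU w wr) (aphi w wr) x4 x1 x2) E4 Ephi
   (fun w wr => i2 w (near_in_le le2 wr)).
have Epsi w : near_in r c w -> dy psi w = U w.
  move=> wr; exact: (unit_equation (rmorph1 (ev w.1 w.2)) (rmorph0 (ev w.1 w.2))
    (e3 w (near_in_le le3 wr))).
have Ef w : near_in r c w -> pv Q w * dx f w + pv P w * U w = 0.
  move=> wr; have := e4 w (near_in_le le4 wr).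
  by rewrite !evE rmorph0 mul0r add0r rmorphN mulNr => ->; exact: addNr.
have fyU := fy_from_axis r0 (fun w wr => let: And4 x1 x2 _ x4 := nz w wr in
     And5 (aU w wr) (apsi w wr) (af w wr) x1 x2) Ef EU E4 Epsi
   (fun w wr => i4 w (near_in_le le4 wr)).
exists r, f; split; [exact: r0 | split; last by move=> w wr; have [_ _ h _] := nz w wr].
split; [exact: af | | | |] => w wr; have [x1 x2 _ x4] := nz w wr.
- by split.
- by rewrite (fyU w wr).
- by rewrite (fyU w wr); exact: Ef.
have -> : dy (dy f) w = dy U w.
  apply: near_eq_derive; have : nbhs w (near_in r c) by exact: near_in_open.
  by apply: filterS => u; exact: fyU.
by rewrite (fyU w wr); exact: EU.
Qed.

End Construct.
End Sufficient.

Section Bridge.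
Variable R : realType.
Local Notation C := (Cplx R).
Implicit Types (x y r : C) (f U V : C * C -> C) (z w c : C * C) (D N : set (C * C)).
Implicit Types (p q P Q g h : polyxy C) (F B G : ratfun C) (n m : nat).
Notation pv p w := (ev w.1 w.2 p).

Lemma near_in_domain r c : 0 < r -> domain (near_in r c).
Proof.
move=> r0; split; first by exists c; exact: near_in_center.
  exact: open_near_in.
exact: near_in_connected.
Qed.

(** Otherwise f is constant near z, and its derivative vanishes. *)
Lemma values_differ D f z : open D -> D z -> analytic_at f z -> dy f z != 0 ->
  exists z w, [/\ D z, D w & f z != f w].
Proof.
move=> oD Dz hf; apply: contra_neqP => H.
have f0 w : D w -> f w + - f z = 0.
  move=> Dw; apply/eqP; rewrite subr_eq0; apply/negPn/negP => fwz.
  by apply: H; exists w, z.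
have := derive_zero_on oD Dz f0 (is_derive_add (analytic_derive_y hf) (is_derive_const (- f z) z (0, 1))).
by rewrite addr0.
Qed.

Section Solution.
Variables (F B : ratfun C) (P Q p q : polyxy C) (r : C) (c : C * C) (f : C * C -> C).
Hypotheses (FPQ : is_frac F P Q) (Bpq : is_frac B p q) (r0 : 0 < r)
  (sol : solution P Q p q (near_in r c) f).

Lemma solution_first_integral : first_integral F (near_in r c) f.
Proof.
have [af nz fy fe _] := sol; have cc := near_in_center c r0.
split; [exact: near_in_domain | exact: af | |].
  exact: (values_differ (@open_near_in _ r c) cc (af c cc) (fy c cc)).
move=> z v Dz /(value_at_eq FPQ) e.
have [Qz _] := nz z Dz; apply: (mulfI Qz); rewrite mulr0 mulrDr mulrA.
by rewrite [_ * v]mulrC (e : v * pv Q z = pv P z); exact: fe.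
Qed.

Lemma solution_log_dy : log_dy (near_in r c) (dy f) B.
Proof.
have [af nz fy _ Ue] := sol; have cc := near_in_center c r0.
split; first by exists c; split; [exact: cc | exact: fy].
move=> z v Dz /(value_at_eq Bpq) e.
have [_ qz] := nz z Dz; apply: (mulfI qz); rewrite (Ue z Dz) mulrA.
by rewrite [_ * v]mulrC (e : v * pv q z = pv p z).
Qed.

Lemma solution_integrating_factor : integrating_factor F (near_in r c) (dy f).
Proof.
split; first by exists B; exact: solution_log_dy.
by exists f; split; [exact: solution_first_integral | by []].
Qed.

(** U^n h/g is constant, as its partial derivatives vanish on the polydisc. *)
Lemma solution_rational_power n g h : (0 < n)%N -> power_eq P Q p q n g h ->
  (forall w, near_in r c w -> pv (g * h) w != 0) -> rational_power (near_in r c) (dy f) n.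
Proof.
move=> n0 pe gh; split=> //.
have [af nz fy fe Ue] := sol; have cc := near_in_center c r0.
have gh' w : near_in r c w -> pv g w != 0 /\ pv h w != 0.
  by move=> /gh; rewrite rmorphM mulf_eq0 negb_or => /andP[].
have e4 w (wr : near_in r c w) := local_Ux (@open_near_in _ r c) af fe Ue wr.
pose V w : C := dy f w ^+ n * (pv h w / pv g w).
have DVx w : near_in r c w -> is_derive w (1, 0) V 0.
  move=> wr; have [Qw qw] := nz w wr; have [gw hw] := gh' w wr.
  have D := is_derive_mul (is_derive_pow n (analytic_derive_x (analytic_dy (af w wr))))
    (is_derive_divide gw (poly_x h w) (poly_x g w)).
  exact: (is_derive_eq D (eval_power Qw qw gw pe (Ue w wr) (e4 w wr)).2).
have DVy w : near_in r c w -> is_derive w (0, 1) V 0.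
  move=> wr; have [Qw qw] := nz w wr; have [gw hw] := gh' w wr.
  have D := is_derive_mul (is_derive_pow n (analytic_derive_y (analytic_dy (af w wr))))
    (is_derive_divide gw (poly_y h w) (poly_y g w)).
  exact: (is_derive_eq D (eval_power Qw qw gw pe (Ue w wr) (e4 w wr)).1).
have Vc w : near_in r c w -> V w = V c.
  move=> wr; rewrite (const_in_x DVx wr) (const_in_y DVy (near_in_axis wr)).
  by rewrite /= -surjective_pairing.
have hn0 : h != 0.
  by apply/eqP => h0; have [_] := gh' c cc; rewrite h0 rmorph0 eqxx.
exists (tofrac ((V c)%:P%:P * g) / tofrac h) => z v Dz.
have [gz hz] := gh' z Dz.
move=> /(value_at_eq (is_frac_intro _ hn0)) e; apply: (mulIf hz).
have {}e : v * pv h z = pv ((V c)%:P%:P * g) z := e.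
rewrite e rmorphM.
have -> : pv (V c)%:P%:P z = V c by rewrite -evE !hornerC.
rewrite -(Vc z Dz) /V -mulrA divfK //.
Qed.

End Solution.

Lemma solution_at (P Q p q s : polyxy C) : Q != 0 -> q != 0 -> s != 0 ->
  factor_eq P Q p q = 0 ->
  exists c r f, 0 < r /\ solution P Q p q (near_in r c) f /\
    forall w, near_in r c w -> pv s w != 0.
Proof.
move=> Q0 q0 s0 e; have h0 : Q * q * s != 0 by rewrite !mulf_neq0.
have [c [_ hc]] := poly_dense (z := (0, 0)) h0 filterT.
exists c; move: hc; rewrite evE !rmorphM !mulf_eq0 !negb_or => /andP[/andP[h1 h2] h3].
exact: solution_exists.
Qed.

(** The centre is any point where Q and q do not vanish. *)
Theorem factor_eq_integrating_factor F B P Q p q : is_frac F P Q -> is_frac B p q ->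
  factor_eq P Q p q = 0 -> exists D U, integrating_factor F D U /\ log_dy D U B.
Proof.
move=> FPQ Bpq e; have [Q0 _] := FPQ; have [q0 _] := Bpq.
have [c [r [f [r0 [sol _]]]]] := solution_at Q0 q0 (oner_neq0 _) e.
exists (near_in r c), (dy f); split.
  exact: solution_integrating_factor FPQ Bpq r0 sol.
exact: solution_log_dy Bpq r0 sol.
Qed.

Theorem rational_first_integral F P Q g h : is_frac F P Q -> h != 0 ->
  flow P Q g * h - g * flow P Q h = 0 -> polyDy g * h - g * polyDy h != 0 ->
  has_rational_first_integral F.
Proof.
move=> FPQ h0 e ne; have [Q0 _] := FPQ.
have s0 : Q * h * (polyDy g * h - g * polyDy h) != 0 by rewrite !mulf_neq0.
have [c [_ hc]] := poly_dense (z := (0, 0)) s0 filterT.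
have [r r0 hr] := (nbhs_near_in _ _).1 (poly_neq0_near hc).
have nz w : near_in r c w -> [/\ pv Q w != 0, pv h w != 0 & pv (polyDy g * h - g * polyDy h) w != 0].
  move=> /hr; rewrite evE !rmorphM !mulf_eq0 !negb_or => /andP[/andP[h1 h2] h3].
  by split.
pose f w : C := pv g w / pv h w.
have cc := near_in_center c r0.
have fx w (wr : near_in r c w) : is_derive w (1, 0) f _ :=
  let: And3 _ hw _ := nz w wr in is_derive_divide hw (poly_x g w) (poly_x h w).
have fy w (wr : near_in r c w) : is_derive w (0, 1) f _ :=
  let: And3 _ hw _ := nz w wr in is_derive_divide hw (poly_y g w) (poly_y h w).
have af w : near_in r c w -> analytic_at f w.
  by move=> /nz[_ hw _]; exact: analytic_quotient.
exists (near_in r c), f, (tofrac g / tofrac h); split; last first.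
  move=> z v Dz /(value_at_eq (is_frac_intro _ h0)) ev'; have [_ hz _] := nz z Dz.
  by apply: (mulIf hz); rewrite divfK.
split; [exact: near_in_domain | exact: af | |].
  apply: (values_differ (@open_near_in _ r c) cc (af c cc)).
  have [_ hz kz] := nz c cc; have [_ fyE] := fy c cc; rewrite /dy fyE.
  move: kz; apply: contra_neq => E.
  rewrite rmorphB !rmorphM; exact: (quotient_derivative_eq0 hz E).
move=> z v Dz /(value_at_eq FPQ) ev'; have [Qz hz _] := nz z Dz.
have [_ fxE] := fx z Dz; have [_ fyE] := fy z Dz; rewrite /dx /dy fxE fyE.
exact: (eval_rational Qz hz ev' e).
Qed.

(** The degree of U is the least exponent allowed by power_eq. Any other
    algebraic integrating factor satisfies power_eq for its own logarithmic
    derivative. If this is not the one of U, then power_eq_quotient gives a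
    rational first integral; and if it is, the exponent is not smaller. *)
Theorem minimal_factor F B P Q p q n g h : is_frac F P Q -> is_frac B p q ->
  ~ has_rational_first_integral F -> factor_eq P Q p q = 0 ->
  (0 < n)%N -> g != 0 -> h != 0 -> power_eq P Q p q n g h ->
  exists D U, minimal_algebraic_integrating_factor F D U /\ log_dy D U B.
Proof.
move=> FPQ Bpq norfi e n0 g0 h0 pe; have [Q0 _] := FPQ; have [q0 _] := Bpq.
pose A m := `[< (0 < m)%N /\ exists g h, [/\ g != 0, h != 0 & power_eq P Q p q m g h] >].
have exA : exists m, A m by exists n; apply/asboolP; split=> //; exists g, h.
have [m /asboolP[m0 [g1 [h1 [g10 h10 pe1]]]] mmin] := ex_minnP exA.
have Amin i gi hi : (0 < i)%N -> gi != 0 -> hi != 0 -> power_eq P Q p q i gi hi -> (m <= i)%N.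
  by move=> i0 gi0 hi0 pei; apply: mmin; apply/asboolP; split=> //; exists gi, hi.
have [c [r [f [r0 [sol gh]]]]] := solution_at Q0 q0 (mulf_neq0 g10 h10) e.
exists (near_in r c), (dy f); split; last exact: solution_log_dy Bpq r0 sol.
have IF := solution_integrating_factor FPQ Bpq r0 sol.
split; first exact: IF.
exists m; split.
  split; first exact: (solution_rational_power r0 sol m0 pe1 gh).
  move=> i [i0 [G UG]]; have [gi [hi Gi]] := frac_repr G.
  have [pei gi0] := algebraic_factor_eq (solution_first_integral FPQ r0 sol)
    (fun z _ => erefl) (solution_log_dy Bpq r0 sol) FPQ Bpq UG Gi.
  by apply: (Amin i gi hi) => //; case: Gi.
move=> D' V i [[B' VB'] [f' [Fi' Vf']]] [[i0 [G VG]] _].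
have [p' [q' Bpq']] := frac_repr B'; have [gi [hi Gi]] := frac_repr G.
have [q'0 _] := Bpq'; have [hi0 _] := Gi.
have [pei gi0] := algebraic_factor_eq Fi' Vf' VB' FPQ Bpq' VG Gi.
have [pq|pq] := eqVneq (p * q') (p' * q).
  exact: (Amin i gi hi i0 gi0 hi0 (power_eq_transfer q0 q'0 pq pei)).
case: norfi.
have [k1 k2] := power_eq_quotient pe1 pei.
have big0 : g1 * h1 * gi * hi != 0 := mulf_neq0 (mulf_neq0 (mulf_neq0 g10 h10) gi0) hi0.
apply: (rational_first_integral FPQ (g := g1 ^+ i * hi ^+ m) (h := h1 ^+ i * gi ^+ m)).
- exact: mulf_neq0 (expf_neq0 i h10) (expf_neq0 m gi0).
- by apply: (mulfI big0); rewrite mulr0.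
apply/eqP => k0; move: k2; rewrite k0 mulr0 => /esym/eqP; apply/negP.
have nm0 : (m * i)%:R != 0 :> polyxy C.
  by rewrite -polyC_natr -polyC_natr !polyC_eq0 pnatr_eq0 muln_eq0 negb_or -!lt0n m0 i0.
have pq0 : p * q' - p' * q != 0 by rewrite subr_eq0.
exact: (mulf_neq0 (mulf_neq0 (mulf_neq0 (mulf_neq0 nm0
  (mulf_neq0 (expf_neq0 i g10) (expf_neq0 m hi0)))
  (mulf_neq0 (expf_neq0 i h10) (expf_neq0 m gi0))) big0) pq0).
Qed.

End Bridge.

(** * Gauss's lemma in two variables *)

Section Gauss.
Variable k : closedFieldType.
Implicit Types (p q r g : {poly {poly k}}) (c : {poly k}) (a : k).

Definition lin a : {poly {poly k}} := ('X - a%:P)%:P.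

Definition at_y a : {rmorphism {poly {poly k}} -> {poly k}} :=
  GRing.RMorphism.clone _ _ (map_poly (horner_eval a)) _.

Lemma lin_neq0 a : lin a != 0.
Proof. by rewrite polyC_eq0 polyXsubC_eq0. Qed.

Lemma lin_dividesP a p : divides (lin a) p <-> at_y a p = 0.
Proof.
split=> [[e ->]|e0].
  by rewrite rmorphM /= /lin map_polyC /= /horner_eval !hornerE subrr mul0r.
exists (map_poly (fun c => c %/ ('X - a%:P)) p); apply/polyP => i.
rewrite coefCM coef_map_id0 ?div0p // mulrC divpK // dvdp_XsubCl.
by have /polyP/(_ i) := e0; rewrite coef_map coef0 => /eqP.
Qed.

(** The quotient by y - a is the domain k[x]. *)
Lemma lin_prime a p q : divides (lin a) (p * q) -> divides (lin a) p \/ divides (lin a) q.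
Proof.
rewrite !lin_dividesP rmorphM => /eqP.
by rewrite mulf_eq0 => /orP[] /eqP; [left | right].
Qed.

Lemma closed_root c : (1 < size c)%N -> exists a c', c = c' * ('X - a%:P) /\ (size c' < size c)%N.
Proof.
move=> sc; have /closed_rootP[a ra] : size c != 1%N by rewrite neq_ltn sc orbT.
have /factor_theorem[c' e] := ra; exists a, c'; split=> //.
have c0 : c != 0 by rewrite -size_poly_eq0; case: size sc.
have c'0 : c' != 0 by apply: contra_neq c0 => c'0; rewrite e c'0 mul0r.
by rewrite e size_Mmonic ?monicXsubC // size_XsubC addn2.
Qed.

Lemma small_unit c : c != 0 -> (size c <= 1)%N -> c \is a GRing.unit.
Proof.
move=> c0 c1; have /size_poly1P[x x0 ->] : size c == 1%N by rewrite eqn_leq c1 size_poly_gt0.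
by rewrite poly_unitE size_polyC x0 coefC eqxx unitfE.
Qed.

(** No common factor of the coefficients, which are polynomials in y: over an
    algebraically closed field linear factors suffice. *)
Definition primitive g := forall a, ~ divides (lin a) g.

(** The linear factors of c divide the right-hand side, hence s, and can be
    cancelled one by one. *)
Lemma primitive_cancel g c r s : primitive g -> c != 0 -> c%:P * r = g * s -> divides g r.
Proof.
move=> pg; have [n] := ubnP (size c); elim: n c s => // n IH c s sc c0 e.
have [c1|c1] := leqP (size c) 1.
  have cu : c \is a GRing.unit by exact: small_unit.
  exists (s * (c^-1)%:P); rewrite mulrA -e mulrAC -polyCM mulrV // mul1r //.
have [a [c' [ce sc']]] := closed_root c1.
have : divides (lin a) (g * s).
  by exists (c'%:P * r); rewrite -e ce polyCM /lin; ring.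
move=> /lin_prime[/pg//|[s' es]].
apply: (IH c' s'); first exact: leq_trans sc' _.
  by apply: contra_neq c0 => c'0; rewrite ce c'0 mul0r.
apply: (mulfI (lin_neq0 a)).
transitivity (c%:P * r); first by rewrite ce polyCM /lin; ring.
by rewrite e es; ring.
Qed.

Lemma primitive_part p : p != 0 -> exists c g, [/\ c != 0, primitive g & p = c%:P * g].
Proof.
have [n] := ubnP (size (lead_coef p)); elim: n p => // n IH p sp p0.
have [[a [p' e]]|np] := pselect (exists a, divides (lin a) p); last first.
  exists 1, p; rewrite oner_neq0 polyC1 mul1r; split=> // a h; by apply: np; exists a.
have p'0 : p' != 0 by apply: contra_neq p0 => p'0; rewrite e p'0 mulr0.
have [|c [g [c0 pg eg]]] := IH p' _ p'0.
  move: sp; rewrite e lead_coefM lead_coefC mulrC size_Mmonic ?monicXsubC ?lead_coef_eq0 //.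
  by rewrite size_XsubC addn2.
exists (('X - a%:P) * c), g; split=> //; first by rewrite mulf_neq0 // polyXsubC_eq0.
by rewrite e eg polyCM mulrA.
Qed.

Lemma lowest_terms_not_both p q a : lowest_terms p q -> divides (lin a) p -> ~ divides (lin a) q.
Proof.
move=> lt hp hq; have := lt _ hp hq.
rewrite poly_unitE size_polyC polyXsubC_eq0 /= coefC eqxx poly_unitE.
by rewrite size_XsubC.
Qed.

Lemma pseudo_dvdp p q : Pdiv.IdomainDefs.dvdp q p ->
  exists c s, c != 0 /\ c%:P * p = s * q.
Proof. by move=> /Pdiv.WeakIdomain.dvdpP[[c s] /= c0 e]; exists c, s; rewrite mul_polyC. Qed.

(** A common divisor over the field of rational functions in y has a primitive
    multiple, which is a common divisor of the polynomials themselves. *)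
Lemma lowest_terms_coprime p q : q != 0 -> lowest_terms p q -> coprimep p q.
Proof.
move=> q0 lt; apply/Pdiv.CommonIdomain.coprimepP => d /pseudo_dvdp[c1 [s [c10 e1]]] /pseudo_dvdp[c2 [t [c20 e2]]].
have d0 : d != 0.
  apply: contra_neq q0 => d0; apply/eqP; move/eqP: e2; rewrite d0 mulr0 mulf_eq0 polyC_eq0.
  by rewrite (negbTE c20).
have [c [g [c0 pg eg]]] := primitive_part d0.
have gp : divides g p.
  by apply: (primitive_cancel pg c10 (s := s * c%:P)); rewrite e1 eg; ring.
have gq : divides g q.
  by apply: (primitive_cancel pg c20 (s := t * c%:P)); rewrite e2 eg; ring.
have := lt g gp gq; rewrite poly_unitE => /andP[/eqP sg _].
by rewrite -Pdiv.CommonIdomain.size_poly_eq1 eg mul_polyC size_scale // sg.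
Qed.

(** Gauss's lemma: in lowest terms, the denominator divides r as soon as it
    divides the product of r by the numerator. *)
Lemma gauss p q r : q != 0 -> lowest_terms p q -> divides q (p * r) -> divides q r.
Proof.
move=> q0 lt [t et].
have /Pdiv.CommonIdomain.Bezout_coprimepP[[u v] /= huv] := lowest_terms_coprime q0 lt.
have [c c0 ec] : exists2 c, c != 0 & u * p + v * q = c%:P.
  move: huv; rewrite -Pdiv.CommonIdomain.size_poly_eq1 => /size_poly1P[c c0 ->].
  by exists c.
have [c1 [q1 [c10 pq1 eq1]]] := primitive_part q0.
have [r1 er1] : divides q1 r.
  apply: (@primitive_cancel q1 c r (c1%:P * (u * t + v * r))) => //.
  rewrite -ec mulrA [q1 * _]mulrC -eq1 mulrDl mulrDr -[u * p * r]mulrA et; ring.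
have q10 : q1 != 0 by apply: contra_neq q0 => h; rewrite eq1 h mulr0.
have e1 : c1%:P * t = p * r1.
  by apply: (mulfI q10); transitivity (q * t); [rewrite eq1; ring | rewrite -et er1; ring].
(* it remains to cancel the content c1 of q: its linear factors divide p r1,
   and not p *)
suff [r2 er2] : divides c1%:P r1.
  by exists r2; rewrite er1 er2 eq1; ring.
have sub a : divides (lin a) c1%:P -> ~ divides (lin a) p.
  move=> [e ee] hp; apply: (lowest_terms_not_both lt hp).
  by exists (e * q1); rewrite eq1 ee mulrA.
clear - c10 sub e1.
have [n] := ubnP (size c1); elim: n c1 r1 c10 sub e1 => // n IH c1 r1 c10 sub e1 sc.
have [c11|c11] := leqP (size c1) 1.
  have cu : c1 \is a GRing.unit by exact: small_unit.
  by exists ((c1^-1)%:P * r1); rewrite mulrA -polyCM mulrV // mul1r.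
have [a [c' [ce sc']]] := closed_root c11.
have la : divides (lin a) c1%:P by exists c'%:P; rewrite ce polyCM mulrC.
have : divides (lin a) (p * r1).
  by rewrite -e1; case: la => e ee; exists (e * t); rewrite ee mulrA.
case/lin_prime => [lp|[r1' er]]; first by case: (sub a la lp).
have c'0 : c' != 0 by apply: contra_neq c10 => h; rewrite ce h mul0r.
have [||r2 er2] := IH c' r1' c'0 _ _ (leq_trans sc' sc).
- move=> b [e ee]; apply: sub; exists (e * lin a); by rewrite ce polyCM ee mulrA.
- apply: (mulfI (lin_neq0 a)); transitivity (c1%:P * t); first by rewrite ce polyCM /lin; ring.
  by rewrite e1 er; ring.
by exists r2; rewrite er er2 ce polyCM /lin; ring.
Qed.

End Gauss.

(** * Linear independence *)

(** ** Separating functionals *)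
(** Phi is a class of functionals which contains the coordinates and is stable
    under linear combinations. *)
Section Separation.
Variables (R : idomainType) (I : Type) (Phi : ((I -> R) -> R) -> Prop).
Implicit Types (v u : I -> R) (vs : seq (I -> R)) (cs : seq R).

Definition independent vs := forall cs, size cs = size vs ->
  (forall i, \sum_(cv <- zip cs vs) cv.1 * cv.2 i = 0) -> all (pred1 0) cs.

Hypotheses (PhiL : forall phi, Phi phi -> forall a b v u,
     phi (fun i => a * v i + b * u i) = a * phi v + b * phi u)
  (PhiC : forall phi psi a b, Phi phi -> Phi psi -> Phi (fun v => a * phi v + b * psi v))
  (PhiE : forall i, Phi (fun v => v i)).

Lemma independent_behead v vs : independent (v :: vs) -> independent vs.
Proof.
move=> H cs sc e; have := H (0 :: cs); rewrite /= eqxx; apply; first by rewrite sc.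
by move=> i; rewrite big_cons mul0r add0r.
Qed.

(** By induction on the number of other vectors, as in Gaussian elimination
    but without division: the last vector serves as a pivot. *)
Lemma separation v vs : independent (v :: vs) ->
  exists2 phi, Phi phi & phi v != 0 /\ List.Forall (fun u => phi u = 0) vs.
Proof.
have [n] := ubnP (size vs); elim: n v vs => // n IH v [|w vs] /= sn H.
  have [i vi] : exists i, v i != 0.
    apply: contrapT => h; have /(_ _)/andP[|] := H [:: 1] erefl; last first.
      by rewrite /= oner_eq0.
    by move=> i; rewrite big_cons big_nil mul1r addr0; apply/eqP/negPn/negP => vi; apply: h; exists i.
  by exists (fun v => v i); [exact: PhiE | split; [|exact: List.Forall_nil]].
have [Y PY [Yw Yvs]] := IH w vs sn (independent_behead H).
(* eliminate w from v with the pivot Y w *)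
pose v' i := Y w * v i + - Y v * w i.
have H' : independent (v' :: vs).
  move=> [//|c cs] /= [sc] e.
  have /= := H (c * Y w :: - (c * Y v) :: cs); rewrite sc => /(_ erefl) {}H.
  have /H/and3P[h1 _ ->] : forall i, \sum_(cv <- (c * Y w, v) :: (- (c * Y v), w) :: zip cs vs) cv.1 * cv.2 i = 0.
    by move=> i; rewrite -[RHS](e i) !big_cons /v' /=; ring.
  by rewrite andbT; move: h1; rewrite mulf_eq0 (negbTE Yw) orbF.
have [X PX [Xv Xvs]] := IH v' vs sn H'.
exists (fun u => Y w * X u + - X w * Y u); first exact: PhiC.
split; first by have <- : X v' = Y w * X v + - X w * Y v by rewrite /v' PhiL //; ring.
apply: List.Forall_cons; first by rewrite mulNr mulrC subrr.
elim: vs Yvs Xvs {IH sn H H'} => // u vs IH.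
move=> /List.Forall_cons_iff[y1 y2] /List.Forall_cons_iff[x1 x2].
by apply: List.Forall_cons; [rewrite y1 x1; ring | exact: IH].
Qed.

End Separation.

(** ** Triangular certificates of independence *)
Section Triangular.
Variables (R : nzRingType) (T U : Type) (pair : T -> U -> R).

(** As a certificate this is checked by finitely many evaluations. *)
Fixpoint triangular (Ls : seq T) (vs : seq U) : bool :=
  match vs, Ls with
  | [::], _ => true
  | v :: vs', L :: Ls' =>
    [&& pair L v != 0, all (fun u => pair L u == 0) vs' & triangular Ls' vs']
  | _ :: _, [::] => false
  end.

Fixpoint pivots (Ls : seq T) (vs : seq U) : R :=
  match vs, Ls with
  | v :: vs', L :: Ls' => pair L v * pivots Ls' vs'
  | _, _ => 1
  end.

End Triangular.

Lemma pivots_neq0 (R : idomainType) (T U : Type) (pair : T -> U -> R) Ls vs :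
  triangular pair Ls vs -> pivots pair Ls vs != 0.
Proof.
elim: vs Ls => [|v vs IH] [|L Ls] //=; rewrite ?oner_neq0 // => /and3P[h1 _ h2].
by rewrite mulf_neq0 // IH.
Qed.

(** Separate each vector from the following ones. *)
Lemma independent_triangular (R : idomainType) (I T U : Type) (pair : T -> U -> R)
   (vec : U -> I -> R) (Phi : ((I -> R) -> R) -> Prop) :
  (forall phi, Phi phi -> forall a b v u,
     phi (fun i => a * v i + b * u i) = a * phi v + b * phi u) ->
  (forall phi psi a b, Phi phi -> Phi psi -> Phi (fun v => a * phi v + b * psi v)) ->
  (forall i, Phi (fun v => v i)) ->
  (forall phi, Phi phi -> exists L, forall u, pair L u = phi (vec u)) ->
  forall vs, independent (map vec vs) -> exists Ls, triangular pair Ls vs.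
Proof.
move=> PL PC PE PT; elim=> [|v vs IH] H; first by exists [::].
have [Ls hLs] := IH (independent_behead H).
have [phi Pphi [p1 p2]] := separation PL PC PE H.
have [L hL] := PT phi Pphi.
exists (L :: Ls) => /=; rewrite hL p1 hLs andbT /=.
elim: vs p2 {IH H hLs} => //= u vs IH /List.Forall_cons_iff[h1 h2].
by rewrite hL h1 eqxx IH.
Qed.

(** ** Two kinds of functionals *)
Section Functionals.
Variable k : comNzRingType.
Implicit Types (p q g h P Q : {poly {poly k}}).

(** The differential operator with coefficients X, applied to m. *)
Fixpoint flow_pairing P Q (X : seq {poly {poly k}}) m : {poly {poly k}} :=
  if X is x :: X' then x * m + flow_pairing P Q X' (flow P Q m) else 0.

Lemma flow_pairing_sum P Q (X : seq {poly {poly k}}) m n : (size X <= n)%N ->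
  flow_pairing P Q X m = \sum_(i < n) X`_i * iter i (flow P Q) m.
Proof.
elim: X m n => [|x X IH] m [|n] //= sX; rewrite ?big_ord0 //.
  by rewrite big1 // => i _; rewrite nth_nil mul0r.
rewrite big_ord_recl /= (IH _ n) //; congr (_ + _); apply: eq_bigr => i _.
by rewrite -iterSr.
Qed.

Definition dot p q : k := \sum_(i < size p) \sum_(j < size (nth 0 p i)) p`_i`_j * q`_i`_j.

Lemma dot_wide p q n : (size p <= n)%N -> (forall i, (size (nth 0%R p i) <= n)%N) ->
  dot p q = \sum_(i < n) \sum_(j < n) p`_i`_j * q`_i`_j.
Proof.
move=> pn pin; rewrite /dot (big_ord_widen _ (fun i => \sum_(j < size (nth 0 p i)) p`_i`_j * q`_i`_j) pn).
rewrite big_mkcond; apply: eq_bigr => i _; case: ltnP => ip; last first.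
  by rewrite nth_default // big1 // => j _; rewrite coef0 mul0r.
rewrite (big_ord_widen _ (fun j => p`_i`_j * q`_i`_j) (pin i)) big_mkcond.
by apply: eq_bigr => j _; case: ltnP => // jp; rewrite (nth_default 0 jp) mul0r.
Qed.

Lemma dotD p q r : dot p (q + r) = dot p q + dot p r.
Proof.
rewrite /dot -big_split; apply: eq_bigr => i _; rewrite -big_split.
by apply: eq_bigr => j _; rewrite !coefD mulrDr.
Qed.

Lemma dotZ p q (c : k) : dot p (c%:P%:P * q) = c * dot p q.
Proof.
rewrite /dot mulr_sumr; apply: eq_bigr => i _; rewrite mulr_sumr.
by apply: eq_bigr => j _; rewrite !coefCM; ring.
Qed.

Lemma dot_sum p (I : Type) (r : seq I) (F : I -> {poly {poly k}}) :
  dot p (\sum_(i <- r) F i) = \sum_(i <- r) dot p (F i).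
Proof.
elim: r => [|i r IH]; last by rewrite !big_cons dotD IH.
rewrite !big_nil /dot big1 // => i _; rewrite big1 // => j _.
by rewrite !coef0 mulr0.
Qed.

End Functionals.

Section FunctionalsComplete.
Variable k : idomainType.
Implicit Types (p q g h P Q : {poly {poly k}}).

Lemma independent_flow P Q ms :
  independent (map (fun m i => iter i (flow P Q) m) ms) ->
  exists Xs, triangular (flow_pairing P Q) Xs ms.
Proof.
move=> H.
apply: (@independent_triangular _ nat _ _ (flow_pairing P Q) (fun m i => iter i (flow P Q) m)
  (fun phi => exists X : {poly {poly {poly k}}}, forall v, phi v = \sum_(i < size X) X`_i * v i)
  _ _ _ _ ms H).
- move=> phi [X E] a b v u; rewrite !E !mulr_sumr -big_split.
  by apply: eq_bigr => i _ /=; ring.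
- move=> phi psi a b [X EX] [Y EY]; exists (a *: X + b *: Y) => v.
  have wide (Z : {poly {poly {poly k}}}) n : (size Z <= n)%N ->
      \sum_(i < size Z) Z`_i * v i = \sum_(i < n) Z`_i * v i.
    move=> Zn; rewrite (big_ord_widen _ (fun i => Z`_i * v i) Zn) big_mkcond.
    by apply: eq_bigr => i _; case: ltnP => // h; rewrite nth_default // mul0r.
  rewrite EX EY (wide X (maxn (size X) (size Y))) ?leq_maxl //.
  rewrite (wide Y (maxn (size X) (size Y))) ?leq_maxr //.
  rewrite (wide _ (maxn (size X) (size Y))); last first.
    apply: leq_trans (size_polyD _ _) _; rewrite geq_max !(leq_trans (size_scale_leq _ _)) ?leq_maxl ?leq_maxr //.
  rewrite !mulr_sumr -big_split; apply: eq_bigr => i _.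
  by rewrite /= coefD !coefZ; ring.
- move=> i; exists 'X^i => v; rewrite size_polyXn (bigD1 ord_max) //= coefXn eqxx mul1r.
  rewrite big1 ?addr0 // => j; rewrite -val_eqE /= => ji.
  by rewrite coefXn (negbTE ji) mul0r.
move=> phi [X E]; exists X => m; rewrite E; exact: flow_pairing_sum.
Qed.

Lemma independent_dot (vs : seq {poly {poly k}}) :
  independent (map (fun (v : {poly {poly k}}) (ij : nat * nat) => v`_ij.1`_ij.2) vs) ->
  exists Ls, triangular (@dot k) Ls vs.
Proof.
pose wdot p (v : nat * nat -> k) n := \sum_(i < n) \sum_(j < n) p`_i`_j * v (i : nat, j : nat).
pose rep (phi : (nat * nat -> k) -> k) p := exists n, forall v m, (n <= m)%N -> phi v = wdot p v m.
move=> H.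
apply: (@independent_triangular _ _ _ _ (@dot k) (fun (v : {poly {poly k}}) (ij : nat * nat) => v`_ij.1`_ij.2)
  (fun phi => exists p, rep phi p) _ _ _ _ vs H).
- move=> phi [p [n E]] a b v u; rewrite !(E _ _ (leqnn n)) /wdot.
  rewrite !mulr_sumr -big_split; apply: eq_bigr => i _; rewrite !mulr_sumr -big_split.
  by apply: eq_bigr => j _ /=; ring.
- move=> phi psi a b [p [n E]] [q [m F]]; exists (a%:P%:P * p + b%:P%:P * q), (maxn n m) => v l.
  rewrite geq_max => /andP[nl ml]; rewrite (E _ _ nl) (F _ _ ml) /wdot.
  rewrite !mulr_sumr -big_split; apply: eq_bigr => i _; rewrite !mulr_sumr -big_split.
  by apply: eq_bigr => j _ /=; rewrite !coefD !coefCM; ring.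
- move=> [i j]; exists ('X^i * ('X^j)%:P), (maxn i j).+1 => v m.
  rewrite gtn_max => /andP[im jm]; rewrite /wdot (bigD1 (Ordinal im)) //= (bigD1 (Ordinal jm)) //=.
  have cE i' j' : ('X^i * ('X^j)%:P : {poly {poly k}})`_i'`_j' = ((i' == i) && (j' == j))%:R.
    by rewrite coefMC coefXn; case: eqP => _; rewrite ?mul1r ?mul0r ?coef0 // coefXn.
  rewrite cE !eqxx mul1r [X in _ + X + _]big1 => [|j' h]; last first.
    by rewrite cE (_ : (j' == j :> nat) = false) ?andbF ?mul0r //; exact: negbTE.
  rewrite [X in _ + X]big1 ?addr0 // => i' h; rewrite big1 // => j' _.
  by rewrite cE (_ : (i' == i :> nat) = false) ?mul0r //; exact: negbTE.
move=> phi [p [n E]]; exists p => v.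
have [m [h1 h2]] := size_bound p.
rewrite (E _ _ (leq_maxl n m)) (@dot_wide _ _ _ (maxn n m)) //.
  by apply: leq_trans h1 (leq_maxr _ _).
by move=> i; apply: leq_trans (h2 i) (leq_maxr _ _).
Qed.

End FunctionalsComplete.

(** * Linear relations between derivatives along the flow *)

Section Constants.
Variable R : idomainType.
Hypothesis char0 : forall n, n.+1%:R != 0 :> R.
Implicit Types (p g h u : {poly R}).

Lemma size_deriv0 p : size p^`() = (size p).-1.
Proof.
case sp : (size p) => [|[|n]].
- by move/eqP: sp; rewrite size_poly_eq0 => /eqP ->; rewrite deriv0 size_poly0.
- have /size_poly1P[c _ ->] : size p == 1%N by rewrite sp.
  by rewrite derivC size_poly0.
apply/eqP; rewrite eqn_leq; apply/andP; split.
  have := lt_size_deriv (_ : p != 0); rewrite -size_poly_eq0 sp ltnS; exact.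
rewrite ltnNge; apply/negP => /leq_sizeP/(_ n (leqnn n)); rewrite coef_deriv => /eqP.
rewrite -mulr_natr mulf_eq0 (negbTE (char0 n)) orbF => /eqP e.
have : lead_coef p = 0 by rewrite lead_coefE sp.
by move/eqP; rewrite lead_coef_eq0 -size_poly_eq0 sp.
Qed.

Lemma lead_coef_deriv0 p : lead_coef p^`() = lead_coef p *+ (size p).-1.
Proof.
rewrite lead_coefE size_deriv0 coef_deriv lead_coefE.
by case sp: (size p) => [|[|n]] //=; rewrite mulr0n mulr1n nth_default ?sp.
Qed.

Lemma same_log_deriv_size u h : h != 0 -> u != 0 -> u^`() * h = u * h^`() -> size u = size h.
Proof.
move=> h0 u0 e.
have nz p : p^`() != 0 -> (1 < size p)%N.
  by apply: contraNltn => sp; rewrite -size_poly_leq0 size_deriv0; lia.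
have /(congr1 (@lead_coef R)) := e.
rewrite !lead_coefM !lead_coef_deriv0 mulrnAl mulrnAr => /eqP.
set c := lead_coef u * lead_coef h.
have c0 : c != 0 by rewrite mulf_neq0 ?lead_coef_eq0.
have su : (0 < size u)%N by rewrite size_poly_gt0.
have sh : (0 < size h)%N by rewrite size_poly_gt0.
rewrite -subr_eq0 => cc; apply/eqP; rewrite -(prednK su) -(prednK sh) eqSS.
have inj m n : (m < n)%N -> c *+ n - c *+ m != 0.
  move=> mn; rewrite -mulrnBr; last exact: ltnW.
  rewrite -mulr_natr mulf_neq0 //; move: mn; rewrite -subn_gt0; case: (n - m)%N => // d _; exact: char0.
case: (ltngtP (size u).-1 (size h).-1) => // /inj.
  by rewrite -opprB oppr_eq0 (eqP cc) eqxx.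
by rewrite (eqP cc) eqxx.
Qed.

(** In characteristic zero, equal logarithmic derivatives force equal degrees,
    and then the combination that cancels the leading coefficients still has
    the logarithmic derivative of h but a smaller degree, hence is zero. *)
Lemma same_log_deriv g h : h != 0 -> g^`() * h = g * h^`() ->
  (lead_coef h)%:P * g = (lead_coef g)%:P * h.
Proof.
move=> h0 e; have [->|g0] := eqVneq g 0; first by rewrite lead_coef0 mulr0 mul0r.
have sg := same_log_deriv_size h0 g0 e.
apply/eqP; rewrite -subr_eq0; apply/negPn/negP => u0.
set u := _ - _ in u0.
have eu : u^`() * h = u * h^`().
  rewrite /u derivB !derivM !derivC !mul0r !add0r.
  transitivity ((lead_coef h)%:P * (g^`() * h) - (lead_coef g)%:P * (h^`() * h)); first by ring.
  by rewrite e; ring.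
have su := same_log_deriv_size h0 u0 eu.
have : (size u <= (size h).-1)%N.
  apply/leq_sizeP => j hj; rewrite /u coefB !coefCM.
  have [->|jh] := eqVneq j (size h).-1; first by rewrite -{1}sg -!lead_coefE mulrC subrr.
  have hj' : (size h <= j)%N.
    by move: hj; rewrite leq_eqVlt eq_sym (negbTE jh) /=; case: (size h).
  by rewrite !nth_default ?mulr0 ?subrr // sg.
have : (0 < size h)%N by rewrite size_poly_gt0.
by rewrite su; case: (size h) => // n _; rewrite ltnn.
Qed.

End Constants.

Section Bivariate.
Variable k : fieldType.
Hypothesis char0 : forall n, n.+1%:R != 0 :> k.
Implicit Types (p q g h P Q m : {poly {poly k}}) (a : nat * nat).

Lemma polychar0 n : n.+1%:R != 0 :> {poly k}.
Proof. by rewrite -polyC_natr polyC_eq0. Qed.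

(** The same argument in x shows that g/h is a quotient of polynomials in y,
    and then in y that it is constant. *)
Lemma bivariate_constant g h : h != 0 ->
  polyDx g * h = g * polyDx h -> polyDy g * h = g * polyDy h ->
  exists c : k, g = c%:P%:P * h.
Proof.
move=> h0 ex ey; have e := same_log_deriv polychar0 h0 ex.
set b := lead_coef h in e; set a := lead_coef g in e.
have b0 : b != 0 by rewrite lead_coef_eq0.
have bP0 : b%:P != 0 :> {poly {poly k}} by rewrite polyC_eq0.
have DyC (c : {poly k}) : polyDy c%:P = (c^`())%:P.
  by apply/polyP => i; rewrite coef_polyDy !coefC; case: ifP => //; rewrite deriv0.
have e2 : a^`() * b = a * b^`().
  have /(congr1 (@polyDy k)) := e; rewrite !polyDyM !DyC => e3.
  apply/polyC_inj; rewrite !polyCM; apply: (mulIf h0).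
  transitivity (b%:P * (a^`()%:P * h + a%:P * polyDy h) - a%:P * b%:P * polyDy h); first by ring.
  rewrite -e3; apply: (mulfI h0).
  transitivity (b%:P * (b^`()%:P * g * h + b%:P * (polyDy g * h) - a%:P * h * polyDy h)); first by ring.
  rewrite ey -e; transitivity (b^`()%:P * h * (b%:P * g)); first by ring.
  by rewrite e; ring.
have e4 := same_log_deriv char0 b0 e2.
have lb : lead_coef b != 0 by rewrite lead_coef_eq0.
exists (lead_coef a / lead_coef b).
have lbP : (lead_coef b)%:P%:P != 0 :> {poly {poly k}} by rewrite !polyC_eq0.
apply: (mulfI lbP); apply: (mulfI bP0).
transitivity (((lead_coef b)%:P * a)%:P * h).
  rewrite polyCM; transitivity ((lead_coef b)%:P%:P * (b%:P * g)); first by ring.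
  by rewrite e; ring.
rewrite e4.
have -> : (lead_coef a)%:P = (lead_coef b)%:P * (lead_coef a / lead_coef b)%:P :> {poly k}.
  by rewrite -polyCM mulrC divfK.
by rewrite !polyCM; ring.
Qed.

(** ** Monomials *)

Definition monomial a : {poly {poly k}} := 'X^(a.1) * ('X^(a.2))%:P.

Lemma coef_monomial a i j : (monomial a)`_i`_j = ((i, j) == a)%:R.
Proof.
case: a => a1 a2; rewrite /monomial coefMC coefXn xpair_eqE /=.
by case: eqP => _; rewrite ?mul1r ?mul0r ?coef0 // coefXn.
Qed.


Lemma coef_combination_const (s : seq (nat * nat)) (c : nat * nat -> k) a :
  uniq s -> a \in s ->
  (\sum_(b <- s) (c b)%:P%:P * monomial b)`_a.1`_a.2 = c a.
Proof.
move=> us sa; rewrite coef_sum coef_sum (bigD1_seq a) //= !coefCM coef_monomial.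
rewrite -surjective_pairing eqxx mulr1 big1 ?addr0 // => b ba.
by rewrite !coefCM coef_monomial -surjective_pairing eq_sym (negbTE ba) mulr0.
Qed.

Definition box_list d (s : seq (nat * nat)) : Prop :=
  uniq s /\ forall i j, ((i, j) \in s) = (i < d)%N && (j < d)%N.

(** Bounds on the degree in each variable, which behave better than the total
    degree under multiplication and division. *)
Definition fits d p : Prop := (size p <= d)%N /\ forall i, (size (nth 0%R p i) <= d)%N.

Lemma box_combination d s p : box_list d s -> fits d p ->
  p = \sum_(b <- s) (p`_b.1`_b.2)%:P%:P * monomial b.
Proof.
move=> [us ms] [pd pi]; apply/polyP => i; apply/polyP => j.
have [ij|ij] := boolP ((i, j) \in s).
  by rewrite (coef_combination_const (fun b => p`_b.1`_b.2) us ij).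
rewrite coef_sum coef_sum big_seq big1 => [|b bs].
  move: ij; rewrite ms negb_and -!leqNgt => /orP[h|h].
    by rewrite (nth_default _ (leq_trans pd h)) coef0.
  by rewrite nth_default // (leq_trans (pi i)).
rewrite !coefCM coef_monomial; case: eqP => [e|_]; last by rewrite mulr0.
by move: ij; rewrite e bs.
Qed.

Lemma seq_as_map (T : eqType) (U : Type) (x0 : U) (s : seq T) (cs : seq U) :
  uniq s -> size cs = size s -> cs = map (fun t => nth x0 cs (index t s)) s.
Proof.
move=> us sc; apply: (@eq_from_nth _ x0); first by rewrite size_map.
move=> i ic; case: s us sc => [|a s] us sc; first by rewrite sc in ic.
by rewrite (nth_map a) -?sc // index_uniq // -sc.
Qed.

Lemma zip_map2 (T U V : Type) (f : T -> U) (g : T -> V) s :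
  zip (map f s) (map g s) = map (fun t => (f t, g t)) s.
Proof. by elim: s => //= a s ->. Qed.

Lemma not_independent (R : idomainType) (I : Type) (T : eqType) (s : seq T) (vec : T -> I -> R) :
  uniq s -> ~ independent (map vec s) ->
  exists c : T -> R, (exists2 t, t \in s & c t != 0) /\
    forall i, \sum_(t <- s) c t * vec t i = 0.
Proof.
move=> us ni; apply: contrapT => H; apply: ni => cs; rewrite size_map => sc e.
rewrite (seq_as_map 0 us sc) in e *.
set c := fun t : T => nth 0 cs (index t s) in e *.
rewrite all_map; apply/allP => t st /=; apply/negPn/negP => ct; apply: H.
exists c; split; first by exists t.
by move=> i; have := e i; rewrite zip_map2 big_map.
Qed.

(** The derivative of the relation of order i, minus the relation of order
    i + 1. *)
Lemma relation_flow P Q (s : seq (nat * nat)) (c : nat * nat -> {poly {poly k}}) :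
  (forall i, \sum_(a <- s) c a * iter i (flow P Q) (monomial a) = 0) ->
  forall i, \sum_(a <- s) flow P Q (c a) * iter i (flow P Q) (monomial a) = 0.
Proof.
move=> H i.
have flow_sum (F : nat * nat -> {poly {poly k}}) :
    flow P Q (\sum_(a <- s) F a) = \sum_(a <- s) flow P Q (F a).
  elim: s {H} => [|a s IH]; last by rewrite !big_cons flowD IH.
  by rewrite !big_nil /flow /polyDx /polyDy deriv0 map_poly0; ring.
have -> : \sum_(a <- s) flow P Q (c a) * iter i (flow P Q) (monomial a) =
    \sum_(a <- s) flow P Q (c a * iter i (flow P Q) (monomial a))
    - \sum_(a <- s) c a * iter i.+1 (flow P Q) (monomial a).
  by rewrite -sumrB; apply: eq_bigr => a _; rewrite flowM /=; ring.
rewrite H subr0 -flow_sum H.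
by rewrite /flow /polyDx /polyDy deriv0 map_poly0; ring.
Qed.

(** The flow maps a relation between the iterated derivatives of the monomials
    to another one. For a relation with the fewest terms this forces the
    quotients of the coefficients to be constant along the flow. They are not
    all constants of k, as the monomials are linearly independent over k; so
    one of them is a first integral. *)
Theorem first_integral_or_independent P Q (s : seq (nat * nat)) : Q != 0 -> uniq s ->
  (exists g h, [/\ h != 0, flow P Q g * h - g * flow P Q h = 0
                 & polyDy g * h - g * polyDy h != 0]) \/
  exists Xs, triangular (flow_pairing P Q) Xs (map monomial s).
Proof.
move=> Q0 us.
pose vec a i := iter i (flow P Q) (monomial a).
have [ind|nind] := pselect (independent (map (fun m i => iter i (flow P Q) m) (map monomial s))).
  by right; exact: independent_flow.
left; rewrite -map_comp in nind.
pose relation c := (exists2 a, a \in s & c a != 0) /\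
    forall i, \sum_(t <- s) c t * vec t i = 0.
have [c0 rc0] : exists c, relation c := not_independent us nind.
pose A n := `[< exists c, relation c /\ count (fun a => c a != 0) s = n >].
have exA : exists n, A n by exists (count (fun a => c0 a != 0) s); apply/asboolP; exists c0.
have [n /asboolP[c [[[b bs cb] rc] cn]] nmin] := ex_minnP exA.
have prop a : a \in s -> flow P Q (c a) * c b = c a * flow P Q (c b).
  (* the term b is eliminated from the derived relation *)
  pose c' a := c b * flow P Q (c a) + - flow P Q (c b) * c a.
  move=> sa; apply/eqP; rewrite -subr_eq0; apply/negPn/negP => h.
  have h' : c' a != 0.
    by have <- : flow P Q (c a) * c b - c a * flow P Q (c b) = c' a by rewrite /c'; ring.
  have rc' : relation c'.
    split; first by exists a.
    move=> i; rewrite /c'.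
    transitivity (c b * \sum_(a <- s) flow P Q (c a) * vec a i
       + - flow P Q (c b) * \sum_(a <- s) c a * vec a i).
      by rewrite !mulr_sumr -big_split; apply: eq_bigr => e _ /=; ring.
    by rewrite rc (relation_flow rc) !mulr0 addr0.
  have : A (count (fun a => c' a != 0) s) by apply/asboolP; exists c'.
  move=> /nmin; rewrite leqNgt => /negP; apply; rewrite -cn.
  have sub e : c' e != 0 -> c e != 0.
    apply: contraNneq => ce; rewrite /c' ce.
    have -> : flow P Q 0 = 0 by rewrite /flow /polyDx /polyDy deriv0 map_poly0; ring.
    by rewrite !mulr0 addr0.
  have c'b : c' b = 0 by rewrite /c'; ring.
  clear - bs cb sub c'b; elim: s bs => // e s IH; rewrite inE => /orP[/eqP eb|es] /=.
    rewrite -{1}eb c'b eqxx add0n -{1}eb cb add1n ltnS.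
    by apply: sub_count => x; exact: sub.
  by rewrite -addnS; apply: leq_add; [case: (c' e =P 0) => // /eqP/sub -> | exact: IH].
have [[a sa h]|H] := pselect (exists2 a, a \in s & polyDy (c a) * c b - c a * polyDy (c b) != 0).
  by exists (c a), (c b); split=> //; apply/eqP; rewrite subr_eq0; apply/eqP; exact: prop.
have ratio a : a \in s -> exists x : k, c a = x%:P%:P * c b.
  move=> sa; have ey : polyDy (c a) * c b = c a * polyDy (c b).
    by apply/eqP; rewrite -subr_eq0; apply/negPn/negP => h; apply: H; exists a.
  apply: bivariate_constant => //.
  have Q3 : Q ^+ 3 != 0 by rewrite expf_neq0.
  apply: (mulfI Q3); have := prop a sa; rewrite /flow => e.
  transitivity ((Q ^+ 3 * polyDx (c a) + P * Q ^+ 2 * polyDy (c a)) * c b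
     - P * Q ^+ 2 * (polyDy (c a) * c b)); first by ring.
  by rewrite e ey; ring.
have [x xP] : {x : nat * nat -> k | forall a, a \in s -> c a = (x a)%:P%:P * c b}.
  suff /choice[x xP] : forall a, exists x : k, a \in s -> c a = x%:P%:P * c b by exists x.
  by move=> a; have [/ratio[x xE]|_] := boolP (a \in s); [exists x | exists 0].
have : \sum_(a <- s) (x a)%:P%:P * monomial a = 0.
  apply: (mulfI cb); rewrite mulr0 -[RHS](rc 0%N) mulr_sumr !big_seq.
  by apply: eq_bigr => a sa; rewrite /vec /= (xP a sa); ring.
move=> /(congr1 (fun p : {poly {poly k}} => p`_b.1`_b.2)).
rewrite (coef_combination_const _ us bs) !coef0 => xb.
by move: cb; rewrite (xP b bs) xb !polyC0 mul0r eqxx.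
Qed.

End Bivariate.

(** * Solutions of bounded degree *)

Section Flow.
Variable L : fieldType.
Implicit Types (p q : {poly {poly L}}).
Variables (P Q : {poly {poly L}}).

Lemma flowC (c : L) : flow P Q c%:P%:P = 0.
Proof.
have -> : polyDy (c%:P%:P : {poly {poly L}}) = 0 :> {poly {poly L}} -> flow P Q c%:P%:P = 0.
  by move=> e; rewrite /flow e /polyDx derivC; ring.
by [].
apply/polyP => i; rewrite coef_polyDy coefC coef0; case: ifP => _; rewrite ?derivC ?deriv0 //.
Qed.

Lemma flow_pairing_lin (X : seq {poly {poly L}}) (c : L) p q :
  flow_pairing P Q X (c%:P%:P * p + q) = c%:P%:P * flow_pairing P Q X p + flow_pairing P Q X q.
Proof.
elim: X p q => [|x X IH] p q /=; first by rewrite mulr0 addr0.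
by rewrite flowD flowM flowC mul0r add0r IH; ring.
Qed.

Lemma flow_pairing0 (X : seq {poly {poly L}}) : flow_pairing P Q X 0 = 0.
Proof.
elim: X => //= x X; have -> : flow P Q 0 = 0 by have := flowC 0; rewrite !polyC0.
by move=> ->; rewrite mulr0 addr0.
Qed.

Lemma flow_pairing_divides (X : seq {poly {poly L}}) q p :
  divides q (flow P Q q) -> divides q p -> divides q (flow_pairing P Q X p).
Proof.
move=> qf; elim: X p => [|x X IH] p /= qp; first by exists 0; rewrite mulr0.
have [e pe] := qp; have [f fe] := qf.
have [|a ae] := IH (flow P Q p); first by exists (f * e + flow P Q e); rewrite pe flowM fe; ring.
by exists (x * e + a); rewrite ae pe; ring.
Qed.

Lemma hom_eq_lin (E : {poly {poly L}}) (c : L) p q :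
  hom_eq P Q (c%:P%:P * p + q) E = c%:P%:P * hom_eq P Q p E + hom_eq P Q q E.
Proof. by rewrite /hom_eq flowD flowM flowC; ring. Qed.

End Flow.

Section Extension.
Variables (k : fieldType) (L : closedFieldType) (iota : {rmorphism k -> L}).
Notation bc := (bc iota).
Implicit Types (P Q : {poly {poly k}}) (p q : {poly {poly L}}).

Lemma coef_bc (v : {poly {poly k}}) i j : (bc v)`_i`_j = iota v`_i`_j.
Proof. by rewrite !coef_map. Qed.

Lemma dot_bc (u v : {poly {poly k}}) : dot (bc u) (bc v) = iota (dot u v).
Proof.
have [n [h1 h2]] := size_bound u.
rewrite (@dot_wide _ _ _ n) //; last first.
- move=> i; have -> : (bc u)`_i = map_poly iota u`_i by rewrite coef_map.
  by rewrite size_map_poly.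
- by apply: leq_trans (size_poly _ _) h1.
rewrite (@dot_wide _ _ _ n) // rmorph_sum; apply: eq_bigr => i _.
by rewrite rmorph_sum; apply: eq_bigr => j _; rewrite rmorphM !coef_bc.
Qed.

(** A triangular certificate over k proves independence over an extension L. *)
Lemma triangular_free Ls (vs : seq {poly {poly k}}) (cs : seq L) :
  triangular (@dot k) Ls vs -> size cs = size vs ->
  \sum_(cv <- zip cs vs) cv.1%:P%:P * bc cv.2 = 0 -> all (pred1 0) cs.
Proof.
elim: vs Ls cs => [|v vs IH] [|U Ls] [|c cs] //= /and3P[Uv /allP Uvs tri] [sc].
rewrite big_cons /= => e.
suff c0 : c = 0.
  rewrite c0 eqxx; apply: (IH Ls) => //.
  by move: e; rewrite c0 !polyC0 mul0r add0r.
have := congr1 (dot (bc U)) e; rewrite dotD dotZ dot_sum dot_bc.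
have -> : dot (bc U) 0 = 0 by have := dotZ (bc U) 0 0; rewrite !polyC0 !mul0r.
rewrite [X in _ + X]big1_seq ?addr0 => [/eqP|[c' v'] /= h].
  by rewrite mulf_eq0 fmorph_eq0 (negbTE Uv) orbF => /eqP.
rewrite dotZ dot_bc.
have /Uvs/eqP -> : v' \in vs.
  by have := map_f snd h; rewrite -/(unzip2 _) unzip2_zip ?sc.
by rewrite rmorph0 mulr0.
Qed.

Lemma flow_pairing_bc P Q X m :
  flow_pairing (bc P) (bc Q) (map bc X) (bc m) = bc (flow_pairing P Q X m).
Proof.
elim: X m => [|x X IH] m /=; first by rewrite rmorph0.
by rewrite -bc_flow IH rmorphD rmorphM.
Qed.


(** The extactic argument: an invariant polynomial spanned by the given ones
    divides the pivot of the first polynomial that really occurs in it. *)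
Lemma pivots_divides P Q Xs (ms : seq {poly {poly k}}) (cs : seq L) q :
  triangular (flow_pairing P Q) Xs ms -> size cs = size ms ->
  q = \sum_(cm <- zip cs ms) cm.1%:P%:P * bc cm.2 -> q != 0 ->
  divides q (flow (bc P) (bc Q) q) -> divides q (bc (pivots (flow_pairing P Q) Xs ms)).
Proof.
move=> tri sc qe q0 qf.
suff H : forall Xs ms cs, triangular (flow_pairing P Q) Xs ms -> size cs = size ms ->
    q = \sum_(cm <- zip cs ms) cm.1%:P%:P * bc cm.2 ->
    divides q (bc (pivots (flow_pairing P Q) Xs ms)) by exact: H tri sc qe.
move=> {Xs ms cs tri sc qe}.
elim=> [|X Xs IH] [|m ms] [|c cs] //=; try by rewrite big_nil => _ _ e; rewrite e eqxx in q0.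
move=> /and3P[Xm /allP Xms tri] [sc]; rewrite big_cons /= => qe.
have [c0|c0] := eqVneq c 0.
  have [|a ae] := IH ms cs tri sc; first by rewrite qe c0 !polyC0 mul0r add0r.
  by exists (bc (flow_pairing P Q X m) * a); rewrite rmorphM ae; ring.
(* the operator X isolates m in q, and maps q to a multiple of q *)
have [a ae] : divides q (flow_pairing (bc P) (bc Q) (map bc X) q).
  by apply: flow_pairing_divides => //; exists 1; rewrite mulr1.
have rest : flow_pairing (bc P) (bc Q) (map bc X) (\sum_(cm <- zip cs ms) cm.1%:P%:P * bc cm.2) = 0.
  have : {subset zip cs ms <= [pred cm | cm.2 \in ms]}.
    move=> [c' m'] h; have := map_f snd h; rewrite -/(unzip2 _) unzip2_zip ?sc //.
  elim: (zip cs ms) => [|[c' m'] s IHs] sub; first by rewrite big_nil flow_pairing0.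
  rewrite big_cons flow_pairing_lin IHs ?addr0 => [|x xs]; last by apply: sub; rewrite inE xs orbT.
  by rewrite flow_pairing_bc (eqP (Xms _ (sub _ (mem_head _ _)))) rmorph0 mulr0.
exists (a * (c^-1)%:P%:P * bc (pivots (flow_pairing P Q) Xs ms)).
rewrite rmorphM -[X in X * _]mul1r -(rmorph1 (polyC \o polyC)) /= -(mulVf c0) !polyCM.
transitivity ((c^-1)%:P%:P * (c%:P%:P * bc (flow_pairing P Q X m)) * bc (pivots (flow_pairing P Q) Xs ms)); first by ring.
have -> : c%:P%:P * bc (flow_pairing P Q X m) = q * a.
  by rewrite -ae {1}qe flow_pairing_lin rest addr0 flow_pairing_bc.
by ring.
Qed.

(** ** Degree bounds *)

Lemma fits_sizeY (p : {poly {poly L}}) d : fits d p <-> (size p <= d)%N /\ (sizeY p <= d)%N.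
Proof.
rewrite /fits; split=> -[h1 h2]; split=> //.
  by apply/bigmax_leqP => i _; exact: h2.
move=> i; apply: leq_trans h2; exact: max_size_coefXY.
Qed.

(** Degrees in each variable add up in a product. *)
Lemma fits_divisor q s E b : E != 0 -> E = q * s -> fits b E -> fits b s.
Proof.
move=> E0 e; rewrite !fits_sizeY => -[h1 h2].
have q0 : q != 0 by apply: contra_neq E0 => q0; rewrite e q0 mul0r.
have s0 : s != 0 by apply: contra_neq E0 => s0; rewrite e s0 mulr0.
have le (R : idomainType) (u v : {poly R}) : u != 0 -> v != 0 -> (size v <= size (u * v)%R)%N.
  by move=> u0 v0; rewrite size_mul // -subn1 -addnBAC ?size_poly_gt0 // leq_addl.
split; first by apply: leq_trans h1; rewrite e; exact: le.
apply: leq_trans h2; rewrite !sizeYE e rmorphM; apply: le.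
  by rewrite swapXY_eq0.
by rewrite swapXY_eq0.
Qed.

Lemma fits_mul p s N b : (0 < b)%N -> tdeg_le N p -> fits b s -> fits (N + b) (p * s).
Proof.
move=> b0 pN [s1 s2].
have p1 : (size p <= N.+1)%N.
  apply/leq_sizeP => i Ni; apply/polyP => j; rewrite coef0.
  by apply: pN; apply: leq_trans Ni (leq_addr _ _).
have p2 i : (size (nth 0%R p i) <= N.+1)%N.
  by apply/leq_sizeP => j Nj; apply: pN; apply: leq_trans Nj (leq_addl _ _).
have le (R : idomainType) (u v : {poly R}) : (size u <= N.+1)%N -> (size v <= b)%N -> (size (u * v)%R <= N + b)%N.
  move=> h1 h2; apply: leq_trans (size_polyMleq _ _) _.
  by apply: (@leq_trans (N.+1 + b).-1); [rewrite -!subn1 leq_sub2r // leq_add | rewrite addSn].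
split; first exact: le.
move=> i; rewrite coefM; apply: leq_trans (size_sum _ _ _) _.
by apply/bigmax_leqP => j _; exact: le.
Qed.

Lemma fits_tdeg p N : tdeg_le N p -> fits N.+1 p.
Proof.
move=> pN; split.
  apply/leq_sizeP => i Ni; apply/polyP => j; rewrite coef0.
  by apply: pN; apply: leq_trans Ni (leq_addr _ _).
by move=> i; apply/leq_sizeP => j Nj; apply: pN; apply: leq_trans Nj (leq_addl _ _).
Qed.

Lemma fits_bc (v : {poly {poly k}}) d : fits d v -> fits d (bc v).
Proof.
move=> [h1 h2]; split; first by apply: leq_trans (size_poly _ _) h1.
move=> i; have -> : (bc v)`_i = map_poly iota v`_i by rewrite coef_map.
by rewrite size_map_poly.
Qed.

Lemma combination_zip d (s : seq (nat * nat)) p : box_list d s -> fits d p ->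
  exists cs, size cs = size (map (@monomial k) s) /\
    p = \sum_(cm <- zip cs (map (@monomial k) s)) cm.1%:P%:P * bc cm.2.
Proof.
move=> bs pd; exists (map (fun b => p`_b.1`_b.2) s); rewrite !size_map; split=> //.
rewrite zip_map2 big_map {1}(box_combination bs pd); apply: eq_bigr => b _ /=.
by rewrite /monomial rmorphM /= map_polyXn map_polyC /= map_polyXn.
Qed.

Lemma hom_eq_scale (P Q p q s : {poly {poly L}}) :
  factor_eq P Q (p * s) (q * s) = s ^+ 2 * factor_eq P Q p q.
Proof. by rewrite /factor_eq /hom_eq !flowM; ring. Qed.

(** All terms of factor_eq but p flow(q) are multiples of q. *)
Lemma factor_eq_invariant (P Q p q : {poly {poly L}}) : q != 0 -> lowest_terms p q ->
  factor_eq P Q p q = 0 -> divides q (flow P Q q).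
Proof.
move=> q0 lt e; apply: (gauss q0 lt).
exists (flow P Q p + Q * dyF P Q * p + dyyF P Q * q).
apply/eqP; rewrite -subr_eq0 -oppr_eq0 -[X in _ == X]e /factor_eq /hom_eq; apply/eqP; ring.
Qed.

(** A solution of bounded degree has the universal denominator given by the
    pivots, and a numerator of bounded degree. *)
Theorem universal_denominator P Q N (s : seq (nat * nat)) Xs p q b d :
  box_list N.+1 s -> triangular (flow_pairing P Q) Xs (map (@monomial k) s) ->
  q != 0 -> lowest_terms p q -> tdeg_le N p -> tdeg_le N q ->
  factor_eq (bc P) (bc Q) p q = 0 ->
  let E := pivots (flow_pairing P Q) Xs (map (@monomial k) s) in
  fits b E -> (N + b <= d)%N ->
  exists r, [/\ fits d r, factor_eq (bc P) (bc Q) r (bc E) = 0 & p * bc E = r * q].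
Proof.
move=> bs tri q0 lt pN qN e E Eb bd.
have [cs [sc qe]] := combination_zip bs (fits_tdeg qN).
have [t te] := pivots_divides tri sc qe q0 (factor_eq_invariant q0 lt e).
have E0 : bc E != 0 by rewrite bc_eq0; exact: pivots_neq0 tri.
exists (p * t); split.
- have b0 : (0 < b)%N.
    case: Eb => h _; apply: leq_trans h; rewrite size_poly_gt0; exact: pivots_neq0 tri.
  have [f1 f2] := fits_mul b0 pN (fits_divisor E0 te (fits_bc Eb)).
  by split=> [|i]; [exact: leq_trans f1 bd | exact: leq_trans (f2 i) bd].
- by rewrite te hom_eq_scale e mulr0.
by rewrite te; ring.
Qed.

Lemma hom_eq_zip (P Q E : {poly {poly k}}) (ms : seq {poly {poly k}}) (cs : seq L) : size cs = size ms ->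
  hom_eq (bc P) (bc Q) (\sum_(cm <- zip cs ms) cm.1%:P%:P * bc cm.2) (bc E) =
  \sum_(cv <- zip cs (map (hom_eq P Q ^~ E) ms)) cv.1%:P%:P * bc cv.2.
Proof.
elim: ms cs => [|m ms IH] [|c cs] //= => [_|[sc]].
  have f0 : flow (bc P) (bc Q) 0 = 0 by have := @flowC _ (bc P) (bc Q) 0; rewrite !polyC0.
  by rewrite !big_nil /hom_eq f0; ring.
by rewrite !big_cons hom_eq_lin IH // bc_hom_eq.
Qed.

End Extension.

(** * Certificates *)


Definition box d : seq (nat * nat) := [seq (i, j) | i <- iota 0 d, j <- iota 0 d].

Lemma boxP d : box_list d (box d).
Proof.
split; first by apply: allpairs_uniq; rewrite ?iota_uniq // => -[i j] [i' j'].
move=> i j; apply/allpairsP/andP => [[[a b] /= [ha hb [-> ->]]]|[id jd]].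
  by move: ha hb; rewrite !mem_iota.
by exists (i, j); rewrite !mem_iota.
Qed.

Section Certificates.
Variables (k : fieldType) (L : closedFieldType) (iota : {rmorphism k -> L}).
Hypothesis char0 : forall n, n.+1%:R != 0 :> k.
Notation bc := (bc iota).
Implicit Types (P Q g h r s E : {poly {poly k}}) (Xs : seq (seq {poly {poly k}})) (Ls : seq {poly {poly k}}).

Definition monomials d : seq {poly {poly k}} := map (@monomial k) (box d).

Definition cert_integral P Q g h : bool :=
  [&& h != 0, flow P Q g * h - g * flow P Q h == 0 & polyDy g * h - g * polyDy h != 0].

Definition cert_rational P Q r s : bool := [&& r != 0, s != 0 & hom_eq P Q r s == 0].

Definition system P Q E d := map (hom_eq P Q ^~ E) (monomials d).

Definition cert_extactic P Q N Xs : bool := triangular (flow_pairing P Q) Xs (monomials N.+1).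

Definition denominator P Q N Xs := pivots (flow_pairing P Q) Xs (monomials N.+1).

Definition cert_none P Q E d Ls : bool :=
  triangular (@dot k) Ls (dyyF P Q * E ^+ 2 :: system P Q E d).

Definition cert_unique P Q E d Ls : bool := triangular (@dot k) Ls (system P Q E d).

Definition bounded_solution P Q N (p q : {poly {poly L}}) : Prop :=
  [/\ q != 0, lowest_terms p q, tdeg_le N p, tdeg_le N q & factor_eq (bc P) (bc Q) p q = 0].

(** A solution has a numerator which is a combination of the monomials with
    coefficients in L, and factor_eq becomes a linear relation in which the
    inhomogeneous term has coefficient 1. *)
Lemma cert_none_correct P Q N Xs d b Ls p q : cert_extactic P Q N Xs ->
  let E := denominator P Q N Xs in fits b E -> (N + b <= d)%N ->
  cert_none P Q E d Ls -> ~ bounded_solution P Q N p q.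
Proof.
move=> cX E Eb bd cN [q0 lt pN qN e].
have [r [rd re _]] := universal_denominator (boxP N.+1) cX q0 lt pN qN e Eb bd.
have [cs [sc rE]] := combination_zip iota (boxP d) rd.
have := @triangular_free _ _ iota Ls (dyyF P Q * E ^+ 2 :: system P Q E d) (1 :: cs) cN.
rewrite /= sc !size_map => /(_ erefl).
suff -> : \sum_(cv <- (1, dyyF P Q * E ^+ 2) :: zip cs (system P Q E d)) cv.1%:P%:P * bc cv.2 = 0.
  by move=> /(_ erefl); rewrite oner_eq0.
rewrite big_cons /= !polyC1 mul1r -hom_eq_zip // -rE rmorphM rmorphXn bc_dyyF.
by rewrite -[RHS]re /factor_eq addrC.
Qed.

(** The difference of two numerators is in the kernel of the homogeneous
    system. *)
Lemma cert_unique_correct P Q N Xs d b Ls r p q : cert_extactic P Q N Xs ->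
  let E := denominator P Q N Xs in fits b E -> (N + b <= d)%N -> fits d r ->
  cert_unique P Q E d Ls -> factor_eq P Q r E = 0 -> bounded_solution P Q N p q ->
  p * bc E = bc r * q.
Proof.
move=> cX E Eb bd rd cU re [q0 lt pN qN e].
have [r' [r'd r'e pE]] := universal_denominator (boxP N.+1) cX q0 lt pN qN e Eb bd.
have rr : fits d (r' + (-1)%:P%:P * bc r).
  have [h1 h2] := r'd; have [h3 h4] := fits_bc iota rd.
  split=> [|i].
    apply: leq_trans (size_polyD _ _) _; rewrite geq_max h1 mul_polyC.
    exact: leq_trans (size_scale_leq _ _) h3.
  rewrite coefD coefCM; apply: leq_trans (size_polyD _ _) _; rewrite geq_max h2 mul_polyC.
  exact: leq_trans (size_scale_leq _ _) (h4 i).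
have [cs [sc rE]] := combination_zip iota (boxP d) rr.
have z : hom_eq (bc P) (bc Q) (r' + (-1)%:P%:P * bc r) (bc E) = 0.
  have := congr1 bc re; rewrite bc_factor_eq rmorph0 /factor_eq => re'.
  move: r'e; rewrite /factor_eq addrC -[RHS]re' [RHS]addrC => /addrI e'.
  by rewrite addrC hom_eq_lin e' !polyCN !polyC1 mulN1r addNr.
have := @triangular_free _ _ iota Ls (system P Q E d) cs cU.
rewrite sc !size_map => /(_ erefl); rewrite -hom_eq_zip // -rE z => /(_ erefl) /allP cs0.
have : r' + (-1)%:P%:P * bc r = 0.
  rewrite rE big1_seq // => -[c m] /= h.
  have : c \in unzip1 (zip cs (monomials d)) by apply: (map_f fst h).
  rewrite unzip1_zip ?sc // => /cs0 /eqP ->; by rewrite !polyC0 mul0r.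
rewrite !polyCN !polyC1 mulN1r => /subr0_eq <-; exact: pE.
Qed.

Lemma system_relation P Q E d (c : nat * nat -> k) (c0 : k) :
  (forall ij : nat * nat, c0 * (dyyF P Q * E ^+ 2)`_ij.1`_ij.2 +
     \sum_(a <- box d) c a * (hom_eq P Q (monomial k a) E)`_ij.1`_ij.2 = 0) ->
  hom_eq P Q (\sum_(a <- box d) (c a)%:P%:P * monomial k a) E + c0%:P%:P * (dyyF P Q * E ^+ 2) = 0.
Proof.
move=> H.
have -> : hom_eq P Q (\sum_(a <- box d) (c a)%:P%:P * monomial k a) E =
   \sum_(a <- box d) (c a)%:P%:P * hom_eq P Q (monomial k a) E.
  elim: (box d) => [|a s IH]; last by rewrite !big_cons hom_eq_lin IH.
  have f0 : flow P Q 0 = 0 by have := @flowC _ P Q 0; rewrite !polyC0.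
  by rewrite !big_nil /hom_eq f0; ring.
apply/polyP => i; apply/polyP => j; have := H (i, j); rewrite /= => e.
rewrite !coefD !coef_sum !coefCM addrC !coef0 -[RHS]e; congr (_ + _).
by apply: eq_bigr => a _; rewrite !coefCM.
Qed.

Lemma combination_neq0 d (c : nat * nat -> k) a : a \in box d -> c a != 0 ->
  \sum_(a <- box d) (c a)%:P%:P * monomial k a != 0.
Proof.
move=> ad; apply: contra_neq => /(congr1 (fun p : {poly {poly k}} => p`_a.1`_a.2)).
by have [ub _] := boxP d; rewrite (coef_combination_const _ ub ad) !coef0.
Qed.

(** If the homogeneous system with denominator E is dependent, a relation is the
    numerator of a rational integrating factor. If it is independent, the affine system is
    either independent too, or a relation involves the inhomogeneous term and
    can be solved for it. *)
Lemma certificates_complete P Q N : Q != 0 ->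
  [\/ exists g h, cert_integral P Q g h, exists r s, cert_rational P Q r s
    | exists Xs, let E := denominator P Q N Xs in
      [/\ cert_extactic P Q N Xs, forall d, exists Ls, cert_unique P Q E d Ls
        & forall d, (exists Ls, cert_none P Q E d Ls) \/ exists r, factor_eq P Q r E = 0]].
Proof.
move=> Q0.
have [[g [h [h0 e1 e2]]]|[Xs cX]] :=
    first_integral_or_independent char0 P Q0 (boxP N.+1).1.
  by apply: Or31; exists g, h; rewrite /cert_integral h0 e1 e2 eqxx.
have [[r [s rs]]|nrat] := pselect (exists r s, cert_rational P Q r s).
  by apply: Or32; exists r, s.
apply: Or33; exists Xs; set E := denominator P Q N Xs.
have E0 : E != 0 by exact: pivots_neq0 cX.
pose cf (v : {poly {poly k}}) (ij : nat * nat) := v`_ij.1`_ij.2.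
have noker d c a : a \in box d -> c a != 0 ->
    hom_eq P Q (\sum_(a <- box d) (c a)%:P%:P * monomial k a) E = 0 -> False.
  move=> ad ca e; apply: nrat; exists (\sum_(a <- box d) (c a)%:P%:P * monomial k a), E.
  by rewrite /cert_rational (combination_neq0 ad ca) E0 e eqxx.
split; first exact: cX.
  move=> d; apply: independent_dot; apply: contrapT => nind.
  rewrite -!map_comp in nind.
  have [c [[a ad ca] e]] := not_independent (boxP d).1 nind.
  apply: (noker d c a ad ca).
  have := @system_relation P Q E d c 0; rewrite !polyC0 mul0r addr0; apply.
  by move=> ij; rewrite mul0r add0r; exact: e.
move=> d.
have [ind|nind] := pselect (independent (map cf (dyyF P Q * E ^+ 2 :: system P Q E d))).
  by left; exact: independent_dot.
right.
pose vec (o : option (nat * nat)) : nat * nat -> k :=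
  if o is Some a then cf (hom_eq P Q (monomial k a) E) else cf (dyyF P Q * E ^+ 2).
have ms : map cf (dyyF P Q * E ^+ 2 :: system P Q E d) = map vec (None :: map Some (box d)).
  by rewrite /= -!map_comp.
rewrite ms in nind.
have us : uniq (None :: map Some (box d)).
  rewrite /= map_inj_uniq ?(boxP d).1 ?andbT => [|x y []//].
  by apply/mapP => -[].
have [c [[w od co] e]] := not_independent us nind.
have e' := @system_relation P Q E d (fun a => c (Some a)) (c None).
have {}e' : hom_eq P Q (\sum_(a <- box d) (c (Some a))%:P%:P * monomial k a) E +
    (c None)%:P%:P * (dyyF P Q * E ^+ 2) = 0.
  by apply: e' => ij; have := e ij; rewrite big_cons big_map.
have [cN|cN] := eqVneq (c None) 0.
  case: w od co => [a|]; last by rewrite cN eqxx.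
  rewrite inE /= mem_map => [ad ca|x y []//].
  case: (noker d (fun a => c (Some a)) a ad ca).
  by move: e'; rewrite cN !polyC0 mul0r addr0.
exists ((c None)^-1%:P%:P * \sum_(a <- box d) (c (Some a))%:P%:P * monomial k a).
have cP : (c None)%:P%:P != 0 :> {poly {poly k}} by rewrite !polyC_eq0.
apply: (mulfI cP); rewrite mulr0 -[RHS]e'.
have := hom_eq_lin P Q E (c None)^-1 (\sum_(a <- box d) (c (Some a))%:P%:P * monomial k a) 0.
have -> : hom_eq P Q 0 E = 0.
  have f0 : flow P Q 0 = 0 by have := @flowC _ P Q 0; rewrite !polyC0.
  by rewrite /hom_eq f0; ring.
rewrite !addr0 /factor_eq => ->.
have cc : (c None)%:P%:P * (c None)^-1%:P%:P = 1 :> {poly {poly k}}.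
  by rewrite -!polyCM mulfV // !polyC1.
by rewrite mulrDr mulrA cc mul1r.
Qed.

End Certificates.

(** * Total functions computed by programs *)

Definition tfst t := if t is Node a _ then a else Leaf.
Definition tsnd t := if t is Node _ b then b else Leaf.
Definition holds t : bool := if t is Node _ _ then true else false.
Definition tif (c a b : tree) := if holds c then a else b.

Definition cf (f : tree -> tree) : Prop := exists p, forall t, Defs.eval p t (f t).

(** Functions of several arguments take them as a nested pair; these classes
    let the tactic below compose them. *)
Class Cf1 (f : tree -> tree) : Prop := cf1P : cf f.
Class Cf2 (f : tree -> tree -> tree) : Prop := cf2P : cf (fun t => f (tfst t) (tsnd t)).
Class Cf3 (f : tree -> tree -> tree -> tree) : Prop :=
  cf3P : cf (fun t => f (tfst t) (tfst (tsnd t)) (tsnd (tsnd t))).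

Lemma cf_id : cf (fun t => t).
Proof. by exists Id => t; constructor. Qed.

Lemma cf_const c : cf (fun=> c).
Proof.
elim: c => [|a [p ap] b [q bq]]; first by exists Defs.Nil => t; constructor.
by exists (Pair p q) => t; constructor.
Qed.

Lemma comp1 f a : Cf1 f -> cf a -> cf (fun t => f (a t)).
Proof. by move=> [p fp] [q aq]; exists (Comp p q) => t; econstructor. Qed.

Lemma cf_node a b : cf a -> cf b -> cf (fun t => Node (a t) (b t)).
Proof. by move=> [p ap] [q bq]; exists (Pair p q) => t; constructor. Qed.

Lemma comp2 f a b : Cf2 f -> cf a -> cf b -> cf (fun t => f (a t) (b t)).
Proof. by move=> cff ca cb; exact: (comp1 cff (cf_node ca cb)). Qed.

Lemma comp3 f a b c : Cf3 f -> cf a -> cf b -> cf c -> cf (fun t => f (a t) (b t) (c t)).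
Proof. by move=> cff ca cb cc; exact: (comp1 cff (cf_node ca (cf_node cb cc))). Qed.

#[export] Instance Cf1_tfst : Cf1 tfst.
Proof. by exists Fst => -[|a b]; constructor. Qed.

#[export] Instance Cf1_tsnd : Cf1 tsnd.
Proof. by exists Snd => -[|a b]; constructor. Qed.

Lemma cf_tif c a b : cf c -> cf a -> cf b -> cf (fun t => tif (c t) (a t) (b t)).
Proof.
move=> [p cp] [q aq] [r br]; exists (If p q r) => t; rewrite /tif.
have := cp t; case: (c t) => [|u v] h /=; first exact: eval_If_false.
exact: eval_If_true h _.
Qed.

(** Lists are right spines; x is the current entry, a the accumulator. *)
Fixpoint tfoldl (f : tree -> tree -> tree) a l :=
  if l is Node x l' then tfoldl f (f x a) l' else a.

Fixpoint tfoldr (f : tree -> tree -> tree) a l :=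
  if l is Node x l' then f x (tfoldr f a l') else a.

(** The only loop of the model that is needed besides the final search. *)
Lemma cf_tfoldl (f : tree -> tree -> tree -> tree) a l : Cf3 f -> cf a -> cf l ->
  cf (fun t => tfoldl (f t) (a t) (l t)).
Proof.
move=> [p fp] [q aq] [r lr].
(* loop state: environment, remaining list, accumulator *)
pose step := Pair Fst (Pair (Comp Snd (Comp Fst Snd))
  (Comp p (Pair Fst (Pair (Comp Fst (Comp Fst Snd)) (Comp Snd Snd))))).
exists (Comp (Comp Snd Snd) (Comp (While (Comp Fst Snd) step) (Pair Id (Pair r q)))) => t.
have comp p1 p2 u v w : Defs.eval p2 u v -> Defs.eval p1 v w -> Defs.eval (Comp p1 p2) u w.
  exact: eval_Comp.
have snd2 u v w : Defs.eval (Comp Snd Snd) (Node u (Node v w)) w.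
  by apply: comp; [exact: eval_Snd|exact: eval_Snd].
have fst2 u v w : Defs.eval (Comp Fst Snd) (Node u (Node v w)) v.
  by apply: comp; [exact: eval_Snd|exact: eval_Fst].
apply: (comp _ _ _ (Node t (Node Leaf (tfoldl (f t) (a t) (l t))))); last exact: snd2.
apply: (comp _ _ _ (Node t (Node (l t) (a t)))).
  by apply: eval_Pair; [exact: eval_Id|apply: eval_Pair].
move: (l t) (a t) => {l a q r aq lr}; elim=> [|x _ l IH] a /=.
  by apply: eval_While_stop; exact: fst2.
apply: (@eval_While_step _ _ _ x l (Node t (Node l (f t x a)))); first exact: fst2.
  apply: eval_Pair; first exact: eval_Fst.
  apply: eval_Pair; first by apply: comp (eval_Snd x l); exact: fst2.
  apply: (comp _ _ _ (Node t (Node x a))); last exact: fp (Node t (Node x a)).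
  apply: eval_Pair; first exact: eval_Fst.
  by apply: eval_Pair; [apply: comp (eval_Fst x l); exact: fst2|exact: snd2].
exact: IH.
Qed.

Ltac cf_step :=
  match goal with
  | |- Cf1 _ => unfold Cf1
  | |- Cf2 _ => unfold Cf2
  | |- Cf3 _ => unfold Cf3
  | |- cf (fun t => t) => exact cf_id
  | |- cf (fun t => ?c) => apply (cf_const c)
  | |- cf (fun t => Node (@?a t) (@?b t)) => apply (@cf_node a b)
  | |- cf (fun t => tif (@?c t) (@?a t) (@?b t)) => apply (@cf_tif c a b)
  | |- cf (fun t => tfoldl (fun x y => @?f t x y) (@?a t) (@?l t)) =>
      apply (@cf_tfoldl f a l)
  | |- cf (fun t => ?f (@?a t) (@?b t) (@?c t)) => apply (@comp3 f a b c); [exact _| | |]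
  | |- cf (fun t => ?f (@?a t) (@?b t)) => apply (@comp2 f a b); [exact _| |]
  | |- cf (fun t => ?f (@?a t)) => apply (@comp1 f a); [exact _|]
  end.
Ltac cf_auto := repeat (cf_step; cbv beta).

Definition trev l := tfoldl (fun x a => Node x a) Leaf l.

#[export] Instance Cf1_trev : Cf1 trev.
Proof. by rewrite /trev; cf_auto. Qed.

Lemma tfoldr_rev f a l : tfoldr f a l = tfoldl f a (trev l).
Proof.
suff H l' : tfoldl f a (tfoldl (fun x a => Node x a) l' l) = tfoldl f (tfoldr f a l) l'.
  by rewrite /trev H.
by elim: l l' => //= x _ l IH l'; rewrite IH.
Qed.

Lemma cf_tfoldr (f : tree -> tree -> tree -> tree) a l : Cf3 f -> cf a -> cf l ->
  cf (fun t => tfoldr (f t) (a t) (l t)).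
Proof.
move=> cff ca cl.
have -> : (fun t => tfoldr (f t) (a t) (l t)) = (fun t => tfoldl (f t) (a t) (trev (l t))).
  by apply/funext => t; rewrite tfoldr_rev.
by apply: cf_tfoldl => //; apply: comp1.
Qed.

Ltac cf_step2 :=
  match goal with
  | |- cf (fun t => tfoldr (fun x y => @?f t x y) (@?a t) (@?l t)) =>
      apply (@cf_tfoldr f a l)
  | _ => cf_step
  end.
Ltac cf_auto ::= repeat (cf_step2; cbv beta).

Definition decl (T : Type) (dec : tree -> T) := fix decl l : seq T :=
  if l is Node x l' then dec x :: decl l' else [::].

Definition tmap f l := tfoldr (fun x a => Node (f x) a) Leaf l.

Lemma cf_tmap (f : tree -> tree -> tree) l : Cf2 f -> cf l -> cf (fun t => tmap (f t) (l t)).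
Proof.
move=> cff cl; apply: (@cf_tfoldr (fun t x a => Node (f t x) a)) => //; cf_auto.
Qed.

Ltac cf_step3 :=
  match goal with
  | |- cf (fun t => tmap (fun x => @?f t x) (@?l t)) => apply (@cf_tmap f l)
  | _ => cf_step2
  end.
Ltac cf_auto ::= repeat (cf_step3; cbv beta).

Lemma decl_map (T U : Type) (dec : tree -> T) (dec' : tree -> U) f g l :
  (forall x, dec' (f x) = g (dec x)) -> decl dec' (tmap f l) = map g (decl dec l).
Proof. by move=> h; elim: l => //= x _ l ->; rewrite h. Qed.

Definition tcat l l' := tfoldr (fun x a => Node x a) l' l.

#[export] Instance Cf2_tcat : Cf2 tcat.
Proof. by rewrite /tcat; cf_auto. Qed.

Lemma decl_cat (T : Type) (dec : tree -> T) l l' : decl dec (tcat l l') = decl dec l ++ decl dec l'.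
Proof. by elim: l => //= x _ l ->. Qed.

(* The state of the fold holds the reversed result and the rest of l'. *)
Definition tzip l l' := trev (tfst (tfoldl (fun x a =>
   tif (tsnd a) (Node (Node (Node x (tfst (tsnd a))) (tfst a)) (tsnd (tsnd a))) a) (Node Leaf l') l)).

#[export] Instance Cf2_tzip : Cf2 tzip.
Proof. by rewrite /tzip; cf_auto. Qed.

Lemma decl_rev (T : Type) (dec : tree -> T) l : decl dec (trev l) = rev (decl dec l).
Proof.
suff H l' : decl dec (tfoldl (fun x a => Node x a) l' l) = catrev (decl dec l) (decl dec l').
  by rewrite /trev H.
by elim: l l' => //= x _ l IH l'; rewrite IH.
Qed.

Lemma decl_zip (T U : Type) (dec : tree -> T) (dec' : tree -> U) l l' :
  decl (fun t => (dec (tfst t), dec' (tsnd t))) (tzip l l') = zip (decl dec l) (decl dec' l').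
Proof.
rewrite /tzip decl_rev; set d := fun t => _; set f := fun x a => _.
have H a b : decl d (tfst (tfoldl f (Node a b) l)) =
    catrev (zip (decl dec l) (decl dec' b)) (decl d a).
  elim: l a b => [|x _ l IH] a [|y b] //=.
    by rewrite /f /= /tif /= -/f; elim: l {IH} => //= z _ l.
  by rewrite {2}/f /= /tif /= -/f IH.
by rewrite H revK.
Qed.

(** * Rational arithmetic on trees *)

Definition tt1 := Node Leaf Leaf.

(** All trees are decoded: a natural number is the length of a right spine,
    whatever hangs on it, and likewise for the other types. Hence no operation
    has to check that its arguments are well formed. *)
Fixpoint spine t : nat := if t is Node _ t' then (spine t').+1 else 0%N.

Definition tmul a b := tfoldr (fun _ c => tcat b c) Leaf a.
Definition tsub a b := tfoldl (fun _ c => tsnd c) a b.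
Definition nnorm a := tmap (fun=> Leaf) a.

#[export] Instance Cf2_tmul : Cf2 tmul. Proof. by rewrite /tmul; cf_auto. Qed.
#[export] Instance Cf2_tsub : Cf2 tsub. Proof. by rewrite /tsub; cf_auto. Qed.
#[export] Instance Cf1_nnorm : Cf1 nnorm. Proof. by rewrite /nnorm; cf_auto. Qed.

Lemma spine_cat a b : spine (tcat a b) = (spine a + spine b)%N.
Proof. by elim: a => //= x _ a ->. Qed.

Lemma spine_mul a b : spine (tmul a b) = (spine a * spine b)%N.
Proof. by elim: a => //= x _ a IH; rewrite spine_cat mulSn -IH. Qed.

Lemma spine_sub a b : spine (tsub a b) = (spine a - spine b)%N.
Proof.
rewrite /tsub; elim: b a => [|x _ b IH] a /=; first by rewrite subn0.
by rewrite IH; case: a => //= *; rewrite subSS.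
Qed.

Lemma spine_tsnd a : spine (tsnd a) = (spine a).-1. Proof. by case: a. Qed.

Lemma holds_spine a : holds a = (0 < spine a)%N. Proof. by case: a. Qed.

Lemma nnormE a : nnorm a = code_nat (spine a).
Proof. by elim: a => //= x _ a <-. Qed.

Lemma spine_code n : spine (code_nat n) = n.
Proof. by elim: n => //= n ->. Qed.

Definition deci t : int := if holds (tfst t) then Negz (spine (tsnd t)) else Posz (spine (tsnd t)).

Definition ipos t := tif (tfst t) Leaf (tsnd t).
Definition ineg t := tif (tfst t) (Node Leaf (tsnd t)) Leaf.
Definition iof a b := tif (tsub b a) (Node tt1 (tsnd (tsub b a))) (Node Leaf (tsub a b)).
Definition iadd x y := iof (tcat (ipos x) (ipos y)) (tcat (ineg x) (ineg y)).
Definition iopp x := iof (ineg x) (ipos x).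
Definition imul x y := iof (tcat (tmul (ipos x) (ipos y)) (tmul (ineg x) (ineg y)))
  (tcat (tmul (ipos x) (ineg y)) (tmul (ineg x) (ipos y))).
Definition inorm t := tif (tfst t) (Node tt1 (nnorm (tsnd t))) (Node Leaf (nnorm (tsnd t))).

#[export] Instance Cf1_ipos : Cf1 ipos. Proof. by rewrite /ipos; cf_auto. Qed.
#[export] Instance Cf1_ineg : Cf1 ineg. Proof. by rewrite /ineg; cf_auto. Qed.
#[export] Instance Cf2_iof : Cf2 iof. Proof. by rewrite /iof; cf_auto. Qed.
#[export] Instance Cf2_iadd : Cf2 iadd. Proof. by rewrite /iadd; cf_auto. Qed.
#[export] Instance Cf1_iopp : Cf1 iopp. Proof. by rewrite /iopp; cf_auto. Qed.
#[export] Instance Cf2_imul : Cf2 imul. Proof. by rewrite /imul; cf_auto. Qed.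
#[export] Instance Cf1_inorm : Cf1 inorm. Proof. by rewrite /inorm; cf_auto. Qed.

Lemma deciE t : deci t = (spine (ipos t))%:Z - (spine (ineg t))%:Z.
Proof. by rewrite /deci /ipos /ineg /tif; case: (tfst t) => [|a b] /=; rewrite ?subr0 ?sub0r ?NegzE. Qed.

Lemma deci_of a b : deci (iof a b) = (spine a)%:Z - (spine b)%:Z.
Proof.
rewrite /iof /tif holds_spine spine_sub subn_gt0.
by case: ltnP => h; rewrite /deci /= ?spine_tsnd !spine_sub ?NegzE; lia.
Qed.

Lemma deci_add x y : deci (iadd x y) = deci x + deci y.
Proof. by rewrite /iadd deci_of !spine_cat !deciE !PoszD; ring. Qed.

Lemma deci_opp x : deci (iopp x) = - deci x.
Proof. by rewrite /iopp deci_of !deciE; ring. Qed.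

Lemma deci_mul x y : deci (imul x y) = deci x * deci y.
Proof. by rewrite /imul deci_of !spine_cat !spine_mul !deciE !PoszD !PoszM; ring. Qed.

Lemma deci_norm t : inorm t = code_int (deci t).
Proof. by rewrite /inorm /deci /tif; case: ifP => _ /=; rewrite nnormE. Qed.

Lemma deci_code m : deci (code_int m) = m.
Proof. by case: m => n; rewrite /deci /= spine_code. Qed.

(** One more than the length that follows the sign, so that denominators are
    positive and the codes of rational numbers are decoded to themselves. *)
Definition qden t := Node Leaf (tsnd (tsnd (tsnd t))).
Definition qmk a d := Node a (Node Leaf d).
Definition decq t : rat := (deci (tfst t))%:~R / (spine (qden t))%:R.
Definition qadd x y := qmk (iadd (imul (tfst x) (Node Leaf (qden y)))
   (imul (tfst y) (Node Leaf (qden x)))) (tmul (qden x) (qden y)).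
Definition qmul x y := qmk (imul (tfst x) (tfst y)) (tmul (qden x) (qden y)).
Definition qopp x := qmk (iopp (tfst x)) (qden x).
Definition qnz x := tif (tfst (tfst x)) tt1 (tsnd (tfst x)).
(** The code of the numerator: the integer multiples suffice, and there is no
    fraction to reduce. *)
Definition qnorm x := qmk (inorm (tfst x)) tt1.

#[export] Instance Cf1_qden : Cf1 qden. Proof. by rewrite /qden; cf_auto. Qed.
#[export] Instance Cf2_qmk : Cf2 qmk. Proof. by rewrite /qmk; cf_auto. Qed.
#[export] Instance Cf2_qadd : Cf2 qadd. Proof. by rewrite /qadd; cf_auto. Qed.
#[export] Instance Cf2_qmul : Cf2 qmul. Proof. by rewrite /qmul; cf_auto. Qed.
#[export] Instance Cf1_qopp : Cf1 qopp. Proof. by rewrite /qopp; cf_auto. Qed.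
#[export] Instance Cf1_qnz : Cf1 qnz. Proof. by rewrite /qnz; cf_auto. Qed.
#[export] Instance Cf1_qnorm : Cf1 qnorm. Proof. by rewrite /qnorm; cf_auto. Qed.

Lemma qden_neq0 t : (spine (qden t))%:R != 0 :> rat. Proof. by rewrite pnatr_eq0. Qed.

Lemma decq_mk a d : (0 < spine d)%N -> decq (qmk a d) = (deci a)%:~R / (spine d)%:R.
Proof. by case: d. Qed.

Lemma deci_nat a : deci (Node Leaf a) = spine a. Proof. by []. Qed.

Lemma decq_add x y : decq (qadd x y) = decq x + decq y.
Proof.
rewrite /qadd decq_mk !spine_mul // deci_add !deci_mul !deci_nat /decq.
have := qden_neq0 x; have := qden_neq0 y.
move: (spine (qden x)) (spine (qden y)) (deci _) (deci _) => a b u v b0 a0.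
rewrite rmorphD !rmorphM /= -!pmulrn; field; rewrite a0 b0 //.
Qed.

Lemma decq_mul x y : decq (qmul x y) = decq x * decq y.
Proof.
rewrite /qmul decq_mk !spine_mul // deci_mul /decq.
have := qden_neq0 x; have := qden_neq0 y.
move: (spine (qden x)) (spine (qden y)) (deci _) (deci _) => a b u v b0 a0.
by rewrite !rmorphM /=; field; rewrite a0 b0.
Qed.

Lemma decq_opp x : decq (qopp x) = - decq x.
Proof. by rewrite /qopp decq_mk // deci_opp rmorphN mulNr. Qed.

Lemma decq_nz x : holds (qnz x) = (decq x != 0).
Proof.
rewrite /decq mulf_eq0 invr_eq0 (negbTE (qden_neq0 x)) orbF intr_eq0 /qnz /tif /deci.
by case: (holds (tfst (tfst x))) => //=; rewrite holds_spine lt0n.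
Qed.

Lemma decq_leaf : decq Leaf = 0. Proof. by rewrite /decq mul0r. Qed.

Lemma decq_code r : decq (code_rat r) = r.
Proof.
rewrite /decq /= deci_code -[RHS]divq_num_den; congr (_ / _).
have := denq_gt0 r; case: (denq r) => // -[|n] _ //=.
by rewrite spine_code.
Qed.

Lemma decq_norm t : decq (qnorm t) = (deci (tfst t))%:~R.
Proof. by rewrite /qnorm decq_mk // deci_norm deci_code divr1. Qed.

Lemma qnormE t : qnorm t = code_rat (decq (qnorm t)).
Proof. by rewrite decq_norm /qnorm deci_norm /code_rat numq_int denq_int. Qed.

(** * Computable rings *)

(** A domain whose elements are given by trees, in several ways: every tree
    denotes an element. The canonical code of an element is only produced by
    cnorm, and only up to an integer factor: this avoids reducing fractions. *)
Record cring (A : idomainType) := CRing {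
  dec : tree -> A;
  cadd : tree -> tree -> tree;
  cmul : tree -> tree -> tree;
  copp : tree -> tree;
  cnz : tree -> tree;
  code : A -> tree;
  cnorm : tree -> tree;
  cf_cadd : Cf2 cadd;
  cf_cmul : Cf2 cmul;
  cf_copp : Cf1 copp;
  cf_cnz : Cf1 cnz;
  cf_cnorm : Cf1 cnorm;
  dec_leaf : dec Leaf = 0;
  dec_add : forall x y, dec (cadd x y) = dec x + dec y;
  dec_mul : forall x y, dec (cmul x y) = dec x * dec y;
  dec_opp : forall x, dec (copp x) = - dec x;
  dec_nz : forall x, holds (cnz x) = (dec x != 0);
  dec_code : forall a, dec (code a) = a;
  cnormE : forall x, cnorm x = code (dec (cnorm x));
  cnorm_multiple : forall a, exists2 M, (0 < M)%N &
    forall k, exists x, dec (cnorm x) = a *+ (M * k) }.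

#[export] Existing Instance cf_cadd.
#[export] Existing Instance cf_cmul.
#[export] Existing Instance cf_copp.
#[export] Existing Instance cf_cnz.
#[export] Existing Instance cf_cnorm.

Section NumberField.
Variable K : fieldExtType rat.
Notation n := (\dim {:K}).
Notation b := (vbasis {:K}).

Definition tnth (i : nat) t := tfst (iter i tsnd t).
Definition vec (f : 'I_n -> tree) := code_seq f (enum 'I_n).

Lemma cf_iter_tsnd i a : cf a -> cf (fun t => iter i tsnd (a t)).
Proof. by elim: i => //= i IH ca; apply: comp1; exact: IH. Qed.

#[export] Instance Cf1_tnth i : Cf1 (tnth i).
Proof. apply: comp1; exact/cf_iter_tsnd/cf_id. Qed.

Lemma cf_code_seq (T : Type) (f : T -> tree -> tree) s : (forall i, cf (f i)) ->
  cf (fun t => code_seq (fun i => f i t) s).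
Proof. by move=> cff; elim: s => [|i s IH] /=; [exact: cf_const|exact: cf_node]. Qed.

Definition qsum (T : Type) (s : seq T) (f : T -> tree) := foldr (fun i a => qadd (f i) a) Leaf s.

Lemma cf_qsum (T : Type) (f : T -> tree -> tree) s : (forall i, cf (f i)) ->
  cf (fun t => qsum s (fun i => f i t)).
Proof. by move=> cff; elim: s => [|i s IH] /=; [exact: cf_const|exact: comp2]. Qed.

Lemma decq_sum (T : Type) (s : seq T) f : decq (qsum s f) = \sum_(i <- s) decq (f i).
Proof. by elim: s => [|i s IH]; rewrite ?big_nil ?big_cons ?decq_leaf //= decq_add IH. Qed.

Lemma tnth_vec f (i : 'I_n) : tnth i (vec f) = f i.
Proof.
rewrite /tnth /vec -[in RHS](@nth_ord_enum n i i).
have : (i < size (enum 'I_n))%N by rewrite size_enum_ord.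
move: (enum 'I_n) => s; elim: s (val i) => // j s IH [|m] //= h.
by rewrite -iterS iterSr /= IH.
Qed.

Definition decK t : K := \sum_(i < n) decq (tnth i t) *: b`_i.

Lemma decK_coord t (i : 'I_n) : coord b i (decK t) = decq (tnth i t).
Proof.
rewrite linear_sum (bigD1 i) //= linearZ /= coord_free ?(basis_free (vbasisP _)) // eqxx mulr1.
rewrite big1 ?addr0 // => j ji.
by rewrite linearZ /= coord_free ?(basis_free (vbasisP _)) // (negbTE ji) mulr0.
Qed.

Lemma coord_inj (x y : K) : (forall i, coord b i x = coord b i y) -> x = y.
Proof.
move=> e; rewrite (coord_vbasis (memvf x)) (coord_vbasis (memvf y)).
by apply: eq_bigr => i _; rewrite e.
Qed.

Definition kadd x y := vec (fun i => qadd (tnth i x) (tnth i y)).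
Definition kopp x := vec (fun i => qopp (tnth i x)).
(** Structure constants with respect to the basis are built into the program. *)
Definition kmul x y := vec (fun k => qsum (enum {: 'I_n * 'I_n}) (fun ij =>
   qmul (code_rat (coord b k (b`_ij.1 * b`_ij.2))) (qmul (tnth ij.1 x) (tnth ij.2 y)))).
Definition knz x := foldr (fun (i : 'I_n) a => tif (qnz (tnth i x)) tt1 a) Leaf (enum 'I_n).
Definition knorm x := vec (fun i => qnorm (tnth i x)).

Lemma Cf2_kadd : Cf2 kadd.
Proof. by apply: cf_code_seq => i; cf_auto. Qed.

Lemma Cf1_kopp : Cf1 kopp.
Proof. by apply: cf_code_seq => i; cf_auto. Qed.

Lemma Cf2_kmul : Cf2 kmul.
Proof. by apply: cf_code_seq => i; apply: cf_qsum => ij; cf_auto. Qed.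

Lemma Cf1_knz : Cf1 knz.
Proof.
rewrite /Cf1 /knz; elim: (enum 'I_n) => [|i s IH] /=; first exact: cf_const.
by apply: cf_tif; [cf_auto|cf_auto|exact: IH].
Qed.

Lemma Cf1_knorm : Cf1 knorm.
Proof. by apply: cf_code_seq => i; cf_auto. Qed.

Lemma decK_leaf : decK Leaf = 0.
Proof.
apply: coord_inj => i; rewrite decK_coord linear0 /tnth.
have -> : iter i tsnd Leaf = Leaf by elim: (val i) => //= m ->.
exact: decq_leaf.
Qed.

Lemma decK_add x y : decK (kadd x y) = decK x + decK y.
Proof. by apply: coord_inj => i; rewrite linearD /= !decK_coord tnth_vec decq_add. Qed.

Lemma decK_opp x : decK (kopp x) = - decK x.
Proof. by apply: coord_inj => i; rewrite linearN /= !decK_coord tnth_vec decq_opp. Qed.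

Lemma decK_mul x y : decK (kmul x y) = decK x * decK y.
Proof.
apply: coord_inj => k; rewrite decK_coord tnth_vec decq_sum big_enum /=.
rewrite /decK big_distrlr pair_big linear_sum; apply: eq_bigr => -[i j] _ /=.
by rewrite -scalerAl -scalerAr scalerA linearZ /= !decq_mul decq_code mulrC.
Qed.

Lemma decK_nz x : holds (knz x) = (decK x != 0).
Proof.
have -> : holds (knz x) = has (fun i : 'I_n => decq (tnth i x) != 0) (enum 'I_n).
  by rewrite /knz; elim: (enum 'I_n) => //= i s <-; rewrite /tif decq_nz; case: (decq _ != 0).
apply/hasP/idP => [[i _]|x0].
  by apply: contra_neq => x0; rewrite -decK_coord x0 linear0.
apply/hasP; apply: contraNT x0 => /hasPn h; apply/eqP/coord_inj => i.
by rewrite decK_coord linear0; apply/eqP; have := h i (mem_enum _ _); rewrite negbK.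
Qed.

Lemma decK_code a : decK (code_elt a) = a.
Proof. by apply: coord_inj => i; rewrite decK_coord [tnth _ _]tnth_vec decq_code. Qed.

Lemma knormE x : knorm x = code_elt (decK (knorm x)).
Proof.
rewrite {1}/knorm /vec /code_elt; congr (code_seq _ _); apply/funext => i.
by rewrite decK_coord tnth_vec -qnormE.
Qed.

Lemma knorm_multiple a : exists2 M, (0 < M)%N &
  forall k, exists x, decK (knorm x) = a *+ (M * k).
Proof.
exists (\prod_(i < n) `|denq (coord b i a)|%N); first by rewrite prodn_gt0 // => i; rewrite absz_gt0 denq_neq0.
move=> k; set M := \prod_i _.
have H (i : 'I_n) : exists z : int, coord b i a *+ (M * k) = z%:~R.
  rewrite /M (bigD1 i) //=; set c := coord b i a; set m := (\prod_(j < _ | _) _)%N.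
  exists (numq c * (m * k)%:Z); rewrite -mulnA mulrnA rmorphM /= numqE -pmulrn mulr_natr.
  congr (_ *+ _); rewrite -mulr_natr; congr (_ * _).
  by have := denq_gt0 c; case: (denq c).
have [z zE] := fin_all_exists H.
exists (vec (fun i => Node (code_int (z i)) Leaf)); apply: coord_inj => i.
by rewrite decK_coord tnth_vec decq_norm tnth_vec /= deci_code -zE raddfMn.
Qed.

Definition cringK : cring K :=
  CRing Cf2_kadd Cf2_kmul Cf1_kopp Cf1_knz Cf1_knorm decK_leaf decK_add decK_mul decK_opp
    decK_nz decK_code knormE knorm_multiple.

End NumberField.

Section Polynomial.
Variables (A : idomainType) (r : cring A).
Notation decA := (dec r).
Implicit Types (x y l : tree).

Fixpoint decP l : {poly A} := if l is Node x l' then cons_poly (decA x) (decP l') else 0.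

Definition pscale c l := tmap (fun x => cmul r c x) l.
(** Both lists are extended with zeros, in order to be zipped. *)
Definition padd a b := tmap (fun x => cadd r (tfst x) (tsnd x))
  (tzip (tcat a (tmap (fun=> Leaf) b)) (tcat b (tmap (fun=> Leaf) a))).
Definition popp a := tmap (fun x => copp r x) a.
Definition pmul a b := tfoldr (fun x c => padd (pscale x b) (Node Leaf c)) Leaf a.
Definition pnz a := tfoldr (fun x c => tif (cnz r x) tt1 c) Leaf a.
(** Trailing zeros are removed, because the code of a polynomial ends with its
    leading coefficient. *)
Definition pnorm a := tfoldr (fun x c => tif c (Node (cnorm r x) c)
  (tif (cnz r (cnorm r x)) (Node (cnorm r x) Leaf) Leaf)) Leaf a.

#[export] Instance Cf2_pscale : Cf2 pscale. Proof. by rewrite /pscale; cf_auto. Qed.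
#[export] Instance Cf2_padd : Cf2 padd. Proof. by rewrite /padd; cf_auto. Qed.
#[export] Instance Cf1_popp : Cf1 popp. Proof. by rewrite /popp; cf_auto. Qed.
#[export] Instance Cf2_pmul : Cf2 pmul. Proof. by rewrite /pmul; cf_auto. Qed.
#[export] Instance Cf1_pnz : Cf1 pnz. Proof. by rewrite /pnz; cf_auto. Qed.
#[export] Instance Cf1_pnorm : Cf1 pnorm. Proof. by rewrite /pnorm; cf_auto. Qed.

Lemma coef_decP l i : (decP l)`_i = nth 0 (decl decA l) i.
Proof. by elim: l i => [|x _ l IH] [|i] /=; rewrite ?coef0 ?coef_cons //=. Qed.

Lemma spine_map f l : spine (tmap f l) = spine l.
Proof. by elim: l => //= x _ l <-. Qed.

Lemma decP_leaves l l' : decP (tcat l (tmap (fun=> Leaf) l')) = decP l.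
Proof.
elim: l => [|x _ l IH] /=; last by rewrite IH.
by elim: l' => //= x _ l ->; rewrite dec_leaf cons_poly_def mul0r add0r polyC0.
Qed.

Lemma size_decl (T : Type) (d : tree -> T) l : size (decl d l) = spine l.
Proof. by elim: l => //= x _ l ->. Qed.

Lemma dec_padd a b : decP (padd a b) = decP a + decP b.
Proof.
rewrite -[in RHS](decP_leaves a b) -[in RHS](decP_leaves b a) /padd.
set a' := tcat a _; set b' := tcat b _; have : spine a' = spine b'.
  by rewrite /a' /b' !spine_cat !spine_map addnC.
move: a' b' => {}a {}b sab; apply/polyP => i; rewrite coefD !coef_decP.
rewrite (@decl_map _ _ (fun t => (decA (tfst t), decA (tsnd t))) _ _ (fun t => t.1 + t.2)).
  rewrite decl_zip; have {sab} : size (decl decA a) = size (decl decA b) by rewrite !size_decl.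
  elim: (decl decA a) (decl decA b) i => [|u s IH] [|v t] [|i] //= e; rewrite ?addr0 //.
  by apply: IH; case: e.
by move=> t; rewrite dec_add.
Qed.

Lemma dec_pscale c l : decP (pscale c l) = (decA c)%:P * decP l.
Proof.
elim: l => [|x _ l IH] /=; first by rewrite mulr0.
by rewrite -/(pscale c l) IH dec_mul !cons_poly_def polyCM; ring.
Qed.

Lemma dec_shift l : decP (Node Leaf l) = decP l * 'X.
Proof. by rewrite /= dec_leaf cons_poly_def polyC0 addr0. Qed.

Lemma dec_pmul a b : decP (pmul a b) = decP a * decP b.
Proof.
elim: a => [|x _ a IH] /=; first by rewrite mul0r.
by rewrite -/(pmul a b) dec_padd dec_shift dec_pscale IH cons_poly_def; ring.
Qed.

Lemma dec_popp a : decP (popp a) = - decP a.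
Proof.
elim: a => [|x _ a IH] /=; first by rewrite oppr0.
by rewrite -/(popp a) IH dec_opp !cons_poly_def polyCN; ring.
Qed.

Lemma cons_poly_eq0 (c : A) p : (cons_poly c p == 0) = (c == 0) && (p == 0).
Proof.
rewrite cons_poly_def; have [->|p0] := eqVneq p 0; first by rewrite mul0r add0r polyC_eq0 andbT.
rewrite andbF; apply/negbTE; rewrite -cons_poly_def -size_poly_eq0 size_cons_poly.
by rewrite nil_poly (negbTE p0).
Qed.

Lemma dec_pnz a : holds (pnz a) = (decP a != 0).
Proof.
elim: a => [|x _ a IH] /=; first by rewrite eqxx.
rewrite /pnz /= -/(pnz a) /tif cons_poly_eq0 negb_and -IH dec_nz; by case: (decA x != 0).
Qed.

Definition codeP (p : {poly A}) := code_seq (code r) p.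

Lemma dec_codeP p : decP (codeP p) = p.
Proof.
have H s : decP (code_seq (code r) s) = Poly s by elim: s => //= c s ->; rewrite dec_code.
by rewrite /codeP H polyseqK.
Qed.

Lemma pnorm_cons x l : pnorm (Node x l) = if holds (pnorm l) then Node (cnorm r x) (pnorm l)
  else if holds (cnz r (cnorm r x)) then Node (cnorm r x) Leaf else Leaf.
Proof. by []. Qed.

Lemma pnormE l : pnorm l = codeP (decP (pnorm l)).
Proof.
elim: l => [|x _ l IH]; first by rewrite /codeP polyseq0.
rewrite pnorm_cons; case: ifP => h.
  rewrite /= {1}IH /codeP polyseq_cons; have -> : nilp (decP (pnorm l)) = false.
    rewrite nil_poly; apply: contraTF h => /eqP e; rewrite IH e /codeP polyseq0 //.
  by rewrite /= -cnormE.
have e : decP (pnorm l) = 0.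
  by apply/eqP; rewrite -nil_poly; move: h; rewrite {1}IH /codeP; case: (polyseq _).
have [c0|c0] := boolP (decA (cnorm r x) == 0); rewrite dec_nz ?c0 ?(negbTE c0) /=.
  by rewrite /codeP polyseq0.
by rewrite /codeP cons_poly_def mul0r add0r polyseqC c0 /= -cnormE.
Qed.

Lemma pnorm_dec l : decP (pnorm l) = decP (tmap (cnorm r) l).
Proof.
elim: l => // x _ l IH; rewrite pnorm_cons [RHS]/= -/(tmap (cnorm r) l) -IH.
case: ifP => //= h; have e : decP (pnorm l) = 0.
  by case: (pnorm l) h.
rewrite dec_nz e; case: eqP => [->|_] //=; by rewrite cons_poly_def mul0r add0r polyC0.
Qed.

Lemma pnorm_multiple p : exists2 M, (0 < M)%N &
  forall k, exists l, decP (pnorm l) = p *+ (M * k).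
Proof.
rewrite -(polyseqK p); elim: (polyseq p) => [|c s [M M0 IH]] /=.
  by exists 1%N => // k; exists Leaf; rewrite mul0rn.
have [M' M0' c'] := cnorm_multiple r c.
exists (M' * M)%N => [|k]; first by rewrite muln_gt0 M0'.
have [x xe] := c' (M * k)%N; have [l le] := IH (M' * k)%N.
exists (Node x l); rewrite pnorm_dec /= -pnorm_dec le xe !cons_poly_def.
by rewrite mulrnDl polyCMn mulrnAl; congr (_ *+ _ + _ *+ _); lia.
Qed.

Definition cringP : cring {poly A} :=
  CRing Cf2_padd Cf2_pmul Cf1_popp Cf1_pnz Cf1_pnorm (erefl : decP Leaf = 0)
    dec_padd dec_pmul dec_popp dec_pnz dec_codeP pnormE pnorm_multiple.

End Polynomial.

(** * Checking certificates *)

Arguments dec : simpl never.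
Arguments decP : simpl nomatch.

Section Derivative.
Variables (A : idomainType) (r : cring A).

(** Horner's scheme: the derivative of p X + c is p + p' X, so the state of the
    fold is the pair of a list and of its derivative. *)
Definition pderiv l := tsnd (tfoldr (fun x s => Node (Node x (tfst s))
  (padd r (tfst s) (Node Leaf (tsnd s)))) (Node Leaf Leaf) l).

#[export] Instance Cf1_pderiv : Cf1 pderiv. Proof. by rewrite /pderiv; cf_auto. Qed.

Lemma dec_pderiv l : decP r (pderiv l) = (decP r l)^`().
Proof.
rewrite /pderiv; set f := fun x s => _.
have -> : tfoldr f (Node Leaf Leaf) l = Node l (pderiv l).
  by elim: l => //= x _ l IH; rewrite /pderiv /= -/f IH.
elim: l => /= [|x _ l IH]; first by rewrite deriv0.
rewrite /pderiv /= -/f; have -> : tfoldr f (Node Leaf Leaf) l = Node l (pderiv l).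
  by elim: l {IH} => //= y _ l IH; rewrite /pderiv /= -/f IH.
by rewrite dec_padd dec_shift IH cons_poly_def derivD derivC addr0 derivM derivX mulr1 addrC.
Qed.

End Derivative.

Section Checks.
Variables (k : fieldType) (r : cring k).
Notation r1 := (cringP r).
Notation r2 := (cringP r1).
Notation D := (dec r2).
Implicit Types (f p q X : tree).

Definition tm a b := cmul r2 a b.
Definition ta a b := cadd r2 a b.
Definition ts a b := cadd r2 a (copp r2 b).
Definition nz a := cnz r2 a.
Definition tdx l := pderiv r1 l.
Definition tdy l := tmap (fun x => pderiv r x) l.

#[export] Instance Cf2_tm : Cf2 tm. Proof. by rewrite /tm; cf_auto. Qed.
#[export] Instance Cf2_ta : Cf2 ta. Proof. by rewrite /ta; cf_auto. Qed.
#[export] Instance Cf2_ts : Cf2 ts. Proof. by rewrite /ts; cf_auto. Qed.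
#[export] Instance Cf1_nz : Cf1 nz. Proof. by rewrite /nz; cf_auto. Qed.
#[export] Instance Cf1_tdx : Cf1 tdx. Proof. by rewrite /tdx; cf_auto. Qed.
#[export] Instance Cf1_tdy : Cf1 tdy. Proof. by rewrite /tdy; cf_auto. Qed.

Lemma D_m a b : D (tm a b) = D a * D b. Proof. exact: dec_mul. Qed.
Lemma D_a a b : D (ta a b) = D a + D b. Proof. exact: dec_add. Qed.
Lemma D_s a b : D (ts a b) = D a - D b. Proof. by rewrite dec_add dec_opp. Qed.
Lemma D_nz a : holds (nz a) = (D a != 0). Proof. exact: dec_nz. Qed.
Lemma D_dx a : D (tdx a) = polyDx (D a). Proof. exact: dec_pderiv. Qed.

Lemma D_dy a : D (tdy a) = polyDy (D a).
Proof.
apply/polyP => i; rewrite coef_polyDy !coef_decP (@decl_map _ _ (dec r1) _ _ (@deriv k)).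
  have [h|h] := ltnP i (size (decl (dec r1) a)); first exact: nth_map.
  by rewrite !nth_default ?size_map // deriv0.
exact: dec_pderiv.
Qed.

(* f is the pair of the numerator and the denominator of F *)
Definition tflow f p := let P := tfst f in let Q := tsnd f in
  ta (tm (tm Q (tm Q Q)) (tdx p)) (tm (tm P (tm Q Q)) (tdy p)).
Definition tdyF f := let P := tfst f in let Q := tsnd f in ts (tm (tdy P) Q) (tm P (tdy Q)).
Definition tdyyF f := let Q := tsnd f in
  ts (tm (tdy (tdyF f)) Q) (tm (ta (tdyF f) (tdyF f)) (tdy Q)).
Definition thom f p q := ta (ts (tm q (tflow f p)) (tm p (tflow f q)))
  (tm (tm (tm (tsnd f) (tdyF f)) p) q).
Definition tfac f p q := ta (thom f p q) (tm (tdyyF f) (tm q q)).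

#[export] Instance Cf2_tflow : Cf2 tflow. Proof. by rewrite /tflow; cf_auto. Qed.
#[export] Instance Cf1_tdyF : Cf1 tdyF. Proof. by rewrite /tdyF; cf_auto. Qed.
#[export] Instance Cf1_tdyyF : Cf1 tdyyF. Proof. by rewrite /tdyyF; cf_auto. Qed.
#[export] Instance Cf3_thom : Cf3 thom. Proof. by rewrite /thom; cf_auto. Qed.
#[export] Instance Cf3_tfac : Cf3 tfac. Proof. by rewrite /tfac; cf_auto. Qed.

Notation P f := (D (tfst f)).
Notation Q f := (D (tsnd f)).

Lemma D_flow f p : D (tflow f p) = flow (P f) (Q f) (D p).
Proof. by rewrite /tflow /flow !(D_a, D_m) D_dx D_dy; ring. Qed.

Lemma D_dyF f : D (tdyF f) = dyF (P f) (Q f).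
Proof. by rewrite /tdyF /dyF !(D_s, D_m) !D_dy. Qed.

Lemma D_dyyF f : D (tdyyF f) = dyyF (P f) (Q f).
Proof. by rewrite /tdyyF /dyyF !(D_s, D_m, D_dy, D_a, D_dyF); ring. Qed.

Lemma D_hom f p q : D (thom f p q) = hom_eq (P f) (Q f) (D p) (D q).
Proof. by rewrite /thom /hom_eq !(D_s, D_m, D_a, D_dyF, D_flow); ring. Qed.

Lemma D_fac f p q : D (tfac f p q) = factor_eq (P f) (Q f) (D p) (D q).
Proof. by rewrite /tfac /factor_eq !(D_a, D_m, D_hom, D_dyyF); ring. Qed.

Definition tfp f X m := tfst (tfoldl (fun x s => Node (ta (tfst s) (tm x (tsnd s)))
  (tflow f (tsnd s))) (Node Leaf m) X).

#[export] Instance Cf3_tfp : Cf3 tfp. Proof. by rewrite /tfp; cf_auto. Qed.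

Lemma D_fp f X m : D (tfp f X m) = flow_pairing (P f) (Q f) (decl D X) (D m).
Proof.
rewrite /tfp; set g := fun x s => _; rewrite -[RHS]add0r -(dec_leaf r2).
elim: X m {1 2}Leaf => [|x _ X IH] m a /=; first by rewrite addr0.
by rewrite [g x _]/g /= IH D_a D_m D_flow addrA.
Qed.

(** Trees of coefficients are padded with zeros, hence the truncation made by
    zip is harmless. *)
Definition tdot1 u v := tfoldr (fun z c => cadd r (cmul r (tfst z) (tsnd z)) c) Leaf (tzip u v).
Definition tdot u v := tfoldr (fun z c => cadd r (tdot1 (tfst z) (tsnd z)) c) Leaf (tzip u v).

#[export] Instance Cf2_tdot1 : Cf2 tdot1. Proof. by rewrite /tdot1; cf_auto. Qed.
#[export] Instance Cf2_tdot : Cf2 tdot. Proof. by rewrite /tdot; cf_auto. Qed.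

Lemma dec_sum_zip (T U : Type) (dT : tree -> T) (dU : tree -> U) (phi : T -> U -> k) g u v :
  (forall x y, dec r (g x y) = phi (dT x) (dU y)) ->
  dec r (tfoldr (fun z c => cadd r (g (tfst z) (tsnd z)) c) Leaf (tzip u v)) =
  \sum_(z <- zip (decl dT u) (decl dU v)) phi z.1 z.2.
Proof.
move=> h; rewrite -decl_zip; elim: (tzip u v) => [|z _ l IH] /=.
  by rewrite big_nil dec_leaf.
by rewrite big_cons dec_add h IH.
Qed.

Lemma sum_zip_wide (A B : idomainType) (phi : A -> B -> k) (s : seq A) (t : seq B) n :
  (forall x, phi x 0 = 0) -> (forall y, phi 0 y = 0) -> (size s <= n)%N ->
  \sum_(z <- zip s t) phi z.1 z.2 = \sum_(i < n) phi s`_i t`_i.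
Proof.
move=> h1 h2; elim: n s t => [|n IH] [|x s] [|y t] //= sn; rewrite ?big_nil ?big_ord0 //.
- by rewrite big1 // => i _; rewrite nth_nil.
- by rewrite big1 // => i _; rewrite nth_nil.
- by rewrite big1 // => i _; rewrite nth_nil.
by rewrite big_cons big_ord_recl /= (IH s t).
Qed.

Lemma D_dot u v : dec r (tdot u v) = dot (D u) (D v).
Proof.
pose phi (a b : {poly k}) := \sum_(i < size a) a`_i * b`_i.
have phiE (a b : {poly k}) n : (size a <= n)%N -> phi a b = \sum_(i < n) a`_i * b`_i.
  move=> an; rewrite /phi (big_ord_widen _ (fun i => a`_i * b`_i) an) big_mkcond.
  by apply: eq_bigr => i _; case: ltnP => // h; rewrite nth_default // mul0r.
have dot1 x y : dec r (tdot1 x y) = phi (dec r1 x) (dec r1 y).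
  rewrite /tdot1 (dec_sum_zip (dT := dec r) (dU := dec r) (phi := *%R)); last exact: dec_mul.
  rewrite (@sum_zip_wide k k *%R _ _ (spine x)) ?size_decl //; try by move=> *; rewrite ?mulr0 ?mul0r.
  rewrite (phiE _ _ (spine x)); last first.
    apply/leq_sizeP => j h; by rewrite coef_decP nth_default // size_decl.
  by apply: eq_bigr => i _; rewrite !coef_decP.
have [n [n1 n2]] := size_bound (D u).
rewrite /tdot (dec_sum_zip (dT := dec r1) (dU := dec r1) (phi := phi)) //.
have phi0 x : phi x 0 = 0 by rewrite /phi big1 // => i _; rewrite coef0 mulr0.
have phi0' x : phi 0 x = 0 by rewrite /phi size_poly0 big_ord0.
rewrite (@sum_zip_wide _ _ phi _ _ (maxn (spine u) n)) //; last by rewrite size_decl leq_maxl.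
rewrite (@dot_wide _ _ _ (maxn (spine u) n)).
- apply: eq_bigr => i _; rewrite (phiE _ _ (maxn (spine u) n)) -?coef_decP //.
  exact: leq_trans (n2 i) (leq_maxr _ _).
- exact: leq_trans n1 (leq_maxr _ _).
- by move=> i; exact: leq_trans (n2 i) (leq_maxr _ _).
Qed.

(** The second component of the state is the part of the list vs that has
    been read. *)
Definition ttri (pnz : tree -> tree -> tree) Ls vs := tif (tsub vs Ls) Leaf
  (tfst (tfoldr (fun z s => Node (tif (pnz (tfst z) (tsnd z))
     (tfoldr (fun u c => tif (pnz (tfst z) u) Leaf c) (tfst s) (tsnd s)) Leaf)
   (Node (tsnd z) (tsnd s))) (Node tt1 Leaf) (tzip Ls vs))).

Lemma cf_ttri (g : tree -> tree -> tree -> tree) Ls vs : Cf3 g -> cf Ls -> cf vs ->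
  cf (fun t => ttri (fun x y => g t x y) (Ls t) (vs t)).
Proof. by move=> cg cL cv; rewrite /ttri; cf_auto; assumption. Qed.

(** The test on the lengths covers the case where there are fewer functionals
    than vectors. *)
Lemma ttriE (T U : Type) (R : nzRingType) (dT : tree -> T) (dU : tree -> U)
    (pair : T -> U -> R) pnz Ls vs :
  (forall x y, holds (pnz x y) = (pair (dT x) (dU y) != 0)) ->
  holds (ttri pnz Ls vs) = triangular pair (decl dT Ls) (decl dU vs).
Proof.
move=> h; rewrite /ttri /tif [holds (tsub _ _)]holds_spine spine_sub subn_gt0; set g := fun z s => _.
have tri_size (s : seq T) (t : seq U) : triangular pair s t -> (size t <= size s)%N.
  by elim: t s => [|y t IH] [|x s] //= /and3P[_ _ /IH].
case: ltnP => lvs.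
  by apply/esym/negP => /tri_size; rewrite !size_decl leqNgt lvs.
have zipt (s : seq T) (t : seq U) : (size t <= size s)%N ->
    triangular pair s t = triangular pair (unzip1 (zip s t)) (unzip2 (zip s t)).
  by elim: t s => [|y t IH] [|x s] //= e; rewrite -IH // unzip2_zip.
rewrite zipt ?size_decl //.
rewrite -decl_zip; set l := tzip Ls vs; set d := fun t => _.
suff : holds (tfst (tfoldr g (Node tt1 Leaf) l)) =
    triangular pair (unzip1 (decl d l)) (unzip2 (decl d l)) /\
   decl dU (tsnd (tfoldr g (Node tt1 Leaf) l)) = unzip2 (decl d l) by case.
elim: l => [|z _ l [IH1 IH2]] //=; rewrite IH2; split=> //.
rewrite -IH1 -IH2 /tif h; case: (_ != 0) => //=.
move: (tfst (tfoldr _ _ _)) (tsnd (tfoldr _ _ _)) => a b {IH1 IH2}.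
elim: b => [|u _ b IH] //=; rewrite -[RHS]andbA -IH h.
by case: (_ == 0).
Qed.


Ltac cf_step4 :=
  match goal with
  | |- cf (fun t => ttri (fun x y => @?g t x y) (@?a t) (@?l t)) => apply (@cf_ttri g a l)
  | _ => cf_step3
  end.
Ltac cf_auto ::= repeat (cf_step4; cbv beta).

Definition typow n := tfoldr (fun _ c => Node (code r1 1) (tmap (fun x => Node Leaf x) c)) Leaf n.
Definition tmons n := tfoldr (fun _ c => tcat (tmap (fun x => Node x Leaf) (typow n))
  (tmap (fun x => Node Leaf x) c)) Leaf n.

#[export] Instance Cf1_typow : Cf1 typow. Proof. by rewrite /typow; cf_auto. Qed.
#[export] Instance Cf1_tmons : Cf1 tmons. Proof. by rewrite /tmons; cf_auto. Qed.

Lemma decl_typow n : decl (dec r1) (typow n) = map (fun j => 'X^j) (iota 0 (spine n)).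
Proof.
elim: n => //= _ _ n IH; rewrite dec_code expr0; congr (_ :: _).
rewrite (@decl_map _ _ (dec r1) _ _ (fun s => s * 'X)); last by move=> x; exact: dec_shift.
rewrite IH -map_comp -[1%N]addn0 iotaDl -map_comp; apply: eq_map => j /=.
by rewrite add1n exprSr.
Qed.

Lemma decl_tmons n : decl D (tmons n) = monomials k (spine n).
Proof.
rewrite /tmons /monomials /box; set s := typow n; set f := fun _ c => _; set m := spine n.
rewrite map_allpairs; suff H l : decl D (tfoldr f Leaf l) =
    [seq monomial k (i, j) | i <- iota 0 (spine l), j <- iota 0 m] by exact: H.
elim: l => //= z _ l IH; rewrite [f z _]/f decl_cat; congr (_ ++ _).
  rewrite (@decl_map _ _ (dec r1) _ _ polyC); last first.
    by move=> x; rewrite /dec /= cons_poly_def mul0r add0r.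
  by rewrite decl_typow -map_comp; apply: eq_map => j; rewrite /= /monomial expr0 mul1r.
rewrite (@decl_map _ _ D _ _ (fun s => s * 'X)); last by move=> x; exact: dec_shift.
rewrite IH -[1%N]addn0 iotaDl map_allpairs allpairs_mapl.
apply: eq_allpairs => // i j; rewrite /monomial /= add1n exprSr; ring.
Qed.

Definition tpiv f X m := tfoldr (fun z c => tm (tfp f (tfst z) (tsnd z)) c) (code r2 1) (tzip X m).

#[export] Instance Cf3_tpiv : Cf3 tpiv. Proof. by rewrite /tpiv; cf_auto. Qed.

Lemma D_piv f X m :
  D (tpiv f X m) = pivots (flow_pairing (P f) (Q f)) (decl (decl D) X) (decl D m).
Proof.
have H (s : seq (seq (polyxy k))) (t : seq (polyxy k)) :
    pivots (flow_pairing (P f) (Q f)) s t =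
    \prod_(z <- zip s t) flow_pairing (P f) (Q f) z.1 z.2.
  by elim: t s => [|y t IH] [|x s]; rewrite ?big_nil //= big_cons IH.
rewrite H -decl_zip /tpiv; elim: (tzip X m) => [|z _ l IH] /=.
  by rewrite big_nil dec_code.
by rewrite big_cons D_m D_fp IH.
Qed.

Definition tbound t := tfoldr (fun x c => Node Leaf (tcat x c)) Leaf t.

#[export] Instance Cf1_tbound : Cf1 tbound. Proof. by rewrite /tbound; cf_auto. Qed.

Lemma fits_bound t : fits (spine (tbound t)) (D t).
Proof.
split=> [|i]; apply/leq_sizeP => j h.
  rewrite coef_decP nth_default // size_decl; apply: leq_trans h.
  by elim: t => //= x _ t IH; rewrite spine_cat ltnS; exact: leq_trans IH (leq_addl _ _).
rewrite coef_decP; elim: t i h => [|x _ t IH] [|i] /=; rewrite ?coef0 //.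
  rewrite coef_decP spine_cat => h; rewrite nth_default // size_decl.
  by apply: ltnW; apply: leq_trans h; rewrite ltnS leq_addr.
by rewrite spine_cat => h; apply: IH; exact: leq_trans (leq_addl _ _) (ltnW h).
Qed.

(* e is the pair of f and the degree bound N, X a list of lists *)
Definition tden e X := tpiv (tfst e) X (tmons (Node Leaf (tsnd e))).
Definition text e X := ttri (fun x m => nz (tfp (tfst e) x m)) X (tmons (Node Leaf (tsnd e))).
(** A bound for the degrees of the numerators which also covers a proposed
    numerator p. *)
Definition tdeg e E p := tcat (tsnd e) (tcat (tbound E) (tbound p)).
Definition tsys e E d := tmap (fun m => thom (tfst e) m E) (tmons d).
Definition tfree L v := ttri (fun x y => cnz r (tdot x y)) L v.

#[export] Instance Cf2_tden : Cf2 tden. Proof. by rewrite /tden; cf_auto. Qed.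
#[export] Instance Cf2_text : Cf2 text. Proof. by rewrite /text; cf_auto. Qed.
#[export] Instance Cf3_tdeg : Cf3 tdeg. Proof. by rewrite /tdeg; cf_auto. Qed.
#[export] Instance Cf3_tsys : Cf3 tsys. Proof. by rewrite /tsys; cf_auto. Qed.
#[export] Instance Cf2_tfree : Cf2 tfree. Proof. by rewrite /tfree; cf_auto. Qed.

Notation Pe e := (D (tfst (tfst e))).
Notation Qe e := (D (tsnd (tfst e))).
Notation Ne e := (spine (tsnd e)).

Lemma D_den e X : D (tden e X) = denominator (Pe e) (Qe e) (Ne e) (decl (decl D) X).
Proof. by rewrite /tden D_piv decl_tmons. Qed.

Lemma textE e X : holds (text e X) = cert_extactic (Pe e) (Qe e) (Ne e) (decl (decl D) X).
Proof.
rewrite /text (@ttriE _ _ _ (decl D) D (flow_pairing (Pe e) (Qe e))) ?decl_tmons // => x y.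
by rewrite D_nz D_fp.
Qed.

Lemma decl_sys e E d : decl D (tsys e E d) = system (Pe e) (Qe e) (D E) (spine d).
Proof.
rewrite /tsys (@decl_map _ _ D _ _ (hom_eq (Pe e) (Qe e) ^~ (D E))) ?decl_tmons // => m.
exact: D_hom.
Qed.

Lemma tfreeE L v : holds (tfree L v) = triangular (@dot k) (decl D L) (decl D v).
Proof. by apply: ttriE => x y; rewrite dec_nz D_dot. Qed.

(** The answer, boxed. The quotient w of polynomials is only computed as a
    pair of trees that need not be codes; the certificate o provides two
    polynomials with the same quotient which are normalised to codes. *)
Definition tout o w := tif (nz (cnorm r2 (tsnd o)))
  (tif (nz (ts (tm (cnorm r2 (tfst o)) (tsnd w)) (tm (tfst w) (cnorm r2 (tsnd o))))) Leaf
    (Node (Node Leaf (Node (cnorm r2 (tfst o)) (cnorm r2 (tsnd o)))) Leaf)) Leaf.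

#[export] Instance Cf2_tout : Cf2 tout. Proof. by rewrite /tout; cf_auto. Qed.

Definition is_quotient (p q p' q' : polyxy k) : Prop := q' != 0 /\ p' * q = p * q'.

Lemma tout_correct o w : holds (tout o w) ->
  exists (p q : polyxy k), tfst (tout o w) = Node Leaf (Node (code r2 p) (code r2 q)) /\
    is_quotient (D (tfst w)) (D (tsnd w)) p q.
Proof.
rewrite /tout /tif; case: ifP => // h1; case: ifP => // /negbT h2 _.
exists (D (cnorm r2 (tfst o))), (D (cnorm r2 (tsnd o))); rewrite -!cnormE; split=> //.
split; first by rewrite -D_nz.
by apply/eqP; rewrite -subr_eq0 -!D_m -D_s; move: h2; rewrite D_nz negbK.
Qed.

(** A common integer multiple of the numerator and of the denominator has
    integral coordinates. *)
Lemma tout_complete w : (forall n, n.+1%:R != 0 :> k) -> D (tsnd w) != 0 ->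
  exists o, holds (tout o w).
Proof.
move=> char0 w0; have [M M0 HM] := cnorm_multiple r2 (D (tfst w)).
have [M' M0' HM'] := cnorm_multiple r2 (D (tsnd w)).
have [a ae] := HM M'; have [b be] := HM' M; exists (Node a b).
rewrite /tout /tif /= !D_nz D_s !D_m ae be.
have -> : D (tsnd w) *+ (M' * M) != 0.
  rewrite -mulr_natr mulf_neq0 // -(prednK (_ : 0 < M' * M)%N) ?muln_gt0 ?M0' //.
  by rewrite -!polyC_natr !polyC_eq0.
by rewrite mulnC mulrnAl mulrnAr subrr eqxx.
Qed.

Definition tfail := Node tt1 Leaf.

Definition check1 f c := tif (nz (tsnd c))
  (tif (nz (ts (tm (tflow f (tfst c)) (tsnd c)) (tm (tfst c) (tflow f (tsnd c))))) Leaf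
    (tif (nz (ts (tm (tdy (tfst c)) (tsnd c)) (tm (tfst c) (tdy (tsnd c))))) (Node tfail Leaf) Leaf))
  Leaf.

Definition check2 f c := let u := tfst (tfst c) in let v := tsnd (tfst c) in
  tif (nz u) (tif (nz v) (tif (nz (thom f u v)) Leaf
    (tout (tsnd c) (Node (ts (tm (tdy u) v) (tm u (tdy v))) (tm u v)))) Leaf) Leaf.

Definition check3 e c := let X := tfst c in let E := tden e X in
  tif (text e X) (tif (tfree (tsnd c)
    (Node (tm (tdyyF (tfst e)) (tm E E)) (tsys e E (tdeg e E Leaf)))) (Node Leaf Leaf) Leaf) Leaf.

Definition check4 e c := let X := tfst (tfst c) in let E := tden e X in let u := tfst (tsnd c) in
  tif (text e X) (tif (nz (tfac (tfst e) u E)) Leaf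
    (tif (tfree (tsnd (tfst c)) (tsys e E (tdeg e E u))) (tout (tsnd (tsnd c)) (Node u E)) Leaf))
  Leaf.

#[export] Instance Cf2_check1 : Cf2 check1. Proof. by rewrite /check1; cf_auto. Qed.
#[export] Instance Cf2_check2 : Cf2 check2. Proof. by rewrite /check2; cf_auto. Qed.
#[export] Instance Cf2_check3 : Cf2 check3. Proof. by rewrite /check3; cf_auto. Qed.
#[export] Instance Cf2_check4 : Cf2 check4. Proof. by rewrite /check4; cf_auto. Qed.

(* c is a certificate, preceded by its kind *)
Definition check e c := let kind := tfst c in
  tif kind (tif (tfst kind) (tif (tsnd kind) (check4 e (tsnd c)) (check3 e (tsnd c)))
    (check2 (tfst e) (tsnd c))) (check1 (tfst e) (tsnd c)).

#[export] Instance Cf2_check : Cf2 check. Proof. by rewrite /check; cf_auto. Qed.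

(** The answers, as trees, with what their certificates prove. *)
Inductive certified (P Q : polyxy k) (N : nat) : tree -> Prop :=
  | certified_integral g h : cert_integral P Q g h -> certified P Q N tfail
  | certified_rational (u v p q : polyxy k) : cert_rational P Q u v ->
      is_quotient (polyDy u * v - u * polyDy v) (u * v) p q ->
      certified P Q N (Node Leaf (Node (code r2 p) (code r2 q)))
  | certified_none Xs b d Ls : cert_extactic P Q N Xs -> fits b (denominator P Q N Xs) ->
      (N + b <= d)%N -> cert_none P Q (denominator P Q N Xs) d Ls ->
      certified P Q N Leaf
  | certified_unique Xs b d Ls (u p q : polyxy k) : cert_extactic P Q N Xs ->
      fits b (denominator P Q N Xs) -> (N + b <= d)%N -> fits d u ->
      cert_unique P Q (denominator P Q N Xs) d Ls ->
      factor_eq P Q u (denominator P Q N Xs) = 0 ->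
      is_quotient u (denominator P Q N Xs) p q ->
      certified P Q N (Node Leaf (Node (code r2 p) (code r2 q))).

Lemma check_correct e c : holds (check e c) ->
  certified (Pe e) (Qe e) (Ne e) (tfst (check e c)).
Proof.
have degE E u : spine (tdeg e E u) = (Ne e + (spine (tbound E) + spine (tbound u)))%N.
  by rewrite /tdeg !spine_cat.
rewrite /check /tif; case: ifP => _; [case: ifP => _; [case: ifP => _|]|];
  move: {c}(tsnd c) => c.
- rewrite /check4 /tif; case: ifP => // h1; case: ifP => // /negbT h2; case: ifP => // h3.
  move=> /tout_correct[p [q [-> pq]]]; move: pq; rewrite /= D_den => pq.
  rewrite textE in h1; rewrite D_nz D_fac D_den negbK in h2; rewrite tfreeE decl_sys D_den in h3.
  set X := tfst (tfst c) in h1 h2 h3 pq *; set E := tden e X in h3; set u := tfst (tsnd c) in h2 h3 pq.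
  apply: (@certified_unique _ _ _ (decl (decl D) X) (spine (tbound E)) (spine (tdeg e E u))
    (decl D (tsnd (tfst c))) (D u)) => //; last 1 first.
  + exact/eqP.
  + rewrite -D_den; exact: fits_bound.
  + by rewrite degE; lia.
  + have [f1 f2] := fits_bound u; rewrite degE.
    by split=> [|i]; [apply: leq_trans f1 _|apply: leq_trans (f2 i) _]; lia.
- rewrite /check3 /tif; case: ifP => // h1; case: ifP => // h2 _.
  rewrite textE in h1; rewrite tfreeE /= decl_sys !D_m D_dyyF D_den in h2.
  apply: certified_none h1 _ _ _; last exact: h2.
    rewrite -D_den; exact: fits_bound.
  by rewrite degE; lia.
- rewrite /check2 /tif; case: ifP => // h1; case: ifP => // h2; case: ifP => // /negbT h3.
  move=> /tout_correct[p [q [-> pq]]].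
  rewrite !D_nz in h1 h2; rewrite D_nz D_hom negbK in h3.
  apply: (@certified_rational _ _ _ (D (tfst (tfst c))) (D (tsnd (tfst c)))).
    by rewrite /cert_rational h1 h2 h3.
  by move: pq; rewrite /= D_s !D_m !D_dy.
rewrite /check1 /tif; case: ifP => // h1; case: ifP => // /negbT h2; case: ifP => // h3 _.
rewrite D_nz in h1; rewrite D_nz D_s !D_m !D_flow negbK in h2.
rewrite D_nz D_s !D_m !D_dy in h3.
by apply: (@certified_integral _ _ _ (D (tfst c)) (D (tsnd c))); rewrite /cert_integral h1 h2 h3.
Qed.

Lemma decl_surj (T : Type) (d : tree -> T) (s : seq T) : (forall x, exists t, d t = x) ->
  exists l, decl d l = s.
Proof.
move=> h; elim: s => [|x s [l ls]]; first by exists Leaf.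
by have [t tx] := h x; exists (Node t l); rewrite /= tx ls.
Qed.

Lemma D_surj x : exists t, D t = x.
Proof. by exists (code r2 x); exact: dec_code. Qed.

Lemma check_complete e : (forall n, n.+1%:R != 0 :> k) -> Qe e != 0 -> exists c, holds (check e c).
Proof.
move=> char0 Q0.
case: (certificates_complete char0 (Pe e) (Ne e) Q0) => [[g [h /and3P[h0 e1 e2]]]|[u [v /and3P[u0 v0 e1]]]|[Xs]].
- exists (Node Leaf (Node (code r2 g) (code r2 h))).
  by rewrite /check /check1 /tif /= D_nz D_nz D_s !D_m !D_flow !dec_code h0 e1 D_nz D_s !D_m !D_dy !dec_code e2.
-
  have [|out ho] := @tout_complete (Node (ts (tm (tdy (code r2 u)) (code r2 v))
    (tm (code r2 u) (tdy (code r2 v)))) (tm (code r2 u) (code r2 v))) char0.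
    by rewrite /= D_m !dec_code mulf_neq0.
  exists (Node (Node Leaf Leaf) (Node (Node (code r2 u) (code r2 v)) out)).
  by rewrite /check /check2 /tif /= !D_nz D_hom !dec_code u0 v0 e1.
have [X <-] := decl_surj Xs (fun x => decl_surj x D_surj); rewrite -D_den -textE.
set E := tden e X => -[hX hU hN].
have E0 : D E != 0 by rewrite D_den; apply: (@pivots_neq0 _ _ _ (flow_pairing (Pe e) (Qe e))); move: hX; rewrite textE.
have [[Ls hL]|[u hu]] := hN (spine (tdeg e E Leaf)).
  have [L LE] := decl_surj Ls D_surj; rewrite -LE in hL.
  exists (Node (Node tt1 Leaf) (Node X L)); rewrite /check /check3 /tif /= -/E hX.
  by rewrite tfreeE /= decl_sys !D_m D_dyyF; move: hL; rewrite /cert_none expr2 => ->.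
have [Ls hL] := hU (spine (tdeg e E (code r2 u))); have [L LE] := decl_surj Ls D_surj.
have [out ho] := @tout_complete (Node (code r2 u) E) char0 E0.
exists (Node (Node tt1 tt1) (Node (Node X L) (Node (code r2 u) out))).
have Z : holds (nz (tfac (tfst e) (code r2 u) E)) = false.
  by rewrite D_nz D_fac dec_code hu eqxx.
have I : holds (tfree L (tsys e E (tdeg e E (code r2 u)))).
  by rewrite tfreeE decl_sys LE; exact: hL.
by rewrite /check /check4 /tif [tfst _]/= [tsnd _]/= -/E hX Z I.
Qed.

End Checks.

(** * Unbounded search *)

(** The levels enumerate the trees by height, each level containing the
    previous one. *)
Definition tnext L := Node Leaf
  (tfoldr (fun a c => tcat (tmap (fun b => Node a b) L) c) Leaf L).

Definition level n := iter n tnext Leaf.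

#[export] Instance Cf1_tnext : Cf1 tnext. Proof. by rewrite /tnext; cf_auto. Qed.

Definition occurs t L := List.In t (decl id L).

Lemma occurs_next t L : occurs t (tnext L) <->
  t = Leaf \/ exists a b, [/\ t = Node a b, occurs a L & occurs b L].
Proof.
rewrite /occurs /=; pose f a c := tcat (tmap (fun b => Node a b) L) c; rewrite -/f.
have H M : List.In t (decl id (tfoldr f Leaf M)) <->
    exists a b, [/\ t = Node a b, List.In a (decl id M) & List.In b (decl id L)].
  elim: M => [|x _ M IH] /=; first by split=> // -[a [b []]].
  rewrite [f x _]/f decl_cat List.in_app_iff IH (@decl_map _ _ id _ _ (Node x)) //.
  rewrite List.in_map_iff; split=> [[[b [<- hb]]|[a [b [-> ha hb]]]]|[a [b [-> [<-|ha] hb]]]].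
  - by exists x, b; split=> //; left.
  - by exists a, b; split=> //; right.
  - by left; exists b.
  - by right; exists a, b.
by rewrite H; split=> -[e|e]; [left|right|left|right].
Qed.

Lemma level_mono m n t : (m <= n)%N -> occurs t (level m) -> occurs t (level n).
Proof.
elim: m n t => [|m IH] [|n] t //= mn; rewrite !occurs_next => -[->|[a [b [-> ha hb]]]].
  by left.
by right; exists a, b; split=> //; apply: IH.
Qed.

Lemma in_level t : exists n, occurs t (level n).
Proof.
elim: t => [|a [m ma] b [n nb]]; first by exists 1%N; apply/occurs_next; left.
exists (maxn m n).+1; apply/occurs_next; right; exists a, b.
by split=> //; [apply: level_mono ma; exact: leq_maxl|apply: level_mono nb; exact: leq_maxr].
Qed.

(* The result is boxed, to distinguish failure from the tree Leaf. *)
Definition find (T : tree -> bool) L := tfoldr (fun x c => if T x then Node x Leaf else c) Leaf L.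

Lemma findP (T : tree -> bool) L t : occurs t L -> T t -> holds (find T L).
Proof.
rewrite /occurs /find; elim: L => //= x _ L IH [->|h] Tt; first by rewrite Tt.
by case: ifP => // _; exact: IH.
Qed.

Lemma find_correct (T : tree -> bool) L : holds (find T L) -> T (tfst (find T L)).
Proof. by rewrite /find; elim: L => //= x _ L IH; case: ifP. Qed.

(** The result depends on the predicate T alone: it is the first tree which
    satisfies T in the first level that contains one. *)
Definition pick (T : tree -> bool) : tree :=
  if pselect (exists n, holds (find T (level n))) is left e
  then tfst (find T (level (ex_minn e))) else Leaf.

Lemma pickP (T : tree -> bool) : (exists t, T t) -> T (pick T).
Proof.
move=> [t Tt]; rewrite /pick; case: pselect => [e|[]]; last first.
  by have [n h] := in_level t; exists n; exact: findP Tt.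
by case: ex_minnP => n h _; exact: find_correct.
Qed.

(** The loop ends at the level chosen by pick, which is the first one where the
    search succeeds. *)
Lemma search_program (f : tree -> tree -> tree) : Cf2 f ->
  exists p, forall e, (exists c, holds (f e c)) ->
    Defs.eval p e (pick (fun c => holds (f e c))).
Proof.
move=> cff; pose tfind e L := tfoldr (fun x c => tif (f e x) (Node x Leaf) c) Leaf L.
have cfind : Cf2 tfind by rewrite /tfind; cf_auto.
(* loop state: environment, level, result of the search in this level *)
pose body s := Node (tfst s) (Node (tnext (tfst (tsnd s)))
  (tfind (tfst s) (tnext (tfst (tsnd s))))).
have [pb eb] : cf body by rewrite /body; cf_auto.
have [pc ec] : cf (fun s => tif (tsnd (tsnd s)) Leaf tt1) by cf_auto.
have [pi ei] : cf (fun e => Node e (Node Leaf Leaf)) by cf_auto.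
have [po eo] : cf (fun s => tfst (tsnd (tsnd s))) by cf_auto.
exists (Defs.Comp po (Defs.Comp (While pc pb) pi)) => e [c hc].
set T := fun c => holds (f e c); rewrite /pick; case: pselect => [ex|[]]; last first.
  by have [n h] := in_level c; exists n; exact: findP h hc.
case: ex_minnP => m hm min.
pose state n := Node e (Node (level n) (find T (level n))).
apply: (@eval_Comp _ _ _ (state m)); last exact: eo (state m).
apply: (@eval_Comp _ _ _ (state 0%N)); first exact: ei.
suff loop d n : (n <= m)%N -> (m - n < d)%N -> Defs.eval (While pc pb) (state n) (state m).
  by apply: (loop m.+1 0%N); rewrite ?subn0.
elim: d n => // d IH n nm dn.
have := ec (state n); rewrite /tif /= => h.
have [emn|nmn] := eqVneq n m.
  by subst n; rewrite hm in h; exact: eval_While_stop.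
have {nm} nm : (n < m)%N by rewrite ltn_neqAle nmn.
have nh : holds (find T (level n)) = false by apply: contraTF nm => /min; rewrite -leqNgt.
rewrite nh in h; apply: (eval_While_step h (eb _)).
have -> : body (state n) = state n.+1 by [].
by apply: IH => //; lia.
Qed.

(** * The algorithm *)

Section Algorithm.
Variables (R : realType) (K : fieldExtType rat) (iota : {rmorphism K -> Cplx R}).
Notation rK := (cringP (cringP (cringK K))).
Notation bc := (bc iota).

(** What an answer asserts. Fail asserts the existence of a rational first
    integral, which excludes it under the hypothesis of the theorem. *)
Definition correct_answer (F : ratfun K) (N : nat) (a : answer K) : Prop :=
  let FC := base_change iota F in
  match a with
  | Factor B =>
      (exists D U, integrating_factor FC D U /\ log_dy D U (base_change iota B)) /\
      (~ has_rational_first_integral FC ->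
       (exists D U, [/\ integrating_factor FC D U, log_dy_deg_le N D U & algebraic D U]) ->
       exists D U, minimal_algebraic_integrating_factor FC D U /\
         log_dy D U (base_change iota B))
  | NoFactor => ~ exists D U, integrating_factor FC D U /\ log_dy_deg_le N D U
  | Fail => has_rational_first_integral FC
  end.

Lemma K_char0 n : n.+1%:R != 0 :> K.
Proof. by rewrite -(rmorph_nat (in_alg K)) fmorph_eq0 pnatr_eq0. Qed.

Lemma bounded_factor (F : ratfun K) P Q N D (U : Cplx R * Cplx R -> Cplx R) : is_frac F P Q ->
  integrating_factor (base_change iota F) D U -> log_dy_deg_le N D U ->
  exists B p q, [/\ log_dy D U B, is_frac B p q & bounded_solution iota P Q N p q].
Proof.
move=> FPQ [_ [f [ff Uf]]] [B [UB [p [q [Bpq lt pN qN]]]]]; exists B, p, q; split=> //.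
split=> //; first by case: Bpq.
exact: integrating_factor_eq ff Uf UB (base_change_frac iota FPQ) Bpq.
Qed.

Lemma quotient_frac (u E p q : polyxy K) : is_quotient u E p q -> E != 0 ->
  is_frac (tofrac p / tofrac q) u E.
Proof. by move=> [q0 e] E0; split=> //; exact: eq_is_frac. Qed.

Lemma factor_exists (F : ratfun K) P Q u E B : is_frac F P Q -> factor_eq P Q u E = 0 ->
  is_frac B u E ->
  exists D U, integrating_factor (base_change iota F) D U /\ log_dy D U (base_change iota B).
Proof.
move=> FPQ e BuE.
apply: (factor_eq_integrating_factor (base_change_frac iota FPQ) (base_change_frac iota BuE)).
by rewrite -bc_factor_eq e rmorph0.
Qed.

Lemma certified_answer (F : ratfun K) P Q N t : is_frac F P Q -> certified (cringK K) P Q N t ->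
  exists2 a, codes_answer a t & correct_answer F N a.
Proof.
move=> FPQ; have FC := base_change_frac iota FPQ; have Q0 : Q != 0 by case: FPQ.
case=> [g h /and3P[h0 /eqP e1 e2]|u v p q /and3P[u0 v0 /eqP e] pq|Xs b d Ls cX Eb bd cN
       |Xs b d Ls u p q cX Eb bd ud cU e pq].
- exists Fail => //=; apply: (@rational_first_integral _ _ _ _ (bc g) (bc h) FC).
  + by rewrite bc_eq0.
  + by rewrite -!bc_flow -!rmorphM -rmorphB /= e1 rmorph0.
  + by rewrite -!bc_polyDy -!rmorphM -rmorphB bc_eq0.
- have uv0 : u * v != 0 by rewrite mulf_neq0.
  have B := quotient_frac pq uv0; have e' := rational_factor_eq Q0 e.
  exists (Factor (tofrac p / tofrac q)).
    exists (Node (code rK p) (code rK q)) => //; exists p, q; split=> //.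
    by apply: is_frac_intro; case: pq.
  split; first exact: factor_exists FPQ e' B.
  move=> nR _; apply: (@minimal_factor _ _ _ _ _ _ _ 1 (bc u) (bc v) FC (base_change_frac iota B) nR).
  + by rewrite -bc_factor_eq e' rmorph0.
  + by [].
  + by rewrite bc_eq0.
  + by rewrite bc_eq0.
  + rewrite !(rmorphB, rmorphM) !bc_polyDy; apply: rational_power_eq.
    by rewrite -bc_hom_eq e rmorph0.
- exists NoFactor => //= -[D [U [UF UN]]].
  have [B [p [q [_ _ s]]]] := bounded_factor FPQ UF UN.
  exact: cert_none_correct cX Eb bd cN s.
have E0 : denominator P Q N Xs != 0 by exact: pivots_neq0 cX.
have B := quotient_frac pq E0.
exists (Factor (tofrac p / tofrac q)).
  exists (Node (code rK p) (code rK q)) => //; exists p, q; split=> //.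
  by apply: is_frac_intro; case: pq.
split; first exact: factor_exists FPQ e B.
move=> nR [D [U [UF UN [n [n0 [G UG]]]]]].
have [B0 [p0 [q0 [UB0 B0pq s]]]] := bounded_factor FPQ UF UN.
have pE := cert_unique_correct cX Eb bd ud cU e s.
have [g [h Ggh]] := frac_repr G.
have [_ [f [ff Uf]]] := UF.
have [pw g0] := algebraic_factor_eq ff Uf UB0 FC B0pq UG Ggh.
have E0' : bc (denominator P Q N Xs) != 0 by rewrite bc_eq0.
apply: (@minimal_factor _ _ _ _ _ _ _ n g h FC (base_change_frac iota B) nR) => //.
- by rewrite -bc_factor_eq e rmorph0.
- by case: Ggh.
- by apply: power_eq_transfer E0' _ _ pw; [case: B0pq|rewrite -pE].
Qed.

(** The equation of quotients tells whether two pairs of polynomials represent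
    the same rational function, so the first tree which represents F does not
    depend on the code of F that is given. *)
Definition tsame f c := tif (nz (cringK K) (tsnd c))
  (tif (nz (cringK K) (ts (cringK K) (tm (cringK K) (tfst c) (tsnd f))
     (tm (cringK K) (tfst f) (tsnd c)))) Leaf tt1) Leaf.

Instance Cf2_tsame : Cf2 tsame. Proof. by rewrite /tsame; cf_auto. Qed.

Definition represents (F : ratfun K) t := is_frac F (dec rK (tfst t)) (dec rK (tsnd t)).

Lemma tsameE F f c : represents F f -> holds (tsame f c) = `[< represents F c >].
Proof.
move=> Ff; have [f0 _] := Ff.
rewrite /tsame /tif !D_nz D_s !D_m subr_eq0; apply/idP/asboolP.
  case: ifP => // c0; case: ifP => // /negbT; rewrite negbK => /eqP e _; split=> //.
  by case: Ff => _ ->; apply: eq_is_frac => //; rewrite e.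
by move=> Fc; have [c0 _] := Fc; rewrite c0 (is_frac_eq Fc Ff) eqxx.
Qed.

Lemma algorithm : exists p : prog, forall F N, exists2 a, correct_answer F N a &
  forall z0 t, codes_input F z0 N t -> exists2 u, Defs.eval p t u & codes_answer a u.
Proof.
have [p1 h1] := search_program Cf2_tsame.
have [p2 h2] := search_program (Cf2_check (cringK K)).
have [p3 h3] : cf (fun s => tfst (check (cringK K) (tfst s) (tsnd s))) by cf_auto.
exists (Defs.Comp p3 (Defs.Comp (Pair Id p2) (Pair (Defs.Comp p1 Fst) (Defs.Comp Snd Snd)))) => F N.
pose cF := pick (fun c => `[< represents F c >]); pose e := Node cF (code_nat N).
have FcF : represents F cF.
  apply/asboolP; apply: (@pickP (fun c => `[< represents F c >])).
  have [P [Q FPQ]] := frac_repr F; exists (Node (code rK P) (code rK Q)); apply/asboolP.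
  by rewrite /represents !dec_code.
have ex : exists c, holds (check (cringK K) e c).
  by apply: check_complete K_char0 _; case: FcF.
pose c := pick (fun c => holds (check (cringK K) e c)).
have hc : holds (check (cringK K) e c) by exact: pickP ex.
have [a aP aF] := certified_answer FcF (check_correct hc).
rewrite spine_code in aF; exists a => // z0 t [u [P [Q [FPQ ->]]] ->]; exists (tfst (check (cringK K) e c)) => //.
apply: (@eval_Comp _ _ _ (Node e c)); last exact: h3 (Node e c).
apply: (@eval_Comp _ _ _ e).
  apply: eval_Pair; last by apply: eval_Comp; [exact: eval_Snd|exact: eval_Snd].
  apply: (@eval_Comp _ _ _ (Node (code rK P) (code rK Q))); first exact: eval_Fst.
  have Fu : represents F (Node (code rK P) (code rK Q)) by rewrite /represents !dec_code.
  have -> : cF = pick (fun c => holds (tsame (Node (code rK P) (code rK Q)) c)).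
    by congr pick; apply/funext => x; rewrite (tsameE _ Fu).
  apply: h1; exists cF; rewrite (tsameE _ Fu); exact/asboolP.
by apply: eval_Pair; [exact: eval_Id|exact: h2].
Qed.

End Algorithm.

Theorem proposition1 (R : realType) (K : fieldExtType rat)
    (iota : {rmorphism K -> Cplx R}) :
  exists IntegratingFactor : ratfun K -> K * K -> nat -> answer K,
    computable IntegratingFactor /\
    forall (F : ratfun K) (N : nat),
      let FC := base_change iota F in
      (forall z0 B, IntegratingFactor F z0 N = Factor B ->
         exists D U, integrating_factor FC D U /\ log_dy D U (base_change iota B)) /\
      (~ has_rational_first_integral FC ->
       [/\ (* (1) *)
           (exists D U, integrating_factor FC D U /\ log_dy_deg_le N D U) ->
           forall z0,
             (exists B, IntegratingFactor F z0 N = Factor B /\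
                exists D U, integrating_factor FC D U /\ log_dy D U (base_change iota B)) \/
             IntegratingFactor F z0 N = Fail,
           (* (2) *)
           (exists D U, [/\ integrating_factor FC D U, log_dy_deg_le N D U
                          & algebraic D U]) ->
           forall z0,
             (exists B, IntegratingFactor F z0 N = Factor B /\
                exists D U, minimal_algebraic_integrating_factor FC D U /\
                  log_dy D U (base_change iota B)) \/
             IntegratingFactor F z0 N = Fail,
           (* (3) *)
           forall z0, IntegratingFactor F z0 N = NoFactor ->
             ~ exists D U, integrating_factor FC D U /\ log_dy_deg_le N D U
         & (* (4) *)
           exists Z : set (Cplx R * Cplx R), codim1_algebraic_set Z /\
             forall z0, IntegratingFactor F z0 N = Fail ->
               Z (iota z0.1, iota z0.2)]).
Proof.
have [p hp] := algorithm iota.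
have [alg algP] := choice (fun x : ratfun K * nat => let: ex_intro2 a h1 h2 := hp x.1 x.2 in
  ex_intro _ a (conj h1 h2)).
exists (fun F _ N => alg (F, N)); split.
  by exists p => F z0 N t; have [_] := algP (F, N); apply.
move=> F N FC; have [] := algP (F, N); rewrite /= -/FC => good _.
split; first by move=> _ B e; move: good; rewrite e => -[].
move=> nR; split.
- move=> [D [U [UF UN]]] z0; left; case e : (alg (F, N)) good => [B||] /=.
  + by case=> h _; exists B.
  + by case; exists D, U.
  + by [].
- move=> alg_ex z0; left; case e : (alg (F, N)) good => [B||] /=.
  + by case=> _ h; exists B; split=> //; exact: h.
  + by case; have [D [U [UF UN _]]] := alg_ex; exists D, U.
  + by [].
- by move=> z0 e; move: good; rewrite e.
exists [set z | ('X : polyxy (Cplx R)).[z.1, z.2] = 0]; split.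
  exists 'X; split=> // -[c /(congr1 (fun q : polyxy (Cplx R) => q`_1))].
  by rewrite coefX coefC => /eqP; rewrite oner_eq0.
by move=> z0 e; case: nR; move: good; rewrite e.
Qed.
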